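(* Let $q\ge1$ and $p$ be integers with $\gcd(p,q)=1$, and let $k=k_1+k_2$ with $k_1,k_2$ positive integers. If $k_1\Delta'(p,q)$ and $k_2\Delta'(p,q)$ both have unimodular triangulations with standard boundary, then so does $k\Delta'(p,q)$ (all with respect to $\Lambda_{p,q}$).
   Context: Let $p'=(-p)\bmod q$, $\Lambda_{p,q}=q\mathbb{Z}\times q\mathbb{Z}\times\mathbb{Z}+\mathbb{Z}(p',1,0)$, and $\Delta'(p,q)=\operatorname{conv}\{(0,0,0),(q,0,0),(0,0,1),(0,q,1)\}$, an empty lattice tetrahedron. Triangulations have vertices in the lattice; a tetrahedron is unimodular if its vertices form an affine basis of the lattice. A triangulation of $k\Delta$ ($\Delta$ an empty lattice tetrahedron) has standard boundary if every edge contained in the boundary of $k\Delta$ is parallel to an edge of $\Delta$. *)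

(* Defs.v *)
From Stdlib Require Import Reals ZArith List.
Import ListNotations.
Open Scope R_scope.

Definition zpt := (Z * Z * Z)%type.
Definition rpt := (R * R * R)%type.

Definition toR (v : zpt) : rpt := let '(a, b, c) := v in (IZR a, IZR b, IZR c).
Definition radd (x y : rpt) : rpt :=
  let '(a, b, c) := x in let '(a', b', c') := y in (a + a', b + b', c + c').
Definition rscale (t : R) (x : rpt) : rpt := let '(a, b, c) := x in (t * a, t * b, t * c).
Definition rsub (x y : rpt) : rpt := radd x (rscale (-1) y).
Definition rzero : rpt := (0, 0, 0).

Definition zadd (x y : zpt) : zpt :=
  let '(a, b, c) := x in let '(a', b', c') := y in (a + a', b + b', c + c')%Z.
Definition zscale (t : Z) (x : zpt) : zpt := let '(a, b, c) := x in (t * a, t * b, t * c)%Z.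
Definition zsub (x y : zpt) : zpt := zadd x (zscale (-1) y).

Definition comb (w : list R) (S : list rpt) : rpt :=
  fold_right (fun tx acc => radd (rscale (fst tx) (snd tx)) acc) rzero (combine w S).

Definition conv (S : list rpt) (x : rpt) : Prop :=
  exists w : list R, length w = length S /\ Forall (fun t => 0 <= t) w /\
    fold_right Rplus 0 w = 1 /\ x = comb w S.

Definition pprime (p q : Z) : Z := Z.modulo (- p) q.
Definition Lambda (p q : Z) (v : zpt) : Prop :=
  exists x y z m : Z, v = (q * x + m * pprime p q, q * y + m, z)%Z.

Definition DeltaV (q : Z) : list zpt := [(0,0,0); (q,0,0); (0,0,1); (0,q,1)]%Z.

Definition aff_indep (T : list zpt) : Prop :=
  match T with
  | [v0; v1; v2; v3] =>
      forall a b c : R,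
        radd (rscale a (rsub (toR v1) (toR v0)))
          (radd (rscale b (rsub (toR v2) (toR v0))) (rscale c (rsub (toR v3) (toR v0))))
        = rzero -> a = 0 /\ b = 0 /\ c = 0
  | _ => False
  end.

Definition unimodular (p q : Z) (T : list zpt) : Prop :=
  match T with
  | [v0; v1; v2; v3] =>
      aff_indep T /\
      forall w : zpt, Lambda p q w <->
        exists n1 n2 n3 : Z,
          w = zadd v0 (zadd (zscale n1 (zsub v1 v0))
                        (zadd (zscale n2 (zsub v2 v0)) (zscale n3 (zsub v3 v0))))
  | _ => False
  end.

(* Tr is a triangulation of conv(P) with vertices in Lambda: lattice
   tetrahedra covering conv(P) exactly, any two meeting in a common face
   (a common face of two simplices = conv of a common subset of vertices). *)
Definition triangulation (p q : Z) (P : list zpt) (Tr : list (list zpt)) : Prop :=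
  (forall T, In T Tr -> Forall (Lambda p q) T /\ aff_indep T) /\
  (forall x, conv (map toR P) x <-> exists T, In T Tr /\ conv (map toR T) x) /\
  (forall T1 T2, In T1 Tr -> In T2 Tr ->
     exists F : list zpt, incl F T1 /\ incl F T2 /\
       forall x, (conv (map toR T1) x /\ conv (map toR T2) x) <-> conv (map toR F) x).

Definition dist_inf (x y : rpt) : R :=
  let '(a, b, c) := x in let '(a', b', c') := y in
  Rmax (Rabs (a - a')) (Rmax (Rabs (b - b')) (Rabs (c - c'))).

Definition boundary (S : rpt -> Prop) (x : rpt) : Prop :=
  (forall eps, 0 < eps -> exists y, dist_inf x y < eps /\ S y) /\
  (forall eps, 0 < eps -> exists y, dist_inf x y < eps /\ ~ S y).

Definition standard_boundary (Delta P : list zpt) (Tr : list (list zpt)) : Prop :=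
  forall T u v, In T Tr -> In u T -> In v T -> u <> v ->
    (forall x, conv [toR u; toR v] x -> boundary (conv (map toR P)) x) ->
    exists a b, In a Delta /\ In b Delta /\ a <> b /\
      exists t : R, rsub (toR u) (toR v) = rscale t (rsub (toR a) (toR b)).

Definition has_unimod_std_triang (p q k : Z) : Prop :=
  exists Tr : list (list zpt),
    triangulation p q (map (zscale k) (DeltaV q)) Tr /\
    (forall T, In T Tr -> unimodular p q T) /\
    standard_boundary (DeltaV q) (map (zscale k) (DeltaV q)) Tr.

(* Main.v *)
(* Put k = k1 + k2. Inside k Delta' = {x, y >= 0, y <= q z, x + q z <= q k} place the given
   triangulations on k1 Delta' = {x + q z <= q k1} and on the translate {x >= q k1} of k2 Delta', at the
   two ends of the edge in the plane z = 0. The planes x = q i, y = q j, x + q z = q s cut the rest into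
   lattice translates of two bodies
     D_e = {0 <= x <= q, 0 <= x + q z <= q, 0 <= y <= q + e q z},   e = 0 or 1.
   On each of these planes every lattice point is a corner (x and y divisible by q), and all edges between
   corners belong to the Kuhn triangulation, so the pieces match automatically; it remains to triangulate
   D_e. The points of the open square 0 < x, y < q, z = 0 of the lattice have one point on each line
   x = m; joining them in this order gives a polygonal chain. It is completed to two paths across the
   square, one through the lower and one through the upper corners, and the edges of these paths are
   joined with edges of D_e parallel to the y-axis at height z = 1 or -1: since the steps of the paths
   have width 1 in x, these tetrahedra are unimodular. The regions cut off by the paths are triangulated
   arbitrarily and coned: their q - 1 triangles have areas which are positive multiples of q with sum
   q (q - 1), hence all equal to q. *)

Require Import Defs.
From Stdlib Require Import Reals ZArith List Lra Lia Psatz Classical.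
Import ListNotations.
Local Open Scope R_scope.

(** * Weighted point sets and coherence *)

(** Matching is the obstacle: the two given triangulations are unknown inside, so the middle part
    can rely only on what they show on the two facets facing it. On such a facet every lattice point
    is a corner, as [p'] is invertible modulo [q]. A standard edge between corners is an integer
    multiple of an edge of Delta', and the multiple is 1 or -1 because edges of unimodular simplices
    are primitive. So both sides show Kuhn edges only. Pairwise Kuhn edges suffice for a fit: the
    planes on which y/q, z, x/q + z or a difference of two of these is an integer never cut a
    simplex with such edges, so it is a face of a single Kuhn simplex. Face-to-face conditions are
    stated for finite measures on the vertices instead of point sets: two simplices fit when mass
    and first moments determine the measure. Separation by planes, splitting a measure into parts
    and joins with apices then become short linear arguments. The polygonal chain is invariant under
    the half-turn of the square. This symmetry yields the sum of the areas and about halves the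
    comparisons between the pieces. *)

Definition px (v : zpt) : Z := fst (fst v).
Definition py (v : zpt) : Z := snd (fst v).
Definition pz (v : zpt) : Z := snd v.
Definition fx (v : zpt) : R := IZR (px v).
Definition fy (v : zpt) : R := IZR (py v).
Definition fz (v : zpt) : R := IZR (pz v).
Definition f1 (v : zpt) : R := 1.

Definition measure := list (R * zpt).
Definition integral (mu : measure) (g : zpt -> R) : R :=
  fold_right (fun p a => fst p * g (snd p) + a) 0 mu.
Definition supported (P : zpt -> Prop) (mu : measure) : Prop :=
  Forall (fun p => 0 <= fst p /\ P (snd p)) mu.

Arguments integral : simpl never.

Lemma integral_cons p mu g : integral (p :: mu) g = fst p * g (snd p) + integral mu g.
Proof. reflexivity. Qed.

Lemma integral_nil g : integral [] g = 0.
Proof. reflexivity. Qed.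

Lemma integral_lin mu g h c : integral mu (fun v => g v + c * h v) = integral mu g + c * integral mu h.
Proof. induction mu as [|p mu IH]; [unfold integral; simpl; lra | rewrite !integral_cons, IH; lra]. Qed.

Lemma integral_eq mu g h : (forall v, g v = h v) -> integral mu g = integral mu h.
Proof.
  intro H. induction mu as [|p mu IH]; [reflexivity | rewrite !integral_cons, IH, H; reflexivity].
Qed.

Lemma integral_ext P mu g h : supported P mu -> (forall v, P v -> g v = h v) -> integral mu g = integral mu h.
Proof.
  intros Hm Hg; induction Hm as [|p mu [Hw Hp] Hm IH]; [reflexivity|].
  rewrite !integral_cons, IH, (Hg _ Hp); reflexivity.
Qed.

Lemma integral_le P mu g h : supported P mu -> (forall v, P v -> g v <= h v) -> integral mu g <= integral mu h.
Proof.
  intros Hm Hg; induction Hm as [|p mu [Hw Hp] Hm IH]; [apply Rle_refl|].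
  rewrite !integral_cons. generalize (Rmult_le_compat_l _ _ _ Hw (Hg _ Hp)). lra.
Qed.

Lemma integral_zero mu : integral mu (fun _ => 0) = 0.
Proof. induction mu as [|p mu IH]; [reflexivity | rewrite integral_cons, IH; lra]. Qed.

Lemma integral_nonneg P mu g : supported P mu -> (forall v, P v -> 0 <= g v) -> 0 <= integral mu g.
Proof. intros Hm Hg. rewrite <- (integral_zero mu). eapply integral_le; eauto. Qed.

Lemma supported_mono P Q mu : (forall v, P v -> Q v) -> supported P mu -> supported Q mu.
Proof. intros H Hm. eapply Forall_impl; [|exact Hm]. simpl; intuition. Qed.

Lemma supported_split P Q mu : supported (fun v => P v \/ Q v) mu ->
  exists m1 m2, supported P m1 /\ supported Q m2 /\ forall g, integral mu g = integral m1 g + integral m2 g.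
Proof.
  intros Hm; induction Hm as [|p mu [Hw Hp] Hm (m1 & m2 & H1 & H2 & H)].
  - exists [], []. repeat split; try constructor. intro g; unfold integral; simpl; lra.
  - destruct Hp as [Hp|Hp].
    + exists (p :: m1), m2. repeat split; try (constructor; auto); auto.
      intro g; rewrite !integral_cons, H; lra.
    + exists m1, (p :: m2). repeat split; try (constructor; auto); auto.
      intro g; rewrite !integral_cons, H; lra.
Qed.

Lemma supported_restrict P mu h : supported P mu -> (forall v, P v -> 0 <= h v) -> integral mu h = 0 ->
  exists m, supported (fun v => P v /\ h v = 0) m /\ forall g, integral mu g = integral m g.
Proof.
  intros Hm Hh; induction Hm as [|p mu [Hw Hp] Hm IH]; intro H0.
  - exists []. split; [constructor | reflexivity].
  - rewrite integral_cons in H0.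
    assert (H1 : 0 <= integral mu h) by (eapply integral_nonneg; eauto).
    assert (H2 : 0 <= fst p * h (snd p)) by (apply Rmult_le_pos; auto).
    destruct IH as (m & Hm' & Hg); [lra|].
    destruct (Req_dec (fst p) 0) as [Hz|Hz].
    + exists m. split; auto. intro g; rewrite integral_cons, Hz, Hg; lra.
    + exists (p :: m). split.
      * constructor; auto. repeat split; auto.
        assert (fst p * h (snd p) = 0) by lra. apply Rmult_integral in H; tauto.
      * intro g; rewrite !integral_cons, Hg; reflexivity.
Qed.

Lemma supported_map P (f : zpt -> zpt) mu Q : supported P mu -> (forall v, P v -> Q (f v)) ->
  supported Q (map (fun p => (fst p, f (snd p))) mu).
Proof.
  intros Hm Hf. apply Forall_map. eapply Forall_impl; [|exact Hm]. simpl; intuition.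
Qed.

Lemma integral_map (f : zpt -> zpt) mu g :
  integral (map (fun p => (fst p, f (snd p))) mu) g = integral mu (fun v => g (f v)).
Proof. induction mu as [|p mu IH]; [reflexivity | simpl; rewrite !integral_cons, IH; reflexivity]. Qed.

Definition affine (a b c d : R) (v : zpt) : R := a + b * fx v + c * fy v + d * fz v.

Lemma integral_affine mu a b c d :
  integral mu (affine a b c d) = a * integral mu f1 + b * integral mu fx + c * integral mu fy + d * integral mu fz.
Proof.
  unfold affine, f1; induction mu as [|p mu IH]; [unfold integral; simpl; lra | rewrite !integral_cons, IH; lra].
Qed.

(* Two simplices are coherent iff a common point of their convex hulls has the same barycentric
   coordinates in both, which is the face-to-face condition. Total masses are not normalised, so that
   a measure can be split into parts. *)
Definition coherent (P Q : zpt -> Prop) : Prop :=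
  forall mu nu, supported P mu -> supported Q nu ->
    integral mu f1 = integral nu f1 -> integral mu fx = integral nu fx -> integral mu fy = integral nu fy -> integral mu fz = integral nu fz ->
    forall g, integral mu g = integral nu g.

Lemma coherent_sym P Q : coherent P Q -> coherent Q P.
Proof. intros H mu nu Hm Hn H1 H2 H3 H4 g. symmetry. apply H; auto. Qed.

Lemma coherent_mono P Q P' Q' : (forall v, P' v -> P v) -> (forall v, Q' v -> Q v) ->
  coherent P Q -> coherent P' Q'.
Proof. intros HP HQ H mu nu Hm Hn. apply H; eapply supported_mono; eauto. Qed.

(** Equal moments give the separating function equal integrals, one nonpositive and the other
    nonnegative. Both are 0, so both measures live on the separating plane. *)
Lemma coherent_sep a b c d P Q :
  (forall v, P v -> affine a b c d v <= 0) -> (forall v, Q v -> 0 <= affine a b c d v) ->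
  coherent (fun v => P v /\ affine a b c d v = 0) (fun v => Q v /\ affine a b c d v = 0) -> coherent P Q.
Proof.
  intros HP HQ H mu nu Hm Hn H1 H2 H3 H4 g.
  assert (HE : integral mu (affine a b c d) = integral nu (affine a b c d)) by (rewrite !integral_affine, H1, H2, H3, H4; reflexivity).
  assert (Hn0 : 0 <= integral nu (affine a b c d)) by (eapply integral_nonneg; eauto).
  assert (Hop : integral mu (affine (-a) (-b) (-c) (-d)) = - integral mu (affine a b c d)) by (rewrite !integral_affine; ring).
  assert (Hpt : forall v, affine (-a) (-b) (-c) (-d) v = - affine a b c d v) by (intro; unfold affine; ring).
  assert (Hm0 : 0 <= integral mu (affine (-a) (-b) (-c) (-d)))
    by (eapply integral_nonneg; eauto; intros v Hv; rewrite Hpt; specialize (HP v Hv); lra).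
  destruct (supported_restrict P mu (affine (-a) (-b) (-c) (-d)) Hm) as (m & Hm' & Em).
  { intros v Hv; rewrite Hpt; specialize (HP v Hv); lra. } { lra. }
  destruct (supported_restrict Q nu (affine a b c d) Hn HQ) as (n & Hn' & En); [lra|].
  rewrite Em, En. apply H; try (rewrite <- Em, <- En; assumption); auto.
  eapply supported_mono; [|exact Hm']. intros v [Hv Hv0]; rewrite Hpt in Hv0; split; [auto|lra].
Qed.

Lemma px_zadd t v : px (zadd t v) = (px t + px v)%Z.
Proof. destruct t as [[? ?] ?], v as [[? ?] ?]; reflexivity. Qed.
Lemma py_zadd t v : py (zadd t v) = (py t + py v)%Z.
Proof. destruct t as [[? ?] ?], v as [[? ?] ?]; reflexivity. Qed.
Lemma pz_zadd t v : pz (zadd t v) = (pz t + pz v)%Z.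
Proof. destruct t as [[? ?] ?], v as [[? ?] ?]; reflexivity. Qed.

Lemma supported_translate_inv t P mu : supported (fun v => exists w, P w /\ v = zadd t w) mu ->
  exists m, supported P m /\ forall h, integral mu h = integral m (fun v => h (zadd t v)).
Proof.
  intros Hm; induction Hm as [|p mu [Hw (w & Hp & He)] Hm (m & H1 & H2)].
  - exists []. split; [constructor|reflexivity].
  - exists ((fst p, w) :: m). split; [constructor; auto|].
    intro h; rewrite !integral_cons, H2, He; reflexivity.
Qed.

Lemma integral_shift m c g : integral m (fun v => c + g v) = c * integral m f1 + integral m g.
Proof.
  unfold f1; induction m as [|p m IH]; [unfold integral; simpl; lra | rewrite !integral_cons, IH; lra].
Qed.

Lemma integral_translate t m :
  integral m (fun v => f1 (zadd t v)) = integral m f1 /\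
  integral m (fun v => fx (zadd t v)) = fx t * integral m f1 + integral m fx /\
  integral m (fun v => fy (zadd t v)) = fy t * integral m f1 + integral m fy /\
  integral m (fun v => fz (zadd t v)) = fz t * integral m f1 + integral m fz.
Proof.
  rewrite <- !integral_shift. repeat split; apply integral_eq; intro v; unfold fx, fy, fz;
    rewrite ?px_zadd, ?py_zadd, ?pz_zadd, ?plus_IZR; reflexivity.
Qed.

Lemma coherent_translate t P Q : coherent P Q ->
  coherent (fun v => exists w, P w /\ v = zadd t w) (fun v => exists w, Q w /\ v = zadd t w).
Proof.
  intros H mu nu Hm Hn H1 H2 H3 H4 g.
  destruct (supported_translate_inv _ _ _ Hm) as (m & Hm' & Em).
  destruct (supported_translate_inv _ _ _ Hn) as (n & Hn' & En).
  rewrite Em, En in *.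
  destruct (integral_translate t m) as (A1 & A2 & A3 & A4).
  destruct (integral_translate t n) as (B1 & B2 & B3 & B4).
  rewrite A1, B1 in H1. rewrite A2, B2, H1 in H2. rewrite A3, B3, H1 in H3. rewrite A4, B4, H1 in H4.
  apply H; auto; lra.
Qed.

(** * Simplices and convex hulls *)

Lemma comb_integral w T : comb w (map toR T) =
  (integral (combine w T) fx, integral (combine w T) fy, integral (combine w T) fz).
Proof.
  revert w; induction T as [|[[a b] c] T IH]; intros [|x w]; try reflexivity.
  unfold comb in *; simpl. rewrite IH. rewrite !integral_cons. reflexivity.
Qed.

Lemma sum_integral w T : length w = length T -> fold_right Rplus 0 w = integral (combine w T) f1.
Proof.
  revert w; induction T as [|v T IH]; intros [|x w] H; try discriminate; [reflexivity|].
  simpl. rewrite integral_cons, IH by (simpl in H; lia). unfold f1; simpl. ring.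
Qed.

Lemma supported_combine w T : length w = length T -> Forall (fun t => 0 <= t) w ->
  supported (fun v => In v T) (combine w T).
Proof.
  intros Hl Hw. apply Forall_forall. intros [x v] H. simpl. split.
  - rewrite Forall_forall in Hw. apply Hw. eapply in_combine_l; eauto.
  - eapply in_combine_r; eauto.
Qed.

(** A measure may list a vertex repeatedly or not at all; here its atoms are collected into one
    weight list aligned with [T], the shape that [conv] asks for. *)
Lemma supported_weights T mu : supported (fun v => In v T) mu ->
  exists w, length w = length T /\ Forall (fun t => 0 <= t) w /\
    forall g, integral mu g = integral (combine w T) g.
Proof.
  assert (H0 : forall T : list zpt, length (repeat 0 (length T)) = length T /\
    Forall (fun t => 0 <= t) (repeat 0 (length T)) /\
    forall g, 0 = integral (combine (repeat 0 (length T)) T) g).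
  { clear. induction T as [|v T (H1 & H2 & H3)]; simpl; repeat split; auto.
    - constructor; auto; lra.
    - intro g. rewrite integral_cons, <- H3; simpl; lra. }
  assert (H1 : forall v a T, 0 <= a -> In v T ->
    exists w, length w = length T /\ Forall (fun t => 0 <= t) w /\
    forall g, a * g v = integral (combine w T) g).
  { clear T mu. intros v a T Ha; induction T as [|u T IH]; intros Hi; [destruct Hi|].
    destruct Hi as [->|Hi].
    - exists (a :: repeat 0 (length T)). destruct (H0 T) as (A & B & C).
      repeat split; simpl; auto. intro g; rewrite integral_cons, <- C; simpl; lra.
    - destruct (IH Hi) as (w & A & B & C). exists (0 :: w). repeat split; simpl; auto.
      + constructor; auto; lra.
      + intro g; rewrite integral_cons, <- C; simpl; lra. }
  assert (H2 : forall (w w' : list R) T, length w = length T -> length w' = length T ->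
    Forall (fun t => 0 <= t) w -> Forall (fun t => 0 <= t) w' ->
    exists w'', length w'' = length T /\ Forall (fun t => 0 <= t) w'' /\
    forall g, integral (combine w'' T) g = integral (combine w T) g + integral (combine w' T) g).
  { clear. intros w w' T; revert w w'.
    induction T as [|v T IH]; intros [|a w] [|a' w'] L L' F F'; try discriminate.
    - exists []. repeat split; auto. intro; unfold integral; simpl; lra.
    - inversion F; inversion F'; subst. simpl in L, L'.
      destruct (IH w w') as (w'' & A & B & C); auto.
      exists (a + a' :: w''). repeat split; simpl; auto.
      + constructor; auto; lra.
      + intro g; rewrite !integral_cons, C; simpl; lra. }
  intro Hm; induction Hm as [|p mu [Hw Hp] Hm (w & A & B & C)].
  - exists (repeat 0 (length T)). apply H0.
  - destruct (H1 _ _ _ Hw Hp) as (w' & A' & B' & C').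
    destruct (H2 w' w T) as (w'' & A'' & B'' & C''); auto.
    exists w''. repeat split; auto. intro g; rewrite integral_cons, C'', C', C; reflexivity.
Qed.

Definition barycentre (mu : measure) (x : rpt) : Prop :=
  integral mu f1 = 1 /\ x = (integral mu fx, integral mu fy, integral mu fz).

Lemma conv_barycentre T x : conv (map toR T) x <-> exists mu, supported (fun v => In v T) mu /\ barycentre mu x.
Proof.
  split.
  - intros (w & L & F & S & ->). rewrite length_map in L.
    exists (combine w T). split; [apply supported_combine; auto|].
    split; [rewrite <- sum_integral; auto | apply comb_integral].
  - intros (mu & Hm & H1 & ->). destruct (supported_weights _ _ Hm) as (w & L & F & C).
    exists w. rewrite length_map, comb_integral, (sum_integral _ T), !C in *; auto.
Qed.

Lemma zpt_eq_dec (u v : zpt) : {u = v} + {u <> v}.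
Proof. repeat decide equality. Qed.

Lemma coherent_common_face T1 T2 : coherent (fun v => In v T1) (fun v => In v T2) ->
  exists F : list zpt, incl F T1 /\ incl F T2 /\
    forall x, (conv (map toR T1) x /\ conv (map toR T2) x) <-> conv (map toR F) x.
Proof.
  intro H.
  set (F := filter (fun v => if in_dec zpt_eq_dec v T2 then true else false) T1).
  assert (HF : forall v, In v F <-> In v T1 /\ In v T2).
  { intro v; unfold F; rewrite filter_In. destruct (in_dec zpt_eq_dec v T2); intuition discriminate. }
  exists F. split; [|split].
  - intros v Hv; apply HF in Hv; tauto.
  - intros v Hv; apply HF in Hv; tauto.
  - intro x. rewrite !conv_barycentre. split.
    + intros [(mu & Hm & M1 & M2) (nu & Hn & N1 & N2)].
      rewrite M2 in N2. injection N2 as X Y Z.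
      (* The indicator of the vertices outside [T2] has integral 0 against [nu], hence by coherence
         against [mu]: the point uses only common vertices. *)
      set (h := fun v => if in_dec zpt_eq_dec v T2 then 0 else 1).
      assert (Hh : integral mu h = 0).
      { rewrite (H mu nu) by (auto; congruence). rewrite <- (integral_zero nu).
        apply (integral_ext _ _ _ _ Hn). intros v Hv; unfold h. destruct (in_dec zpt_eq_dec v T2); tauto. }
      destruct (supported_restrict _ mu h Hm) as (m & Hm' & Em); auto.
      { intros v _; unfold h; destruct (in_dec zpt_eq_dec v T2); lra. }
      exists m. split.
      * eapply supported_mono; [|exact Hm']. unfold h; intros v [A B]; apply HF; split; auto.
        destruct (in_dec zpt_eq_dec v T2); [auto|lra].
      * split; rewrite <- !Em; auto.
    + intros (mu & Hm & B). split; exists mu; split; auto; eapply supported_mono; try exact Hm;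
        intros v Hv; apply HF in Hv; tauto.
Qed.

Lemma supported4 v0 v1 v2 v3 mu : supported (fun v => In v [v0; v1; v2; v3]) mu ->
  exists w0 w1 w2 w3, 0 <= w0 /\ 0 <= w1 /\ 0 <= w2 /\ 0 <= w3 /\
   forall g, integral mu g = w0 * g v0 + w1 * g v1 + w2 * g v2 + w3 * g v3.
Proof.
  intro Hm. destruct (supported_weights _ _ Hm) as (w & L & F & C).
  destruct w as [|w0 [|w1 [|w2 [|w3 [|w4 w]]]]]; try discriminate.
  repeat match goal with H : Forall _ (_ :: _) |- _ => inversion H; clear H; subst end.
  exists w0, w1, w2, w3. repeat split; auto. intro g; rewrite C; simpl; rewrite !integral_cons.
  unfold integral; simpl; ring.
Qed.

(** Uniqueness of barycentric coordinates, in homogeneous form: equal masses replace the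
    normalisation to 1. *)
Lemma coherent_indep T : aff_indep T -> coherent (fun v => In v T) (fun v => In v T).
Proof.
  destruct T as [|v0 [|v1 [|v2 [|v3 [|v4 T]]]]]; try (intros []; fail).
  intros H mu nu Hm Hn H1 H2 H3 H4 g.
  destruct (supported4 _ _ _ _ _ Hm) as (a0 & a1 & a2 & a3 & _ & _ & _ & _ & A).
  destruct (supported4 _ _ _ _ _ Hn) as (b0 & b1 & b2 & b3 & _ & _ & _ & _ & B).
  rewrite !A, !B in *. unfold f1, fx, fy, fz, px, py, pz in *.
  destruct v0 as [[x0 y0] z0], v1 as [[x1 y1] z1], v2 as [[x2 y2] z2], v3 as [[x3 y3] z3].
  simpl in *.
  destruct (H (a1 - b1) (a2 - b2) (a3 - b3)) as (E1 & E2 & E3).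
  - unfold rzero. f_equal; [f_equal|].
    + replace a0 with (b0 + b1 + b2 + b3 - a1 - a2 - a3) in H2 by lra. lra.
    + replace a0 with (b0 + b1 + b2 + b3 - a1 - a2 - a3) in H3 by lra. lra.
    + replace a0 with (b0 + b1 + b2 + b3 - a1 - a2 - a3) in H4 by lra. lra.
  - replace a1 with b1 by lra. replace a2 with b2 by lra. replace a3 with b3 by lra.
    replace a0 with b0 by lra. reflexivity.
Qed.

(** After scaling to mass 1, the common point has coordinates over [F]. Since [F] lies in both
    simplices, uniqueness in [T1] and in [T2] identifies both measures with that one. *)
Lemma common_face_coherent T1 T2 F : aff_indep T1 -> aff_indep T2 -> incl F T1 -> incl F T2 ->
  (forall x, (conv (map toR T1) x /\ conv (map toR T2) x) -> conv (map toR F) x) ->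
  coherent (fun v => In v T1) (fun v => In v T2).
Proof.
  intros I1 I2 F1 F2 H mu nu Hm Hn H1 H2 H3 H4 g.
  assert (Hpos : 0 <= integral mu f1) by (eapply integral_nonneg; eauto; intros; unfold f1; lra).
  (* Measures of mass 0 cannot be normalised, but all their integrals vanish. *)
  assert (Z : forall P m, supported P m -> integral m f1 = 0 -> forall g, integral m g = 0).
  { clear. intros P m Hm H g. destruct (supported_restrict P m f1 Hm) as (m' & Hm' & Em); auto.
    - intros; unfold f1; lra.
    - destruct m' as [|p m']; [rewrite Em; reflexivity|].
      inversion Hm'; subst. unfold f1 in *; lra. }
  destruct (Req_dec (integral mu f1) 0) as [H0|H0].
  { rewrite (Z _ _ Hm H0), (Z _ _ Hn); auto. lra. }
  set (s := / integral mu f1).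
  assert (Hs : 0 < s) by (apply Rinv_0_lt_compat; lra).
  set (sc := fun m : measure => map (fun p => (s * fst p, snd p)) m).
  assert (Esc : forall m g, integral (sc m) g = s * integral m g).
  { intros m h; unfold sc; induction m as [|p m IH]; [unfold integral; simpl; lra|].
    simpl; rewrite !integral_cons, IH; simpl; ring. }
  assert (Osc : forall P m, supported P m -> supported P (sc m)).
  { intros P m Hp. apply Forall_map. eapply Forall_impl; [|exact Hp]. simpl. intros p [A B].
    split; auto. apply Rmult_le_pos; lra. }
  assert (Hs1 : s * integral mu f1 = 1) by (unfold s; field; auto).
  destruct (proj1 (conv_barycentre F (integral (sc mu) fx, integral (sc mu) fy, integral (sc mu) fz))) as (xi & Hx & X1 & X2).
  { apply H. split; apply conv_barycentre.
    - exists (sc mu). split; auto. split; auto. rewrite Esc; auto.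
    - exists (sc nu). split; auto. split; rewrite !Esc, <- ?H1, ?H2, ?H3, ?H4; auto. }
  injection X2 as X Y W. rewrite !Esc in *.
  assert (A : integral (sc mu) g = integral xi g).
  { apply (coherent_indep T1 I1); auto; rewrite ?Esc; try congruence.
    eapply supported_mono; [|exact Hx]; auto. }
  assert (B : integral (sc nu) g = integral xi g).
  { apply (coherent_indep T2 I2); auto; rewrite ?Esc; try congruence.
    eapply supported_mono; [|exact Hx]; auto. }
  rewrite Esc in *. apply Rmult_eq_reg_l with s; lra.
Qed.

(** * Volume and unimodularity *)

Definition det3 (a b c : zpt) : Z :=
  (px a * (py b * pz c - py c * pz b) - py a * (px b * pz c - px c * pz b)
   + pz a * (px b * py c - px c * py b))%Z.
Definition vol (v0 v1 v2 v3 : zpt) : Z := det3 (zsub v1 v0) (zsub v2 v0) (zsub v3 v0).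

Lemma vol_indep v0 v1 v2 v3 : vol v0 v1 v2 v3 <> 0%Z -> aff_indep [v0; v1; v2; v3].
Proof.
  destruct v0 as [[x0 y0] z0], v1 as [[x1 y1] z1], v2 as [[x2 y2] z2], v3 as [[x3 y3] z3].
  unfold vol, det3, zsub, zadd, zscale, px, py, pz; cbn [fst snd aff_indep toR rsub radd rscale].
  intros H a b c He. unfold rzero in He. injection He as X Y Z.
  apply not_0_IZR in H.
  rewrite !plus_IZR, !minus_IZR, !mult_IZR, !minus_IZR, !mult_IZR, !plus_IZR, !mult_IZR in H.
  revert H X Y Z.
  generalize (IZR x0) (IZR x1) (IZR x2) (IZR x3) (IZR y0) (IZR y1) (IZR y2) (IZR y3)
    (IZR z0) (IZR z1) (IZR z2) (IZR z3).
  intros X0 X1 X2 X3 Y0 Y1 Y2 Y3 Z0 Z1 Z2 Z3 HR EX EY EZ.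
  set (A1 := X1 + -1 * X0) in *. set (A2 := X2 + -1 * X0) in *. set (A3 := X3 + -1 * X0) in *.
  set (B1 := Y1 + -1 * Y0) in *. set (B2 := Y2 + -1 * Y0) in *. set (B3 := Y3 + -1 * Y0) in *.
  set (C1 := Z1 + -1 * Z0) in *. set (C2 := Z2 + -1 * Z0) in *. set (C3 := Z3 + -1 * Z0) in *.
  set (D := A1 * (B2 * C3 - B3 * C2) - B1 * (A2 * C3 - A3 * C2) + C1 * (A2 * B3 - A3 * B2)) in *.
  (* Cramer's rule: each coefficient times the determinant is a combination of the three coordinate
     equations. *)
  assert (Ha : a * D = (a * A1 + (b * A2 + c * A3)) * (B2 * C3 - B3 * C2)
     - (a * B1 + (b * B2 + c * B3)) * (A2 * C3 - A3 * C2)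
     + (a * C1 + (b * C2 + c * C3)) * (A2 * B3 - A3 * B2)) by (unfold D; ring).
  assert (Hb : b * D = - (a * A1 + (b * A2 + c * A3)) * (B1 * C3 - B3 * C1)
     + (a * B1 + (b * B2 + c * B3)) * (A1 * C3 - A3 * C1)
     - (a * C1 + (b * C2 + c * C3)) * (A1 * B3 - A3 * B1)) by (unfold D; ring).
  assert (Hc : c * D = (a * A1 + (b * A2 + c * A3)) * (B1 * C2 - B2 * C1)
     - (a * B1 + (b * B2 + c * B3)) * (A1 * C2 - A2 * C1)
     + (a * C1 + (b * C2 + c * C3)) * (A1 * B2 - A2 * B1)) by (unfold D; ring).
  rewrite EX, EY, EZ in Ha, Hb, Hc.
  repeat split; apply Rmult_eq_reg_r with D; auto; lra.
Qed.

Lemma Lambda_iff p q v : (1 <= q)%Z -> Lambda p q v <-> (q | px v - py v * pprime p q)%Z.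
Proof.
  intro Hq. destruct v as [[x y] z]; unfold px, py; cbn [fst snd]. split.
  - intros (a & b & c & m & H). injection H as -> -> ->.
    exists (a - b * pprime p q)%Z. ring.
  - intros [k Hk]. exists k, 0%Z, z, y. f_equal; f_equal; lia.
Qed.

(** The lattice is the kernel of x - p' y modulo [q], of index [q] in the integer lattice, so [q] is
    the least possible nonzero volume. *)
Lemma det3_Lambda p q a b c : (1 <= q)%Z -> Lambda p q a -> Lambda p q b -> Lambda p q c ->
  (q | det3 a b c)%Z.
Proof.
  intros Hq. rewrite !Lambda_iff by auto. intros [k Ha] [l Hb] [m Hc].
  set (t := pprime p q) in *. unfold det3.
  replace (px a) with (py a * t + k * q)%Z by lia.
  replace (px b) with (py b * t + l * q)%Z by lia.
  replace (px c) with (py c * t + m * q)%Z by lia.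
  exists (k * (py b * pz c - py c * pz b) - py a * (l * pz c - m * pz b) + pz a * (l * py c - m * py b))%Z.
  ring.
Qed.

Lemma px_zsub u v : px (zsub u v) = (px u - px v)%Z.
Proof. destruct u as [[? ?] ?], v as [[? ?] ?]; unfold px; cbn [zsub zadd zscale fst snd]; ring. Qed.
Lemma py_zsub u v : py (zsub u v) = (py u - py v)%Z.
Proof. destruct u as [[? ?] ?], v as [[? ?] ?]; unfold py; cbn [zsub zadd zscale fst snd]; ring. Qed.
Lemma pz_zsub u v : pz (zsub u v) = (pz u - pz v)%Z.
Proof. destruct u as [[? ?] ?], v as [[? ?] ?]; unfold pz; cbn [zsub zadd zscale fst snd]; ring. Qed.

Lemma Lambda_sub p q u v : (1 <= q)%Z -> Lambda p q u -> Lambda p q v -> Lambda p q (zsub u v).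
Proof.
  intro Hq. rewrite !Lambda_iff, px_zsub, py_zsub by auto. intros [k H] [l H'].
  exists (k - l)%Z. lia.
Qed.

Lemma zpt_ext (u v : zpt) : px u = px v -> py u = py v -> pz u = pz v -> u = v.
Proof. destruct u as [[? ?] ?], v as [[? ?] ?]; unfold px, py, pz; simpl; congruence. Qed.

(** By Cramer's rule the coordinates of a lattice vector are quotients of determinants: the
    numerators are multiples of [q] and the denominator is [q] up to sign. *)
Lemma vol_unimodular p q v0 v1 v2 v3 : (1 <= q)%Z -> Forall (Lambda p q) [v0; v1; v2; v3] ->
  (vol v0 v1 v2 v3 = q \/ vol v0 v1 v2 v3 = - q)%Z -> unimodular p q [v0; v1; v2; v3].
Proof.
  intros Hq HL HV.
  repeat match goal with H : Forall _ (_ :: _) |- _ => inversion H; clear H; subst end.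
  rename H1 into L0, H3 into L1, H2 into L2, H4 into L3.
  split; [apply vol_indep; lia|].
  (* The sign [e] is its own inverse, so division by [e * q] becomes multiplication by [e] and
     cancellation of [q]. *)
  assert (He : exists e, (vol v0 v1 v2 v3 = e * q /\ e * e = 1)%Z)
    by (destruct HV; [exists 1%Z | exists (-1)%Z]; lia).
  destruct He as (e & He & Hee).
  unfold vol in He.
  assert (M1 := Lambda_sub _ _ _ _ Hq L1 L0). assert (M2 := Lambda_sub _ _ _ _ Hq L2 L0).
  assert (M3 := Lambda_sub _ _ _ _ Hq L3 L0).
  set (a := zsub v1 v0) in *. set (b := zsub v2 v0) in *. set (c := zsub v3 v0) in *.
  intro w. split.
  - intro Hw. assert (M := Lambda_sub _ _ _ _ Hq Hw L0).
    set (d := zsub w v0) in *.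
    destruct (det3_Lambda _ _ d b c Hq M M2 M3) as [n1 N1].
    destruct (det3_Lambda _ _ a d c Hq M1 M M3) as [n2 N2].
    destruct (det3_Lambda _ _ a b d Hq M1 M2 M) as [n3 N3].
    exists (e * n1)%Z, (e * n2)%Z, (e * n3)%Z.
    assert (Hd : forall f : zpt -> Z, (f d * (e * q) = n1 * q * f a + n2 * q * f b + n3 * q * f c)%Z ->
      (f d = (e * n1) * f a + (e * n2) * f b + (e * n3) * f c)%Z).
    { intros f Hf. apply Z.mul_reg_r with q; [lia|].
      replace (f d * q)%Z with (e * e * f d * q)%Z by (rewrite Hee; ring).
      replace (e * e * f d * q)%Z with (e * (f d * (e * q)))%Z by ring. rewrite Hf. ring. }
    assert (X := Hd px). assert (Y := Hd py). assert (Z := Hd pz).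
    rewrite <- He, <- N1, <- N2, <- N3 in X, Y, Z.
    specialize (X ltac:(unfold det3; ring)). specialize (Y ltac:(unfold det3; ring)).
    specialize (Z ltac:(unfold det3; ring)).
    assert (D1 : px d = (px w - px v0)%Z) by apply px_zsub.
    assert (D2 : py d = (py w - py v0)%Z) by apply py_zsub.
    assert (D3 : pz d = (pz w - pz v0)%Z) by apply pz_zsub.
    clearbody d. clear - X Y Z D1 D2 D3. clearbody a b c.
    destruct a as [[? ?] ?], b as [[? ?] ?], c as [[? ?] ?], v0 as [[? ?] ?], w as [[? ?] ?].
    unfold px, py, pz in *; cbn [fst snd zadd zscale] in *. f_equal; f_equal; lia.
  - intros (n1 & n2 & n3 & ->). rewrite Lambda_iff in * by auto.
    rewrite !px_zadd, !py_zadd.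
    assert (S : forall t v, px (zscale t v) = (t * px v)%Z /\ py (zscale t v) = (t * py v)%Z)
      by (intros t [[? ?] ?]; split; reflexivity).
    destruct (S n1 a) as [-> ->], (S n2 b) as [-> ->], (S n3 c) as [-> ->].
    destruct L0 as [k0 K0], M1 as [k1 K1], M2 as [k2 K2], M3 as [k3 K3].
    exists (k0 + n1 * k1 + n2 * k2 + n3 * k3)%Z.
    replace (_ - _)%Z with ((px v0 - py v0 * pprime p q) + n1 * (px a - py a * pprime p q)
     + n2 * (px b - py b * pprime p q) + n3 * (px c - py c * pprime p q))%Z by ring.
    rewrite K0, K1, K2, K3. ring.
Qed.

(** * The Kuhn triangulation *)

Definition corner (q : Z) (v : zpt) : Prop := (q | px v)%Z /\ (q | py v)%Z.

(* In the coordinates (y/q, z, x/q + z) the edges of Delta' become the vectors e1, e2, e3,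
   e1+e2, e2+e3, e1+e2+e3, i.e. the 0/1 vectors other than e1+e3: the standard triangulations
   become the Kuhn (Freudenthal) triangulation. *)
Definition kuhn_edge (q : Z) (u v : zpt) : Prop :=
  exists e a b c : Z, ((e = 1 \/ e = -1) /\ (0 <= a <= 1) /\ (0 <= b <= 1) /\ (0 <= c <= 1) /\
    py v - py u = q * (e * a) /\ pz v - pz u = e * b /\
    (px v + q * pz v) - (px u + q * pz u) = q * (e * c))%Z.

(** A linear form in the Kuhn coordinates. The divisions are exact on corners, the only points where
    it is evaluated to any purpose. *)
Definition kuhn_form (q a b c : Z) (v : zpt) : Z :=
  (a * (py v / q) + b * pz v + c * (px v / q + pz v))%Z.

Lemma kuhn_form_affine q a b c v : (0 < q)%Z -> corner q v ->
  IZR (kuhn_form q a b c v) = affine 0 (IZR c / IZR q) (IZR a / IZR q) (IZR b + IZR c) v.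
Proof.
  intros Hq [[k Hk] [l Hl]]. unfold kuhn_form, affine, fx, fy, fz.
  rewrite Hk, Hl, !Z.div_mul by lia.
  rewrite !plus_IZR, !mult_IZR, !plus_IZR.
  assert (IZR q <> 0) by (apply not_0_IZR; lia). field; auto.
Qed.

(** Along a Kuhn edge the form changes, up to sign, by the sum of some subset of its coefficients;
    the hypotheses bound all these subset sums. *)
Lemma kuhn_edge_form q a b c u v : (0 < q)%Z -> corner q u -> corner q v -> kuhn_edge q u v ->
  (-1 <= a <= 1)%Z -> (-1 <= b <= 1)%Z -> (-1 <= c <= 1)%Z ->
  (-1 <= a + b <= 1)%Z -> (-1 <= a + c <= 1)%Z -> (-1 <= b + c <= 1)%Z ->
  (-1 <= a + b + c <= 1)%Z ->
  (-1 <= kuhn_form q a b c v - kuhn_form q a b c u <= 1)%Z.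
Proof.
  intros Hq [[k Hk] [l Hl]] [[k' Hk'] [l' Hl']] (e & a' & b' & c' & He & Ha & Hb & Hc & H1 & H2 & H3).
  intros. unfold kuhn_form. rewrite Hk, Hl, Hk', Hl', !Z.div_mul by lia.
  rewrite Hk, Hl, Hk', Hl' in *.
  assert (E1 : (l' - l = e * a')%Z) by (apply Z.mul_reg_l with q; lia).
  assert (E3 : (k' + pz v - (k + pz u) = e * c')%Z) by (apply Z.mul_reg_l with q; lia).
  replace (_ - _)%Z with (a * (l' - l) + b * (pz v - pz u) + c * (k' + pz v - (k + pz u)))%Z by ring.
  rewrite E1, H2, E3.
  assert (a' = 0 \/ a' = 1)%Z as [-> | ->] by lia;
  assert (b' = 0 \/ b' = 1)%Z as [-> | ->] by lia;
  assert (c' = 0 \/ c' = 1)%Z as [-> | ->] by lia; destruct He as [-> | ->]; lia.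
Qed.

Lemma two_values (P : zpt -> Prop) (f : zpt -> Z) :
  (forall u v, P u -> P v -> (-1 <= f v - f u <= 1)%Z) ->
  exists n, forall v, P v -> (n <= f v <= n + 1)%Z.
Proof.
  intro H. destruct (classic (exists u, P u)) as [[u Hu]|N].
  - destruct (classic (exists w, P w /\ (f w = f u - 1)%Z)) as [(w & Hw & Hfw)|N].
    + exists (f w). intros v Hv. specialize (H u v Hu Hv) as A. specialize (H w v Hw Hv). lia.
    + exists (f u). intros v Hv. specialize (H u v Hu Hv).
      assert (f v <> f u - 1)%Z by (intro; apply N; eauto). lia.
  - exists 0%Z. intros v Hv. destruct N; eauto.
Qed.

(** Each set lies in a slab between consecutive integer levels of the form. Sets in different slabs
    are separated by a level plane, whose points belong to a slab to which the hypothesis applies;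
    so both sets may be assumed to lie in one slab. *)
Lemma coherent_kuhn_form q a b c P Q : (0 < q)%Z ->
  (forall v, P v -> corner q v) -> (forall v, Q v -> corner q v) ->
  (forall u v, P u -> P v -> (-1 <= kuhn_form q a b c v - kuhn_form q a b c u <= 1)%Z) ->
  (forall u v, Q u -> Q v -> (-1 <= kuhn_form q a b c v - kuhn_form q a b c u <= 1)%Z) ->
  (forall n, coherent (fun v => P v /\ (n <= kuhn_form q a b c v <= n + 1)%Z)
                 (fun v => Q v /\ (n <= kuhn_form q a b c v <= n + 1)%Z)) ->
  coherent P Q.
Proof.
  intros Hq CP CQ DP DQ H.
  destruct (two_values P _ DP) as (n & Hn). destruct (two_values Q _ DQ) as (m & Hm).
  assert (S : forall P Q n m, (n < m)%Z ->
    (forall v, P v -> corner q v) -> (forall v, Q v -> corner q v) ->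
    (forall v, P v -> (n <= kuhn_form q a b c v <= n + 1)%Z) ->
    (forall v, Q v -> (m <= kuhn_form q a b c v <= m + 1)%Z) ->
    coherent (fun v => P v /\ (m <= kuhn_form q a b c v <= m + 1)%Z)
        (fun v => Q v /\ (m <= kuhn_form q a b c v <= m + 1)%Z) -> coherent P Q).
  { clear - Hq. intros P Q n m Hnm CP CQ Hn Hm H.
    assert (L : forall v, corner q v ->
      affine (- IZR m) (IZR c / IZR q) (IZR a / IZR q) (IZR b + IZR c) v = IZR (kuhn_form q a b c v - m)).
    { intros v Hv. rewrite minus_IZR, kuhn_form_affine by auto. unfold affine; ring. }
    apply (coherent_sep (- IZR m) (IZR c / IZR q) (IZR a / IZR q) (IZR b + IZR c)).
    - intros v Hv. rewrite L by auto. apply IZR_le. specialize (Hn v Hv). lia.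
    - intros v Hv. rewrite L by auto. apply IZR_le. specialize (Hm v Hv). lia.
    - eapply coherent_mono; [| |exact H].
      + intros v [Hv Hz]. rewrite L in Hz by auto. apply eq_IZR in Hz. split; auto; lia.
      + intros v [Hv Hz]. split; auto. }
  destruct (Z.lt_trichotomy n m) as [L|[<-|L]].
  - apply (S P Q n m); auto.
  - eapply coherent_mono; [| |exact (H n)]; simpl; auto.
  - apply coherent_sym. apply (S Q P m n); auto. apply coherent_sym; auto.
Qed.

(** The three coordinates and their differences confine both sets to one cell of the arrangement of
    type A3. Its corners are among the vertices of a single tetrahedron, where barycentric
    coordinates are unique. *)
Lemma kuhn_coherent q P Q : (0 < q)%Z ->
  (forall v, P v -> corner q v) -> (forall v, Q v -> corner q v) ->
  (forall u v, P u -> P v -> kuhn_edge q u v) -> (forall u v, Q u -> Q v -> kuhn_edge q u v) -> coherent P Q.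
Proof.
  intros Hq CP CQ KP KQ.
  assert (DP : forall a b c, (-1 <= a <= 1)%Z -> (-1 <= b <= 1)%Z -> (-1 <= c <= 1)%Z ->
  (-1 <= a + b <= 1)%Z -> (-1 <= a + c <= 1)%Z -> (-1 <= b + c <= 1)%Z ->
  (-1 <= a + b + c <= 1)%Z -> forall u v, P u -> P v -> (-1 <= kuhn_form q a b c v - kuhn_form q a b c u <= 1)%Z)
   by (intros; apply kuhn_edge_form; auto).
  assert (DQ : forall a b c, (-1 <= a <= 1)%Z -> (-1 <= b <= 1)%Z -> (-1 <= c <= 1)%Z ->
  (-1 <= a + b <= 1)%Z -> (-1 <= a + c <= 1)%Z -> (-1 <= b + c <= 1)%Z ->
  (-1 <= a + b + c <= 1)%Z -> forall u v, Q u -> Q v -> (-1 <= kuhn_form q a b c v - kuhn_form q a b c u <= 1)%Z)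
   by (intros; apply kuhn_edge_form; auto).
  apply (coherent_kuhn_form q 1 0 0); auto; [apply DP; lia | apply DQ; lia|]. intro nY.
  apply (coherent_kuhn_form q 0 1 0); [auto|intros v Hv; apply CP, Hv|intros v Hv; apply CQ, Hv| |
    |intro nZ].
  1: intros u v [Hu _] [Hv _]; apply DP; auto; lia.
  1: intros u v [Hu _] [Hv _]; apply DQ; auto; lia.
  apply (coherent_kuhn_form q 0 0 1); [auto|intros v Hv; apply CP, Hv|intros v Hv; apply CQ, Hv| |
    |intro nW].
  1: intros u v [[Hu _] _] [[Hv _] _]; apply DP; auto; lia.
  1: intros u v [[Hu _] _] [[Hv _] _]; apply DQ; auto; lia.
  apply (coherent_kuhn_form q 1 (-1) 0); [auto|intros v Hv; apply CP, Hv|intros v Hv; apply CQ, Hv| |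
    |intro n1].
  1: intros u v Hu Hv; apply DP; try lia; [apply Hu|apply Hv].
  1: intros u v Hu Hv; apply DQ; try lia; [apply Hu|apply Hv].
  apply (coherent_kuhn_form q 1 0 (-1)); [auto|intros v Hv; apply CP, Hv|intros v Hv; apply CQ, Hv| |
    |intro n2].
  1: intros u v Hu Hv; apply DP; try lia; [apply Hu|apply Hv].
  1: intros u v Hu Hv; apply DQ; try lia; [apply Hu|apply Hv].
  apply (coherent_kuhn_form q 0 1 (-1)); [auto|intros v Hv; apply CP, Hv|intros v Hv; apply CQ, Hv| |
    |intro n3].
  1: intros u v Hu Hv; apply DP; try lia; [apply Hu|apply Hv].
  1: intros u v Hu Hv; apply DQ; try lia; [apply Hu|apply Hv].
  (* The corner whose Kuhn coordinates exceed those of the cube's base point ([nY], [nZ], [nW]) by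
     [y], [z], [w]. *)
  set (pt := fun y z w : Z => (q * (nW + w - (nZ + z)), q * (nY + y), nZ + z)%Z : zpt).
  set (K := fun v => exists y z w : Z, v = pt y z w /\ ((0 <= y <= 1) /\ (0 <= z <= 1) /\ (0 <= w <= 1) /\
    n1 <= nY + y - (nZ + z) <= n1 + 1 /\ n2 <= nY + y - (nW + w) <= n2 + 1 /\
    n3 <= nZ + z - (nW + w) <= n3 + 1)%Z).
  assert (PX : forall y z w, px (pt y z w) = (q * (nW + w - (nZ + z)))%Z) by reflexivity.
  assert (PY : forall y z w, py (pt y z w) = (q * (nY + y))%Z) by reflexivity.
  assert (PZ : forall y z w, pz (pt y z w) = (nZ + z)%Z) by reflexivity.
  apply (coherent_mono K K).
  1,2: intros v [[[[[[Hv H1] H2] H3] H4] H5] H6];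
    assert (Hc : corner q v) by auto; destruct Hc as [[k Hk] [l Hl]];
    unfold kuhn_form in *; rewrite Hk, Hl, !Z.div_mul in * by lia;
    exists (l - nY)%Z, (pz v - nZ)%Z, (k + pz v - nW)%Z; split; [|lia];
    apply zpt_ext; rewrite ?PX, ?PY, ?PZ; lia.
  assert (S : forall w0 w1 w2 w3, vol w0 w1 w2 w3 <> 0%Z ->
    (forall v, K v -> In v [w0; w1; w2; w3]) -> coherent K K).
  { intros w0 w1 w2 w3 Hv HK. eapply coherent_mono; [exact HK|exact HK|].
    apply coherent_indep, vol_indep; auto. }
  assert (V : forall y1 z1 w1 y2 z2 w2 y3 z3 w3,
    vol (pt 0 0 0)%Z (pt y1 z1 w1) (pt y2 z2 w2) (pt y3 z3 w3) =
    (q * q * (w1 * (y2 * z3 - y3 * z2) - y1 * (w2 * z3 - w3 * z2) + z1 * (w2 * y3 - w3 * y2)))%Z).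
  { intros. unfold vol, det3, pt, zsub, zadd, zscale, px, py, pz; cbn [fst snd]; ring. }
  (* The three signs compare [y], [z], [w] pairwise. Six patterns are orders and select their Kuhn
     tetrahedron; the two cyclic ones force [y = z = w], and any tetrahedron on the main diagonal
     serves. *)
  destruct (Z_le_gt_dec 0 (n1 - nY + nZ)); destruct (Z_le_gt_dec 0 (n2 - nY + nW));
    destruct (Z_le_gt_dec 0 (n3 - nZ + nW));
        [ apply (S (pt 0 0 0) (pt 1 0 0) (pt 1 1 0) (pt 1 1 1))%Z
        | apply (S (pt 0 0 0) (pt 1 0 0) (pt 1 0 1) (pt 1 1 1))%Z
        | apply (S (pt 0 0 0) (pt 1 0 0) (pt 1 1 0) (pt 1 1 1))%Z
        | apply (S (pt 0 0 0) (pt 0 0 1) (pt 1 0 1) (pt 1 1 1))%Z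
        | apply (S (pt 0 0 0) (pt 0 1 0) (pt 1 1 0) (pt 1 1 1))%Z
        | apply (S (pt 0 0 0) (pt 0 1 0) (pt 1 1 0) (pt 1 1 1))%Z
        | apply (S (pt 0 0 0) (pt 0 1 0) (pt 0 1 1) (pt 1 1 1))%Z
        | apply (S (pt 0 0 0) (pt 0 0 1) (pt 0 1 1) (pt 1 1 1))%Z ];
    try (rewrite V; nia); intros v (y & z & w & -> & H);
    assert (y = 0 \/ y = 1)%Z as [-> | ->] by lia; assert (z = 0 \/ z = 1)%Z as [-> | ->] by lia;
    assert (w = 0 \/ w = 1)%Z as [-> | ->] by lia; try (exfalso; lia); simpl; auto.
Qed.

(** * Triangulating the square *)

(* Over equal abscissae, conv A is below conv B, and where they meet the barycentric coordinates
   agree. This order is what makes coherence of the pieces of a staircase provable (join_coherent). *)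
Definition below (A B : zpt -> Prop) : Prop :=
  forall mu nu, supported A mu -> supported B nu -> integral mu f1 = integral nu f1 -> integral mu fx = integral nu fx ->
    integral mu fy <= integral nu fy /\ (integral mu fy = integral nu fy -> forall g, integral mu g = integral nu g).

Definition coherent2 (A B : zpt -> Prop) : Prop :=
  forall mu nu, supported A mu -> supported B nu -> integral mu f1 = integral nu f1 -> integral mu fx = integral nu fx ->
    integral mu fy = integral nu fy -> forall g, integral mu g = integral nu g.

Lemma below_coherent2 A B : below A B -> coherent2 A B.
Proof. intros H mu nu Hm Hn H1 H2. apply (H mu nu); auto. Qed.

Lemma coherent2_sym A B : coherent2 A B -> coherent2 B A.
Proof. intros H mu nu Hm Hn H1 H2 H3 g. symmetry. apply H; auto. Qed.

Lemma coherent2_coherent A B : coherent2 A B -> coherent A B.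
Proof. intros H mu nu Hm Hn H1 H2 H3 _. apply H; auto. Qed.

Lemma below_mono A B A' B' : (forall v, A' v -> A v) -> (forall v, B' v -> B v) ->
  below A B -> below A' B'.
Proof. intros HP HQ H mu nu Hm Hn. apply H; eapply supported_mono; eauto. Qed.

(** On two points of different abscissae every function agrees with an affine function of the
    abscissa, so mass and abscissa determine all integrals. *)
Lemma two_points (p r : zpt) mu nu : (px p <> px r) ->
  supported (fun v => v = p \/ v = r) mu -> supported (fun v => v = p \/ v = r) nu ->
  integral mu f1 = integral nu f1 -> integral mu fx = integral nu fx -> forall g, integral mu g = integral nu g.
Proof.
  intros Hpr Hm Hn H1 H2 g.
  set (s := (g r - g p) / (fx r - fx p)).
  assert (Hne : fx r - fx p <> 0).
  { unfold fx. rewrite <- minus_IZR. apply not_0_IZR. lia. }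
  assert (Hg : forall v, v = p \/ v = r -> g v = affine (g p - s * fx p) s 0 0 v).
  { unfold affine; intros v [-> | ->]; [ring|]. unfold s; field; auto. }
  rewrite (integral_ext _ _ _ _ Hm Hg), (integral_ext _ _ _ _ Hn Hg), !integral_affine, H1, H2. ring.
Qed.

Definition cross (p r v : zpt) : Z :=
  ((px r - px p) * (py v - py p) - (py r - py p) * (px v - px p))%Z.

Lemma below_line p r A B : (px p < px r)%Z ->
  (forall v, A v -> (cross p r v <= 0)%Z) -> (forall v, B v -> (0 <= cross p r v)%Z) ->
  (forall v, A v \/ B v -> cross p r v = 0%Z -> v = p \/ v = r) -> below A B.
Proof.
  intros Hpr HA HB H0 mu nu Hm Hn H1 H2.
  set (a := IZR (- (px r - px p) * py p + (py r - py p) * px p)).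
  set (b := IZR (- (py r - py p))). set (c := IZR (px r - px p)).
  assert (Hc : 0 < c) by (apply IZR_lt; lia).
  assert (Hh : forall v, IZR (cross p r v) = affine a b c 0 v).
  { intro v. unfold cross, affine, a, b, c, fx, fy, fz.
    rewrite !minus_IZR, !plus_IZR, !mult_IZR, !opp_IZR, !minus_IZR. ring. }
  set (h := fun v => IZR (cross p r v)). set (h' := fun v => IZR (- cross p r v)).
  assert (Em : forall m, integral m h = a * integral m f1 + b * integral m fx + c * integral m fy).
  { intro m. transitivity (integral m (affine a b c 0)); [|rewrite integral_affine; ring].
    apply integral_eq; exact Hh. }
  assert (Em' : forall m, integral m h' = - integral m h).
  { intro m. unfold h, h'. clear. induction m as [|x m IH]; [unfold integral; simpl; lra|].
    rewrite !integral_cons, IH, opp_IZR. ring. }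
  assert (M : 0 <= integral mu h') by (eapply integral_nonneg; eauto; intros v Hv; apply IZR_le; specialize (HA v Hv); lia).
  assert (N : 0 <= integral nu h) by (eapply integral_nonneg; eauto; intros v Hv; apply IZR_le; specialize (HB v Hv); lia).
  rewrite Em', Em in M. rewrite Em in N. rewrite H1, H2 in M.
  split; [apply Rmult_le_reg_l with c; lra|].
  intros H3 g.
  destruct (supported_restrict A mu h' Hm) as (m & Hm' & Gm).
  { intros v Hv; apply IZR_le; specialize (HA v Hv); lia. }
  { rewrite Em', Em, H1, H2. rewrite H3 in *. lra. }
  destruct (supported_restrict B nu h Hn) as (n & Hn' & Gn).
  { intros v Hv; apply IZR_le; specialize (HB v Hv); lia. }
  { rewrite Em. rewrite H3 in *. lra. }
  rewrite Gm, Gn. apply (two_points p r); try (rewrite <- Gm, <- Gn; assumption); [lia| |].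
  - eapply supported_mono; [|exact Hm']. unfold h'; intros v [Hv Hz]. apply eq_IZR in Hz. apply H0; auto; lia.
  - eapply supported_mono; [|exact Hn']. unfold h; intros v [Hv Hz]. apply eq_IZR in Hz. apply H0; auto.
Qed.

(** The abscissa ranges touch only at [px p], so equal abscissa moments push both measures onto that
    vertical line, where [p] separates them. *)
Lemma below_xsep p A B :
  ((forall v, A v -> (px v <= px p)%Z) /\ (forall v, B v -> (px p <= px v)%Z) \/
   (forall v, A v -> (px p <= px v)%Z) /\ (forall v, B v -> (px v <= px p)%Z)) ->
  (forall v, A v -> px v = px p -> (py v < py p)%Z \/ v = p) ->
  (forall v, B v -> px v = px p -> (py p < py v)%Z \/ v = p) -> below A B.
Proof.
  intros Hs HA HB mu nu Hm Hn H1 H2.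
  assert (R : exists m n, supported (fun v => A v /\ px v = px p) m /\ supported (fun v => B v /\ px v = px p) n /\
     (forall g, integral mu g = integral m g) /\ (forall g, integral nu g = integral n g)).
  { set (h := fun v => IZR (px v - px p)). set (h' := fun v => IZR (px p - px v)).
    assert (Em : forall m, integral m h = integral m fx - IZR (px p) * integral m f1).
    { intro m. unfold h, fx, f1. clear. induction m as [|x m IH]; [unfold integral; simpl; lra|].
      rewrite !integral_cons, IH, minus_IZR. ring. }
    assert (Em' : forall m, integral m h' = - integral m h).
    { intro m. unfold h, h'. clear. induction m as [|x m IH]; [unfold integral; simpl; lra|].
      rewrite !integral_cons, IH, !minus_IZR. ring. }
    assert (Es : integral mu h = integral nu h) by (rewrite !Em, H1, H2; reflexivity).
    destruct Hs as [[SA SB]|[SA SB]].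
    - assert (PA : forall v, A v -> 0 <= h' v) by (intros v Hv; apply IZR_le; specialize (SA v Hv); lia).
      assert (PB : forall v, B v -> 0 <= h v) by (intros v Hv; apply IZR_le; specialize (SB v Hv); lia).
      assert (M := integral_nonneg _ _ _ Hm PA). assert (N := integral_nonneg _ _ _ Hn PB). rewrite Em' in M.
      destruct (supported_restrict A mu h' Hm PA) as (m & Hm' & Gm); [rewrite Em'; lra|].
      destruct (supported_restrict B nu h Hn PB) as (n & Hn' & Gn); [lra|].
      exists m, n. repeat split; auto; (eapply supported_mono; [|first [exact Hm'|exact Hn']]);
        unfold h, h'; intros v [Hv Hz]; apply eq_IZR in Hz; split; auto; lia.
    - assert (PA : forall v, A v -> 0 <= h v) by (intros v Hv; apply IZR_le; specialize (SA v Hv); lia).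
      assert (PB : forall v, B v -> 0 <= h' v) by (intros v Hv; apply IZR_le; specialize (SB v Hv); lia).
      assert (M := integral_nonneg _ _ _ Hm PA). assert (N := integral_nonneg _ _ _ Hn PB). rewrite Em' in N.
      destruct (supported_restrict A mu h Hm PA) as (m & Hm' & Gm); [lra|].
      destruct (supported_restrict B nu h' Hn PB) as (n & Hn' & Gn); [rewrite Em'; lra|].
      exists m, n. repeat split; auto; (eapply supported_mono; [|first [exact Hm'|exact Hn']]);
        unfold h, h'; intros v [Hv Hz]; apply eq_IZR in Hz; split; auto; lia. }
  destruct R as (m & n & Hm' & Hn' & Gm & Gn).
  assert (Bl : below (fun v => A v /\ px v = px p) (fun v => B v /\ px v = px p)).
  (* The second point is auxiliary: it makes the separating line horizontal through [p]. *)
  { apply (below_line p (px p + 1, py p, 0)%Z); unfold cross; cbn [px py fst snd].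
    - unfold px; cbn [fst snd]; lia.
    - intros v [Hv Hx]. destruct (HA v Hv Hx) as [L|L]; [|rewrite L]; unfold px, py in *; cbn [fst snd] in *; nia.
    - intros v [Hv Hx]. destruct (HB v Hv Hx) as [L|L]; [|rewrite L]; unfold px, py in *; cbn [fst snd] in *; nia.
    - intros v Hv Hz. left.
      destruct Hv as [[Hv Hx]|[Hv Hx]]; [destruct (HA v Hv Hx) as [L|L]|destruct (HB v Hv Hx) as [L|L]]; auto;
        exfalso; unfold px, py in *; cbn [fst snd] in *; nia. }
  destruct (Bl m n Hm' Hn') as [B1 B2]; [rewrite <- Gm, <- Gn; auto..|].
  rewrite <- Gm, <- Gn in B1, B2. split; [exact B1|].
  intros H3 g. rewrite Gm, Gn. auto.
Qed.

(** A floor function found without dividing by [s], which may be 0. *)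
Lemma find_step q s X : (0 < q)%Z -> 0 <= s -> 0 <= X <= IZR q * s ->
  exists l, (0 <= l < q)%Z /\ IZR l * s <= X <= IZR (l + 1) * s.
Proof.
  intros Hq Hs HX.
  assert (G : forall n : nat, X <= IZR (Z.of_nat n + 1) * s ->
      exists l, (0 <= l < Z.of_nat n + 1)%Z /\ IZR l * s <= X <= IZR (l + 1) * s).
  { induction n as [|n IH]; intro H.
    - exists 0%Z. split; [lia|]. simpl in *. lra.
    - destruct (Rle_dec X (IZR (Z.of_nat n + 1) * s)) as [Hle|Hgt].
      + destruct (IH Hle) as (l & Hl & Hl'). exists l. split; [lia|auto].
      + exists (Z.of_nat (S n)). split; [lia|]. split; [|exact H].
        replace (Z.of_nat (S n)) with (Z.of_nat n + 1)%Z by lia. lra. }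
  destruct (G (Z.to_nat (q - 1))) as (l & Hl & Hl').
  - rewrite Z2Nat.id by lia. replace (q - 1 + 1)%Z with q by lia. lra.
  - exists l; split; [lia|auto].
Qed.

(** [below] is not transitive, since a middle set may miss the abscissa in question. A path whose
    unit steps cover the whole range always provides an intermediate measure. *)
Lemma below_trans q (edge : Z -> zpt -> Prop) (b : Z -> Z) A C : (0 < q)%Z ->
  (forall l v, edge l v <-> v = (l, b l, 0%Z) \/ v = (l + 1, b (l + 1), 0)%Z) ->
  (forall v, A v -> (0 <= px v <= q)%Z) ->
  (forall l, (0 <= l < q)%Z -> below A (edge l)) -> (forall l, (0 <= l < q)%Z -> below (edge l) C) ->
  below A C.
Proof.
  intros Hq He HA H1 H2 mu nu Hm Hn M1 M2.
  assert (Hs : 0 <= integral mu f1) by (eapply integral_nonneg; eauto; intros; unfold f1; lra).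
  assert (X0 : 0 <= integral mu fx) by (eapply integral_nonneg; eauto; intros v Hv; apply IZR_le, HA; auto).
  assert (Xq : integral mu fx <= IZR q * integral mu f1).
  { assert (0 <= integral mu (fun v => IZR q + (-1) * fx v)).
    { eapply integral_nonneg; eauto; intros v Hv. destruct (HA v Hv) as [_ L]. apply IZR_le in L. unfold fx; lra. }
    assert (E1 : integral mu (fun v => IZR q + (-1) * fx v) = IZR q * integral mu f1 + (-1) * integral mu fx).
    { rewrite (integral_lin mu (fun _ => IZR q) fx (-1)). f_equal.
      unfold f1. clear. induction mu as [|p m IH]; [unfold integral; simpl; lra|rewrite !integral_cons, IH; ring]. }
    lra. }
  assert (L := find_step q (integral mu f1) (integral mu fx) Hq Hs (conj X0 Xq)).
  destruct L as (l & Hl & L1 & L2).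
  (* The step has width 1, so these weights reproduce both the mass and the abscissa of [mu]. *)
  set (xi := [(IZR (l + 1) * integral mu f1 - integral mu fx, (l, b l, 0%Z));
              (integral mu fx - IZR l * integral mu f1, (l + 1, b (l + 1), 0)%Z)] : measure).
  assert (Ox : supported (edge l) xi).
  { constructor; [|constructor; [|constructor]]; cbn [fst snd]; (split; [lra|apply He; auto]). }
  assert (X1 : integral xi f1 = integral mu f1).
  { unfold xi. rewrite !integral_cons, integral_nil, plus_IZR. cbn [fst snd]. unfold f1 at 2 4. ring. }
  assert (X2 : integral xi fx = integral mu fx).
  { unfold xi. rewrite !integral_cons, integral_nil. cbn [fst snd]. unfold fx at 2 4, px; cbn [fst snd]. rewrite plus_IZR. ring. }
  destruct (H1 l Hl mu xi) as [A1 A2]; auto.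
  destruct (H2 l Hl xi nu) as [B1 B2]; auto; try congruence.
  split; [lra|]. intros H3 g. rewrite A2, B2; auto; lra.
Qed.

(** A fourth vertex off the plane reduces this to an affinely independent tetrahedron. *)
Lemma coherent2_triangle u v w : pz u = 0%Z -> pz v = 0%Z -> pz w = 0%Z -> cross u v w <> 0%Z ->
  coherent2 (fun x => In x [u; v; w]) (fun x => In x [u; v; w]).
Proof.
  intros Hu Hv Hw Hc mu nu Hm Hn H1 H2 H3.
  assert (Z : forall m, supported (fun x => In x [u; v; w]) m -> integral m fz = 0).
  { intros m H. rewrite (integral_ext _ _ _ (fun _ => 0) H); [apply integral_zero|].
    unfold fz. intros x [<-|[<-|[<-|[]]]]; rewrite ?Hu, ?Hv, ?Hw; reflexivity. }
  apply (coherent_mono (fun x => In x [u; v; w; (0, 0, 1)%Z]) (fun x => In x [u; v; w; (0, 0, 1)%Z])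
    (fun x => In x [u; v; w]) (fun x => In x [u; v; w])); auto.
  1,2: simpl; intuition.
  - apply coherent_indep, vol_indep. intro Hvol. apply Hc. rewrite <- Hvol.
    unfold vol, det3. rewrite !px_zsub, !py_zsub, !pz_zsub, Hu, Hv, Hw.
    unfold cross. change (pz (0, 0, 1)%Z) with 1%Z. ring.
  - rewrite !Z; auto.
Qed.

(** The weights are Cramer quotients. Two of their signs are given by the hypotheses; the third
    follows from the moment about the abscissa [m], as [X] lies on a known side of it. *)
Lemma triangle_weights i m j bi bm bj s X Y : i < m < j ->
  0 < (j - i) * (bm - bi) - (bj - bi) * (m - i) ->
  (j * s - X) * bi + (X - i * s) * bj <= (j - i) * Y ->
  (X <= m * s /\ (m - i) * Y <= (m * s - X) * bi + (X - i * s) * bm \/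
   m * s <= X /\ (j - m) * Y <= (j * s - X) * bm + (X - m * s) * bj) ->
  exists wi wm wj, 0 <= wi /\ 0 <= wm /\ 0 <= wj /\ wi + wm + wj = s /\
    wi * i + wm * m + wj * j = X /\ wi * bi + wm * bm + wj * bj = Y.
Proof.
  intros Hm HD H1 H2. set (D := (j - i) * (bm - bi) - (bj - bi) * (m - i)) in *.
  set (wm := ((j - i) * Y - (j * s - X) * bi - (X - i * s) * bj) / D).
  set (wj := ((m * s - X) * bi + (X - i * s) * bm - (m - i) * Y) / D).
  set (wi := ((j * s - X) * bm + (X - m * s) * bj - (j - m) * Y) / D).
  assert (E1 : wi + wm + wj = s) by (unfold wi, wm, wj; field_simplify_eq; [unfold D; ring|lra]).
  assert (E2 : wi * i + wm * m + wj * j = X)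
    by (unfold wi, wm, wj; field_simplify_eq; [unfold D; ring|lra]).
  assert (E3 : wi * bi + wm * bm + wj * bj = Y)
    by (unfold wi, wm, wj; field_simplify_eq; [unfold D; ring|lra]).
  assert (Pm : 0 <= wm) by (apply Rle_mult_inv_pos; lra).
  exists wi, wm, wj. repeat split; auto.
  - destruct H2 as [[HX H]|[HX H]]; [|apply Rle_mult_inv_pos; lra].
    assert (Pj : 0 <= wj) by (apply Rle_mult_inv_pos; lra).
    apply Rmult_le_reg_r with (m - i); [lra|].
    assert (wi * (m - i) = wj * (j - m) + (m * s - X)) by (rewrite <- E1, <- E2; ring).
    assert (0 <= wj * (j - m)) by (apply Rmult_le_pos; lra). lra.
  - destruct H2 as [[HX H]|[HX H]]; [apply Rle_mult_inv_pos; lra|].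
    assert (Pi : 0 <= wi) by (apply Rle_mult_inv_pos; lra).
    apply Rmult_le_reg_r with (j - m); [lra|].
    assert (wj * (j - m) = wi * (m - i) + (X - m * s)) by (rewrite <- E1, <- E2; ring).
    assert (0 <= wi * (m - i)) by (apply Rmult_le_pos; lra). lra.
Qed.

Lemma argmin (f : Z -> Z) n i j : (j - i = Z.of_nat n + 2)%Z ->
  exists m, (i < m < j)%Z /\ forall l, (i < l < j)%Z -> (f m <= f l)%Z.
Proof.
  revert j; induction n as [|n IH]; intros j H.
  - exists (i + 1)%Z. split; [lia|]. intros l Hl. replace l with (i + 1)%Z by lia. lia.
  - destruct (IH (j - 1)%Z) as (m & Hm & Hf); [lia|].
    destruct (Z_le_gt_dec (f m) (f (j - 1)%Z)) as [Hc|Hc].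
    + exists m. split; [lia|]. intros l Hl. destruct (Z.eq_dec l (j - 1)) as [->|]; auto. apply Hf; lia.
    + exists (j - 1)%Z. split; [lia|]. intros l Hl. destruct (Z.eq_dec l (j - 1)) as [->|]; [lia|].
      specialize (Hf l). lia.
Qed.

Definition node (b : Z -> Z) (l : Z) : zpt := (l, b l, 0%Z).
Definition edge_nodes (b : Z -> Z) (l : Z) : list zpt := [node b l; node b (l + 1)].
Definition triangle_nodes (b : Z -> Z) (t : Z * Z * Z) : list zpt :=
  let '(a, m, d) := t in [node b a; node b m; node b d].
(** Twice the Euclidean area, positive when the middle node lies above the chord of the outer
    two. *)
Definition tri_area (b : Z -> Z) (t : Z * Z * Z) : Z :=
  let '(a, m, d) := t in cross (node b a) (node b d) (node b m).
Definition mem (T : list zpt) (v : zpt) : Prop := In v T.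
Arguments mem : simpl never.

Lemma cross_node b i j l :
  cross (node b i) (node b j) (node b l) = ((j - i) * (b l - b i) - (b j - b i) * (l - i))%Z.
Proof. reflexivity. Qed.

(* Triangulates the region between the polygonal line through the nodes i..j and the chord from
   node i to node j, lying below it: the apex over the chord is the node closest to it, so that the
   remaining nodes stay above the two new chords. *)
Lemma mountain (b F : Z -> Z) :
  (forall l, (0 <= l)%Z -> F (l + 1)%Z = (F l + b l + b (l + 1))%Z) ->
  forall n i j, (0 <= i)%Z -> (j - i = Z.of_nat n + 1)%Z ->
  (forall l, (i < l < j)%Z -> (0 < cross (node b i) (node b j) (node b l))%Z) ->
  exists M : list (Z * Z * Z),
    length M = n /\
    (forall a m d, In (a, m, d) M -> (i <= a < m /\ m < d <= j)%Z /\ (0 < tri_area b (a, m, d))%Z) /\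
    (fold_right (fun t s => tri_area b t + s)%Z 0%Z M = F j - F i - (j - i) * (b i + b j))%Z /\
    (forall t l, In t M -> (i <= l < j)%Z -> below (mem (triangle_nodes b t)) (mem (edge_nodes b l))) /\
    (forall t t', In t M -> In t' M -> coherent2 (mem (triangle_nodes b t)) (mem (triangle_nodes b t'))) /\
    (forall l s X Y, (2 <= j - i)%Z -> (i <= l < j)%Z -> IZR l * s <= X <= IZR (l + 1) * s ->
       Y <= (IZR (l + 1) * s - X) * IZR (b l) + (X - IZR l * s) * IZR (b (l + 1)%Z) ->
       (IZR j * s - X) * IZR (b i) + (X - IZR i * s) * IZR (b j) <= IZR (j - i) * Y ->
       exists t mu, In t M /\ supported (mem (triangle_nodes b t)) mu /\ integral mu f1 = s /\ integral mu fx = X /\ integral mu fy = Y).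
Proof.
  intro HF. intro n. induction n as [n IH] using lt_wf_ind. intros i j Hi Hn Hpos.
  destruct n as [|n].
  { exists []. replace j with (i + 1)%Z by lia. repeat split; simpl; try tauto; try lia.
    rewrite HF by auto. ring. }
  destruct (argmin (fun l => cross (node b i) (node b j) (node b l)) n i j) as (m & Hm & Hmin); [lia|].
  assert (Dm := Hpos m Hm).
  (* With [dl] and [dm] the heights over the old chord, up to a common factor, minimality gives
     [dm <= dl]; the height over the new chord is then at least a positive multiple of
     [(m - l) * dm]. *)
  assert (P1 : forall l, (i < l < m)%Z -> (0 < cross (node b i) (node b m) (node b l))%Z).
  { intros l Hl. specialize (Hmin l ltac:(lia)). rewrite !cross_node in *.
    set (dm := ((j - i) * (b m - b i) - (b j - b i) * (m - i))%Z) in *.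
    set (dl := ((j - i) * (b l - b i) - (b j - b i) * (l - i))%Z) in *.
    set (x := ((m - i) * (b l - b i) - (b m - b i) * (l - i))%Z).
    assert ((j - i) * x = (m - i) * dl - (l - i) * dm)%Z by (unfold x, dl, dm; ring).
    assert ((m - l) * dm <= (j - i) * x)%Z by nia. assert (0 < (m - l) * dm)%Z by nia. nia. }
  assert (P2 : forall l, (m < l < j)%Z -> (0 < cross (node b m) (node b j) (node b l))%Z).
  { intros l Hl. specialize (Hmin l ltac:(lia)). rewrite !cross_node in *.
    set (dm := ((j - i) * (b m - b i) - (b j - b i) * (m - i))%Z) in *.
    set (dl := ((j - i) * (b l - b i) - (b j - b i) * (l - i))%Z) in *.
    set (x := ((j - m) * (b l - b m) - (b j - b m) * (l - m))%Z).
    assert ((j - i) * x = (j - m) * dl - (j - l) * dm)%Z by (unfold x, dl, dm; ring).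
    assert ((l - m) * dm <= (j - i) * x)%Z by nia. assert (0 < (l - m) * dm)%Z by nia. nia. }
  destruct (IH (Z.to_nat (m - i - 1))) with (i := i) (j := m) as (M1 & L1 & R1 & A1 & B1 & C1 & V1);
    auto; try lia.
  destruct (IH (Z.to_nat (j - m - 1))) with (i := m) (j := j) as (M2 & L2 & R2 & A2 & B2 & C2 & V2);
    auto; try lia.
  assert (X1 : cross (node b i) (node b m) (node b j) = (- cross (node b i) (node b j) (node b m))%Z)
    by (rewrite !cross_node; ring).
  assert (X2 : cross (node b m) (node b j) (node b i) = (- cross (node b i) (node b j) (node b m))%Z)
    by (rewrite !cross_node; ring).
  assert (W1 : forall l, (i <= l <= m)%Z -> (0 <= cross (node b i) (node b m) (node b l))%Z /\
    (cross (node b i) (node b m) (node b l) = 0%Z -> node b l = node b i \/ node b l = node b m)).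
  { intros l Hl. destruct (Z.eq_dec l i) as [->|]; [rewrite cross_node; split; [lia|auto]|].
    destruct (Z.eq_dec l m) as [->|]; [rewrite cross_node; split; [lia|auto]|].
    specialize (P1 l). lia. }
  assert (W2 : forall l, (m <= l <= j)%Z -> (0 <= cross (node b m) (node b j) (node b l))%Z /\
    (cross (node b m) (node b j) (node b l) = 0%Z -> node b l = node b m \/ node b l = node b j)).
  { intros l Hl. destruct (Z.eq_dec l j) as [->|]; [rewrite cross_node; split; [lia|auto]|].
    destruct (Z.eq_dec l m) as [->|]; [rewrite cross_node; split; [lia|auto]|].
    specialize (P2 l). lia. }
  (* The line through nodes [i] and [m] separates: node [j] is strictly below it, and the path over
     [[i, m]] is on or above it. *)
  assert (Q1 : forall B, (forall v, B v -> exists l, (i <= l <= m)%Z /\ v = node b l) ->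
    below (mem (triangle_nodes b (i, m, j))) B).
  { intros B HB. apply (below_line (node b i) (node b m)).
    - unfold px; simpl; lia.
    - intros v [<-|[<-|[<-|[]]]]; [rewrite cross_node; lia..|]. rewrite X1; lia.
    - intros v Hv. destruct (HB v Hv) as (l & Hl & ->). apply W1; auto.
    - intros v [[<-|[<-|[<-|[]]]]|Hv]; auto; [rewrite X1; lia|].
      destruct (HB v Hv) as (l & Hl & ->). apply W1; auto. }
  assert (Q2 : forall B, (forall v, B v -> exists l, (m <= l <= j)%Z /\ v = node b l) ->
    below (mem (triangle_nodes b (i, m, j))) B).
  { intros B HB. apply (below_line (node b m) (node b j)).
    - unfold px; simpl; lia.
    - intros v [<-|[<-|[<-|[]]]]; [|rewrite cross_node; lia..]. rewrite X2; lia.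
    - intros v Hv. destruct (HB v Hv) as (l & Hl & ->). apply W2; auto.
    - intros v [[<-|[<-|[<-|[]]]]|Hv]; auto; [rewrite X2; lia|].
      destruct (HB v Hv) as (l & Hl & ->). apply W2; auto. }
  assert (T1 : forall t v, In t M1 -> mem (triangle_nodes b t) v -> exists l, (i <= l <= m)%Z /\ v = node b l).
  { intros [[a e] d] v Ht Hv. apply R1 in Ht.
    destruct Hv as [<-|[<-|[<-|[]]]]; eexists; (split; [|reflexivity]); lia. }
  assert (T2 : forall t v, In t M2 -> mem (triangle_nodes b t) v -> exists l, (m <= l <= j)%Z /\ v = node b l).
  { intros [[a e] d] v Ht Hv. apply R2 in Ht.
    destruct Hv as [<-|[<-|[<-|[]]]]; eexists; (split; [|reflexivity]); lia. }
  assert (T3 : forall l v, mem (edge_nodes b l) v -> exists k, (l <= k <= l + 1)%Z /\ v = node b k).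
  { intros l v [<-|[<-|[]]]; eexists; (split; [|reflexivity]); lia. }
  (* Pieces over abscissa ranges that share at most one node are below each other in both
     directions. *)
  assert (T0 : forall a c A B, (forall v, A v -> exists l, (i <= l <= a)%Z /\ v = node b l) ->
    (forall v, B v -> exists l, (c <= l <= j)%Z /\ v = node b l) -> (a <= c)%Z -> below A B /\ below B A).
  { intros a c A B HA HB Hac. split; apply (below_xsep (node b c)).
    - left. split; intros v Hv; [destruct (HA v Hv) as (l & Hl & ->)|destruct (HB v Hv) as (l & Hl & ->)];
        unfold px; simpl; lia.
    - intros v Hv; destruct (HA v Hv) as (l & Hl & ->). unfold px; simpl. intros ->; auto.
    - intros v Hv; destruct (HB v Hv) as (l & Hl & ->). unfold px; simpl. intros ->; auto.
    - right. split; intros v Hv; [destruct (HB v Hv) as (l & Hl & ->)|destruct (HA v Hv) as (l & Hl & ->)];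
        unfold px; simpl; lia.
    - intros v Hv; destruct (HB v Hv) as (l & Hl & ->). unfold px; simpl. intros ->; auto.
    - intros v Hv; destruct (HA v Hv) as (l & Hl & ->). unfold px; simpl. intros ->; auto. }
  exists ((i, m, j) :: M1 ++ M2). split; [|split; [|split; [|split; [|split]]]].
  - simpl. rewrite length_app, L1, L2. lia.
  - intros a e d [H|H].
    + injection H as <- <- <-. split; [lia|]. exact Dm.
    + apply in_app_iff in H. destruct H as [H|H]; [apply R1 in H|apply R2 in H]; split; try tauto; lia.
  (* The right-hand side is twice the area between path and chord; cutting at [m] splits it into the
     apex triangle and the areas of the two smaller mountains. *)
  - simpl. rewrite fold_right_app.
    assert (G : forall (M : list (Z * Z * Z)) c, (fold_right (fun t s => tri_area b t + s) c M =
      fold_right (fun t s => tri_area b t + s) 0 M + c)%Z).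
    { clear. induction M as [|t M IH]; intro c; simpl; [ring|rewrite IH; ring]. }
    rewrite G, A1, A2, cross_node. ring.
  - intros t l Ht Hl. destruct Ht as [<-|Ht]; [|apply in_app_iff in Ht; destruct Ht as [Ht|Ht]].
    + destruct (Z_lt_le_dec l m) as [L|L]; [apply Q1|apply Q2]; intros v Hv;
        destruct (T3 l v Hv) as (k & Hk & ->); exists k; split; auto; lia.
    + destruct (Z_lt_le_dec l m) as [L|L]; [apply B1; auto; lia|].
      apply (T0 m m (mem (triangle_nodes b t)) (mem (edge_nodes b l))); [intros v; apply T1; auto| |lia].
      intros v Hv; destruct (T3 l v Hv) as (k & Hk & ->); exists k; split; auto; lia.
    + destruct (Z_lt_le_dec l m) as [L|L]; [|apply B2; auto; lia].
      apply (T0 m m (mem (edge_nodes b l)) (mem (triangle_nodes b t))); [|intros v; apply T2; auto|lia].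
      intros v Hv; destruct (T3 l v Hv) as (k & Hk & ->); exists k; split; auto; lia.
  - assert (G : forall t t', In t ((i, m, j) :: M1 ++ M2) -> In t' M1 \/ In t' M2 ->
      coherent2 (mem (triangle_nodes b t)) (mem (triangle_nodes b t'))).
    { intros t t' [<-|Ht] Ht'.
      - apply below_coherent2. destruct Ht'; [apply Q1|apply Q2]; intros v; [apply T1|apply T2]; auto.
      - apply in_app_iff in Ht. destruct Ht as [Ht|Ht], Ht' as [Ht'|Ht']; auto; apply below_coherent2.
        + apply (T0 m m (mem (triangle_nodes b t)) (mem (triangle_nodes b t'))); try lia; intros v; [apply T1|apply T2]; auto.
        + apply (T0 m m (mem (triangle_nodes b t')) (mem (triangle_nodes b t))); try lia; intros v; [apply T1|apply T2]; auto. }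
    intros t t' Ht [<-|Ht']; [|apply G; auto; apply in_app_iff; auto].
    destruct Ht as [<-|Ht].
    + apply coherent2_triangle; try reflexivity.
      rewrite X1. lia.
    + apply coherent2_sym, G; [left; auto|]. apply in_app_iff; auto.
  - intros l s X Y _ Hl HX HY1 HY2.
    assert (HS : 0 <= s) by (rewrite plus_IZR in HX; lra).
    assert (T : (X <= IZR m * s /\ IZR (m - i) * Y <= (IZR m * s - X) * IZR (b i) + (X - IZR i * s) * IZR (b m) \/
      IZR m * s <= X /\ IZR (j - m) * Y <= (IZR j * s - X) * IZR (b m) + (X - IZR m * s) * IZR (b j)) ->
      exists t mu, In t ((i, m, j) :: M1 ++ M2) /\ supported (mem (triangle_nodes b t)) mu /\ integral mu f1 = s /\ integral mu fx = X /\ integral mu fy = Y).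
    { intro H. rewrite !minus_IZR in *.
      destruct (triangle_weights (IZR i) (IZR m) (IZR j) (IZR (b i)) (IZR (b m)) (IZR (b j)) s X Y)
        as (wi & wm & wj & Wi & Wm & Wj & S1 & S2 & S3); auto.
      - split; apply IZR_lt; lia.
      - rewrite <- !minus_IZR, <- !mult_IZR, <- minus_IZR. apply IZR_lt. exact Dm.
      - exists (i, m, j), [(wi, node b i); (wm, node b m); (wj, node b j)].
        split; [left; auto|]. split.
        { unfold supported; repeat (apply Forall_cons; [split; simpl; auto|]); [..|apply Forall_nil].
          all: unfold mem; simpl; auto. }
        rewrite !integral_cons, !integral_nil; unfold f1, fx, fy, px, py; simpl. repeat split; lra. }
    destruct (Z_lt_le_dec l m) as [L|L].
    + assert (HXm : X <= IZR m * s).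
      { apply Rle_trans with (IZR (l + 1) * s); [lra|]. apply Rmult_le_compat_r; auto. apply IZR_le; lia. }
      destruct (Rle_dec (IZR (m - i) * Y) ((IZR m * s - X) * IZR (b i) + (X - IZR i * s) * IZR (b m)))
        as [Hle|Hgt]; [apply T; left; auto|].
      destruct (V1 l s X Y) as (t & mu & Ht & H); auto; try lia; try lra.
      (* If [m = i + 1], the new chord is an edge of the path, and no point under the path lies
         above it. *)
      * destruct (Z.eq_dec m (i + 1)) as [e|e]; [|lia]. exfalso. apply Hgt.
        assert (l = i) by lia. subst l m. replace (i + 1 - i)%Z with 1%Z by lia. lra.
      * exists t, mu. split; auto. right. apply in_app_iff; auto.
    + assert (HXm : IZR m * s <= X).
      { apply Rle_trans with (IZR l * s); [|lra]. apply Rmult_le_compat_r; auto. apply IZR_le; lia. }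
      destruct (Rle_dec (IZR (j - m) * Y) ((IZR j * s - X) * IZR (b m) + (X - IZR m * s) * IZR (b j)))
        as [Hle|Hgt]; [apply T; right; auto|].
      destruct (V2 l s X Y) as (t & mu & Ht & H); auto; try lia; try lra.
      * destruct (Z.eq_dec j (m + 1)) as [e|e]; [|lia]. exfalso. apply Hgt.
        assert (l = m) by lia. subst l j. replace (m + 1 - m)%Z with 1%Z by lia. lra.
      * exists t, mu. split; auto. right. apply in_app_iff; auto.
Qed.

(** * The two paths, the half-turn and the levels of the square *)

Definition chain (q : Z) (b : Z -> Z) : Prop :=
  (0 < q)%Z /\ b 0%Z = 0%Z /\ b q = 0%Z /\
  forall l, (0 < l < q)%Z -> (0 < b l < q)%Z /\ b (q - l)%Z = (q - b l)%Z.

(** The half-turn of the lower path. By the symmetry required in [chain] it has the same interior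
    nodes, but it ends at the upper corners. *)
Definition top (q : Z) (b : Z -> Z) (l : Z) : Z := (q - b (q - l))%Z.

Definition rot (q : Z) (v : zpt) : zpt := (q - px v, q - py v, - pz v)%Z.

Lemma rot_rot q v : rot q (rot q v) = v.
Proof. apply zpt_ext; unfold rot, px, py, pz; cbn [fst snd]; lia. Qed.

Lemma in_map_rot q T v : mem (map (rot q) T) v <-> mem T (rot q v).
Proof.
  unfold mem. rewrite in_map_iff. split.
  - intros (w & <- & Hw). rewrite rot_rot; auto.
  - intro H. exists (rot q v). rewrite rot_rot; auto.
Qed.

Lemma integral_rot q m :
  integral m (fun v => f1 (rot q v)) = integral m f1 /\
  integral m (fun v => fx (rot q v)) = IZR q * integral m f1 - integral m fx /\
  integral m (fun v => fy (rot q v)) = IZR q * integral m f1 - integral m fy.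
Proof.
  induction m as [|p m (H1 & H2 & H3)]; [rewrite !integral_nil; repeat split; ring|].
  rewrite !integral_cons, H1, H2, H3. unfold f1, fx, fy, rot, px, py; cbn [fst snd]. rewrite !minus_IZR.
  repeat split; ring.
Qed.

Lemma below_rot q A B : below A B -> below (fun v => B (rot q v)) (fun v => A (rot q v)).
Proof.
  intros H mu nu Hm Hn H1 H2.
  set (push := fun m : measure => map (fun p => (fst p, rot q (snd p))) m).
  assert (G : forall m g, integral m g = integral (push m) (fun v => g (rot q v))).
  { intros m g. unfold push. rewrite integral_map. apply integral_eq. intro; rewrite rot_rot; reflexivity. }
  destruct (integral_rot q mu) as (A1 & A2 & A3). destruct (integral_rot q nu) as (B1 & B2 & B3).
  destruct (H (push nu) (push mu)) as [L R].
  - apply (supported_map _ (rot q) nu A Hn); auto.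
  - apply (supported_map _ (rot q) mu B Hm); auto.
  - unfold push. rewrite !integral_map, A1, B1; auto.
  - unfold push. rewrite !integral_map, A2, B2, H1, H2; auto.
  - unfold push in L, R. rewrite !integral_map in L, R. rewrite A3, B3, H1 in L, R.
    split; [lra|]. intros H3 g. rewrite (G mu), (G nu). symmetry.
    unfold push. apply R. lra.
Qed.

Lemma coherent2_rot q A B : coherent2 A B -> coherent2 (fun v => A (rot q v)) (fun v => B (rot q v)).
Proof.
  intros H mu nu Hm Hn H1 H2 H3.
  set (push := fun m : measure => map (fun p => (fst p, rot q (snd p))) m).
  assert (G : forall m g, integral m g = integral (push m) (fun v => g (rot q v))).
  { intros m g. unfold push. rewrite integral_map. apply integral_eq. intro; rewrite rot_rot; reflexivity. }
  destruct (integral_rot q mu) as (A1 & A2 & A3). destruct (integral_rot q nu) as (B1 & B2 & B3).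
  intro g. rewrite (G mu), (G nu). apply H; unfold push;
    [apply (supported_map _ (rot q) mu A Hm); auto | apply (supported_map _ (rot q) nu B Hn); auto|..];
    rewrite !integral_map; rewrite ?A1, ?A2, ?A3, ?B1, ?B2, ?B3, ?H1, ?H2, ?H3; auto.
Qed.

(** The paths differ only at their ends, so the gap between them consists of this triangle and the
    next one; for [q = 1] these are the two halves of the square. *)
Definition corner_left (q : Z) (b : Z -> Z) : list zpt :=
  [node b 0; node (top q b) 0; node (top q b) 1].
Definition corner_right (q : Z) (b : Z -> Z) : list zpt :=
  [node b q; node (top q b) q; node b (q - 1)].

(* The simplices of the triangulated square, numbered from bottom to top: the lower mountain, the edges of
   the lower path, the two triangles between the paths, the edges of the upper path, and the upper
   mountain, which is the lower one rotated by a half-turn. *)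
Inductive slice (q : Z) (b : Z -> Z) (M : list (Z * Z * Z)) : nat -> list zpt -> Prop :=
| slice0 t : In t M -> slice q b M 0 (triangle_nodes b t)
| slice1 l : (0 <= l < q)%Z -> slice q b M 1 (edge_nodes b l)
| slice2_left : slice q b M 2 (corner_left q b)
| slice2_right : slice q b M 2 (corner_right q b)
| slice3 l : (0 <= l < q)%Z -> slice q b M 3 (edge_nodes (top q b) l)
| slice4 t : In t M -> slice q b M 4 (map (rot q) (triangle_nodes b t)).

(** The guard [2 <= q] in the last clause is there because for [q = 1] the path is its own chord and
    there are no triangles. *)
Definition mountains (q : Z) (b : Z -> Z) (M : list (Z * Z * Z)) : Prop :=
  (forall a m d, In (a, m, d) M -> (0 <= a < m /\ m < d <= q)%Z /\ tri_area b (a, m, d) = q) /\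
  (forall t l, In t M -> (0 <= l < q)%Z -> below (mem (triangle_nodes b t)) (mem (edge_nodes b l))) /\
  (forall t t', In t M -> In t' M -> coherent2 (mem (triangle_nodes b t)) (mem (triangle_nodes b t'))) /\
  (forall l s X Y, (2 <= q)%Z -> (0 <= l < q)%Z -> IZR l * s <= X <= IZR (l + 1) * s ->
     0 <= Y <= (IZR (l + 1) * s - X) * IZR (b l) + (X - IZR l * s) * IZR (b (l + 1)%Z) ->
     exists t mu, In t M /\ supported (mem (triangle_nodes b t)) mu /\ integral mu f1 = s /\ integral mu fx = X /\ integral mu fy = Y).

Lemma top_end q b : chain q b -> top q b 0 = q /\ top q b q = q /\
  forall l, (0 < l < q)%Z -> top q b l = b l.
Proof.
  intros (Hq & B0 & Bq & H). unfold top. rewrite Z.sub_0_r, Z.sub_diag, B0, Bq.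
  repeat split; try lia. intros l Hl. destruct (H l Hl) as [_ ->]. lia.
Qed.

Lemma top_ge q b l : chain q b -> (0 <= l <= q)%Z ->
  (0 <= b l <= q /\ b l <= top q b l <= q)%Z.
Proof.
  intros Hc Hl. destruct (top_end q b Hc) as (T0 & Tq & T). destruct Hc as (Hq & B0 & Bq & H).
  destruct (Z.eq_dec l 0) as [->|]; [lia|]. destruct (Z.eq_dec l q) as [->|]; [lia|].
  rewrite T by lia. specialize (H l). lia.
Qed.

Lemma node_rot q b l : rot q (node b l) = node (top q b) (q - l).
Proof.
  unfold rot, node, top, px, py, pz; cbn [fst snd]. replace (q - (q - l))%Z with l by lia. reflexivity.
Qed.

(** The half-turn exchanges levels [k] and [4 - k], so a comparison near the bottom also gives one
    near the top. *)
Lemma slice_rot q b M k A : (0 < q)%Z -> slice q b M k A ->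
  exists A', slice q b M (4 - k) A' /\ forall v, mem A' v <-> mem A (rot q v).
Proof.
  intros Hq H.
  assert (R : forall l, rot q (node (top q b) l) = node b (q - l)).
  { intro l. rewrite <- (rot_rot q (node b (q - l))), (node_rot q b (q - l)). replace (q - (q - l))%Z with l by lia; reflexivity. }
  destruct H as [t Ht|l Hl| | |l Hl|t Ht]; simpl.
  - exists (map (rot q) (triangle_nodes b t)). split; [constructor; auto|]. intro; apply in_map_rot.
  - exists (edge_nodes (top q b) (q - 1 - l)). split; [constructor; lia|].
    intro v. rewrite <- in_map_rot. unfold edge_nodes, mem; simpl. rewrite !node_rot.
    replace (q - 1 - l + 1)%Z with (q - l)%Z by lia. replace (q - (l + 1))%Z with (q - 1 - l)%Z by lia. tauto.
  - exists (corner_right q b). split; [constructor|].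
    intro v. rewrite <- in_map_rot. unfold corner_left, corner_right, mem; simpl. rewrite !R, node_rot.
    rewrite !Z.sub_0_r. tauto.
  - exists (corner_left q b). split; [constructor|].
    intro v. rewrite <- in_map_rot. unfold corner_left, corner_right, mem; simpl. rewrite !R, !node_rot.
    rewrite !Z.sub_diag. replace (q - (q - 1))%Z with 1%Z by lia. tauto.
  - exists (edge_nodes b (q - 1 - l)). split; [constructor; lia|].
    intro v. rewrite <- in_map_rot. unfold edge_nodes, mem; simpl. rewrite !R.
    replace (q - 1 - l + 1)%Z with (q - l)%Z by lia. replace (q - (l + 1))%Z with (q - 1 - l)%Z by lia. tauto.
  - exists (triangle_nodes b t). split; [constructor; auto|].
    intro v. rewrite in_map_rot, rot_rot. tauto.
Qed.

Lemma slice_z q b M k A v : slice q b M k A -> mem A v -> pz v = 0%Z.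
Proof.
  intros []; unfold mem; simpl; try (destruct t as [[? ?] ?]); simpl; intuition subst; reflexivity.
Qed.

Lemma slice_x q b M k A v : chain q b -> mountains q b M -> slice q b M k A -> mem A v -> (0 <= px v <= q)%Z.
Proof.
  intros (Hq & _) [HM _] HA Hv.
  destruct HA as [[[a m] d] Ht|l Hl| | |l Hl|[[a m] d] Ht]; try apply HM in Ht; unfold mem in Hv; simpl in Hv;
    repeat (destruct Hv as [<-|Hv]; [unfold rot, px; simpl; lia|]); destruct Hv.
Qed.

Ltac unfold_cross := unfold cross, node, px, py in *; cbn [fst snd] in *.

Lemma edge_nodes_below q b c l l' : (0 < q)%Z -> (0 <= l < q)%Z -> (0 <= l' < q)%Z ->
  (forall i, (0 <= i <= q)%Z -> (b i <= c i)%Z) -> below (mem (edge_nodes b l)) (mem (edge_nodes c l')).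
Proof.
  intros Hq Hl Hl' H.
  destruct (Z.lt_trichotomy l l') as [L|[<-|L]].
  - apply (below_xsep (node b (l + 1))).
    + left. split; intros v [<-|[<-|[]]]; unfold_cross; lia.
    + intros v [<-|[<-|[]]]; auto. unfold_cross; lia.
    + intros v [<-|[<-|[]]]; unfold_cross; intro e.
      * rewrite <- e. specialize (H l'). unfold node; destruct (Z.eq_dec (b l') (c l')) as [<-|]; [auto|left; lia].
      * lia.
  - apply (below_line (node b l) (node b (l + 1))); unfold_cross.
    + lia.
    + intros v [<-|[<-|[]]]; unfold_cross; nia.
    + assert (H1 := H l). assert (H2 := H (l + 1)%Z).
      intros v [<-|[<-|[]]]; unfold_cross; nia.
    + assert (H1 := H l). assert (H2 := H (l + 1)%Z).
      intros v [[<-|[<-|[]]]|[<-|[<-|[]]]]; auto; unfold_cross; intro e.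
      * left. f_equal. f_equal. nia.
      * right. f_equal. f_equal. nia.
  - apply (below_xsep (node b l)).
    + right. split; intros v [<-|[<-|[]]]; unfold_cross; lia.
    + intros v [<-|[<-|[]]]; auto. unfold_cross; lia.
    + intros v [<-|[<-|[]]]; unfold_cross; intro e.
      * lia.
      * rewrite e. specialize (H l). unfold node; destruct (Z.eq_dec (b l) (c l)) as [<-|]; [auto|left; lia].
Qed.

(** Only the pairs 0-1, 1-2 and 1-3 are compared directly. The others follow from the half-turn and
    from transitivity through the lower path, which spans the whole width. *)
Lemma slice_below q b M : chain q b -> mountains q b M ->
  forall k k' A B, (k < k')%nat -> slice q b M k A -> slice q b M k' B -> below (mem A) (mem B).
Proof.
  intros Hc HM. assert (Hq : (0 < q)%Z) by apply Hc.
  destruct (top_end q b Hc) as (T0 & Tq & Tm).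
  assert (Hge := fun l => top_ge q b l Hc).
  set (L := fun k k' => forall A B, slice q b M k A -> slice q b M k' B -> below (mem A) (mem B)).
  assert (Rot : forall k k', (k <= 4)%nat -> (k' <= 4)%nat -> L k k' -> L (4 - k')%nat (4 - k)%nat).
  { intros k k' Hk Hk' HL A B HA HB.
    destruct (slice_rot _ _ _ _ _ Hq HA) as (A' & SA & EA).
    destruct (slice_rot _ _ _ _ _ Hq HB) as (B' & SB & EB).
    replace (4 - (4 - k'))%nat with k' in SA by lia. replace (4 - (4 - k))%nat with k in SB by lia.
    apply (below_mono (fun v => mem A' (rot q v)) (fun v => mem B' (rot q v))).
    - intros v Hv. apply EA. rewrite rot_rot; auto.
    - intros v Hv. apply EB. rewrite rot_rot; auto.
    - apply below_rot, HL; auto. }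
  assert (L01 : L 0%nat 1%nat).
  { intros A B HA HB. inversion HA; subst. inversion HB; subst. apply HM; auto. }
  assert (L12 : L 1%nat 2%nat).
  { intros A B HA HB. inversion HA as [|l Hl| | | |]; subst. inversion HB; subst.
    - destruct (Z.eq_dec l 0) as [->|Hl0].
      + change (edge_nodes b 0) with [node b 0; node b 1].
        apply (below_line (node b 0) (node b 1)); unfold_cross.
        * lia.
        * intros v [<-|[<-|[]]]; unfold_cross; nia.
        * assert (H0 := Hge 0%Z). assert (H1 := Hge 1%Z).
          intros v [<-|[<-|[<-|[]]]]; unfold_cross; nia.
        * assert (H0 := Hge 0%Z). assert (H1 := Hge 1%Z).
          intros v [[<-|[<-|[]]]|[<-|[<-|[<-|[]]]]]; auto; unfold_cross; intro e.
          -- left. f_equal. f_equal. nia.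
          -- right. f_equal. f_equal. nia.
      + apply (below_xsep (node b 1)).
        * right. split; [intros v [<-|[<-|[]]]|intros v [<-|[<-|[<-|[]]]]]; unfold_cross; lia.
        * intros v [<-|[<-|[]]]; unfold_cross; intros e; right; rewrite ?e; auto; lia.
        * intros v [<-|[<-|[<-|[]]]]; unfold_cross; intro e; try lia.
          right. unfold node. rewrite Tm by lia. auto.
    - destruct (Z.eq_dec l (q - 1)) as [->|Hl0].
      + unfold edge_nodes. replace (q - 1 + 1)%Z with q by lia.
        assert (H0 := Hge q). assert (H1 := Hge (q - 1)%Z).
        apply (below_line (node b (q - 1)) (node b q)); unfold_cross.
        * lia.
        * intros v [<-|[<-|[]]]; unfold_cross; nia.
        * intros v [<-|[<-|[<-|[]]]]; unfold_cross; nia.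
        * intros v [[<-|[<-|[]]]|[<-|[<-|[<-|[]]]]]; auto; unfold_cross; intro e.
          right. f_equal. f_equal. nia.
      + apply (below_xsep (node b (q - 1))).
        * left. split; [intros v [<-|[<-|[]]]|intros v [<-|[<-|[<-|[]]]]]; unfold_cross; lia.
        * intros v [<-|[<-|[]]]; unfold_cross; intros e; right; rewrite ?e; auto; lia.
        * intros v [<-|[<-|[<-|[]]]]; unfold_cross; intro e; try lia. auto. }
  assert (L13 : L 1%nat 3%nat).
  { intros A B HA HB. inversion HA; subst. inversion HB; subst. apply (edge_nodes_below q); auto. apply Hge. }
  assert (Tr : forall k k', L k 1%nat -> L 1%nat k' -> L k k').
  { intros k k' H1 H2 A B HA HB.
    apply (below_trans q (fun l => mem (edge_nodes b l)) b); auto.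
    - intros l v. unfold mem, edge_nodes, node; simpl. intuition.
    - intros v. apply (slice_x q b M k); auto.
    - intros l Hl. apply H1; auto. constructor; auto.
    - intros l Hl. apply H2; auto. constructor; auto. }
  assert (L02 := Tr _ _ L01 L12). assert (L03 := Tr _ _ L01 L13).
  assert (L34 := Rot 0%nat 1%nat ltac:(lia) ltac:(lia) L01).
  assert (L23 := Rot 1%nat 2%nat ltac:(lia) ltac:(lia) L12).
  assert (L14 := Rot 0%nat 3%nat ltac:(lia) ltac:(lia) L03).
  assert (L24 := Rot 0%nat 2%nat ltac:(lia) ltac:(lia) L02).
  simpl in L34, L23, L14, L24. assert (L04 := Tr _ _ L01 L14).
  assert (bd : forall k A, slice q b M k A -> (k <= 4)%nat) by (intros k A []; lia).
  intros k k' A B Hk HA HB. assert (k' <= 4)%nat by eauto.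
  destruct k as [|[|[|[|k]]]]; destruct k' as [|[|[|[|[|k']]]]]; try lia; eauto.
Qed.

Lemma slice_edges q b M k A B : chain q b -> (k = 1 \/ k = 3)%nat ->
  slice q b M k A -> slice q b M k B -> below (mem A) (mem B).
Proof.
  intros (Hq & _) [-> | ->] HA HB; inversion HA; subst; inversion HB; subst;
   apply (edge_nodes_below q); auto; lia.
Qed.

Lemma slice_coherent2 q b M : chain q b -> mountains q b M ->
  forall k A B, slice q b M k A -> slice q b M k B -> coherent2 (mem A) (mem B).
Proof.
  intros Hc HM k A B HA HB. assert (Hq : (0 < q)%Z) by apply Hc.
  destruct (top_end q b Hc) as (T0 & Tq & Tm).
  (* For [q = 1] the two triangles share the diagonal of the square; otherwise they meet at most in
     the node over abscissa 1, and that only for [q = 2]. *)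
  assert (LR : coherent2 (mem (corner_right q b)) (mem (corner_left q b))).
  { apply below_coherent2. destruct (Z.eq_dec q 1) as [E1|E1].
    - subst q. destruct Hc as (_ & B0 & Bq & _).
      assert (X : forall v, mem (corner_right 1 b) v -> v = (1, 0, 0)%Z \/ v = (1, 1, 0)%Z \/ v = (0, 0, 0)%Z).
      { intros v [<-|[<-|[<-|[]]]]; unfold node; change (1 - 1)%Z with 0%Z; rewrite ?B0, ?Bq, ?Tq; auto. }
      assert (Y : forall v, mem (corner_left 1 b) v -> v = (0, 0, 0)%Z \/ v = (0, 1, 0)%Z \/ v = (1, 1, 0)%Z).
      { intros v [<-|[<-|[<-|[]]]]; unfold node; rewrite ?B0, ?T0, ?Tq; auto. }
      apply (below_line (0, 0, 0)%Z (1, 1, 0)%Z).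
      + unfold_cross; lia.
      + intros v Hv; destruct (X v Hv) as [-> |[-> | ->]]; unfold_cross; lia.
      + intros v Hv; destruct (Y v Hv) as [-> |[-> | ->]]; unfold_cross; lia.
      + intros v [Hv|Hv]; [destruct (X v Hv) as [-> |[-> | ->]]|destruct (Y v Hv) as [-> |[-> | ->]]]; auto;
          unfold_cross; intro; lia.
    - apply (below_xsep (node b 1)).
      + right. split; intros v [<-|[<-|[<-|[]]]]; unfold_cross; lia.
      + intros v [<-|[<-|[<-|[]]]]; unfold_cross; intro e; try lia. right. rewrite e; reflexivity.
      + intros v [<-|[<-|[<-|[]]]]; unfold_cross; intro e; try lia. right. unfold node. rewrite Tm by lia. auto. }
  inversion HA; subst; inversion HB; subst.
  - apply HM; auto.
  - apply below_coherent2, (edge_nodes_below q); auto; lia.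
  - apply coherent2_triangle; auto. unfold_cross. rewrite T0. destruct Hc as (_ & B0 & _). rewrite B0. lia.
  - apply coherent2_sym; auto.
  - auto.
  - apply coherent2_triangle; auto. unfold_cross. rewrite Tq. destruct Hc as (_ & _ & Bq & _). rewrite Bq. lia.
  - apply below_coherent2, (edge_nodes_below q); auto; lia.
  - intros mu nu Hm Hn. apply (coherent2_rot q (mem (triangle_nodes b t)) (mem (triangle_nodes b t0))).
    + apply HM; auto.
    + eapply supported_mono; [|exact Hm]. intro; apply in_map_rot.
    + eapply supported_mono; [|exact Hn]. intro; apply in_map_rot.
Qed.

(** * The lattice chain and the areas under it *)

Lemma chain_exists p q : (1 <= q)%Z -> Z.gcd p q = 1%Z ->
  exists b r, chain q b /\ (forall l, (q | l - b l * pprime p q)%Z) /\ (forall l, (q | r * l - b l)%Z).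
Proof.
  intros Hq Hg.
  assert (Hg' : Z.gcd (pprime p q) q = 1%Z).
  { unfold pprime. rewrite Z.gcd_mod by lia. rewrite Z.gcd_opp_r, Z.gcd_comm. auto. }
  destruct (Z.gcd_bezout _ _ _ Hg') as (r & s & Hr).
  (* By the Bezout identity [r] inverts [p'] modulo [q], so the lattice points over abscissa [l] in
     the plane z = 0 have ordinates congruent to [r * l]. *)
  exists (fun l => (r * l) mod q)%Z, r.
  assert (D : forall l, (q | r * l - (r * l) mod q)%Z).
  { intro l. exists ((r * l) / q)%Z. rewrite Z.mod_eq by lia. ring. }
  assert (C : forall l, (q | l - (r * l) mod q * pprime p q)%Z).
  { intro l. destruct (D l) as [k Hk].
    exists (s * l + k * pprime p q)%Z.
    replace ((r * l) mod q)%Z with (r * l - k * q)%Z by lia.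
    transitivity (l * (r * pprime p q + s * q) - r * l * pprime p q + k * q * pprime p q)%Z; [rewrite Hr|]; ring. }
  split; [|split; auto].
  split; [lia|]. split; [rewrite Z.mul_0_r; apply Z.mod_0_l; lia|].
  split; [apply Z.mod_mul; lia|].
  intros l Hl. assert (B := Z.mod_pos_bound (r * l) q ltac:(lia)).
  assert (N : ((r * l) mod q <> 0)%Z).
  { intro N. destruct (C l) as [k Hk]. rewrite N in Hk. assert (l = k * q)%Z by lia. assert (k <= 0 \/ 1 <= k)%Z as [?|?] by lia; nia. }
  split; [lia|].
  replace (r * (q - l))%Z with (- (r * l) + r * q)%Z by ring.
  rewrite Z.mod_add by lia. apply Z.mod_opp_l_nz; lia.
Qed.

(** Twice the area under the first [n] edges of the path. *)
Fixpoint trapezia (b : Z -> Z) (n : nat) : Z :=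
  match n with
  | O => 0
  | S n => trapezia b n + b (Z.of_nat n) + b (Z.of_nat n + 1)
  end%Z.

(** Summing from the right end gives the same area. In the sum of both counts the heights at [l] and
    [q - l] pair to [q], except at the two ends, where they vanish. *)
Lemma trapezia_chain q b : chain q b -> trapezia b (Z.to_nat q) = (q * (q - 1))%Z.
Proof.
  intros (Hq & B0 & Bq & H).
  set (b' := fun l => b (q - l)%Z).
  assert (R : forall n, (Z.of_nat n <= q)%Z ->
    (trapezia b (Z.to_nat q) = trapezia b (Z.to_nat q - n) + trapezia b' n)%Z).
  { induction n as [|n IH]; intro Hn.
    - rewrite Nat.sub_0_r. simpl. ring.
    - rewrite IH by lia. simpl.
      replace (Z.to_nat q - n)%nat with (S (Z.to_nat q - S n)) by lia. simpl. unfold b'.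
      replace (Z.of_nat (Z.to_nat q - S n) + 1)%Z with (q - Z.of_nat n)%Z by lia.
      replace (Z.of_nat (Z.to_nat q - S n))%Z with (q - (Z.of_nat n + 1))%Z by lia. ring. }
  (* The deficit [q] is the pair missing at the left end; the last edge brings a second one. *)
  assert (S : forall n, (Z.of_nat n < q)%Z -> (0 < n)%nat ->
    (trapezia b n + trapezia b' n = 2 * q * Z.of_nat n - q)%Z).
  { induction n as [|n IH]; [lia|]. intros Hn _.
    assert (P : (b (Z.of_nat n + 1) + b' (Z.of_nat n + 1) = q)%Z).
    { unfold b'. destruct (H (Z.of_nat n + 1)%Z) as [_ ->]; lia. }
    destruct n as [|n].
    - change (trapezia b 1) with (0 + b 0 + b (0 + 1))%Z.
      change (trapezia b' 1) with (0 + b (q - 0) + b' (0 + 1))%Z.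
      change (Z.of_nat 0) with 0%Z in P. change (Z.of_nat 1) with 1%Z.
      rewrite B0, Z.sub_0_r, Bq. lia.
    - change (trapezia b (S (S n))) with (trapezia b (S n) + b (Z.of_nat (S n)) + b (Z.of_nat (S n) + 1))%Z.
      change (trapezia b' (S (S n))) with (trapezia b' (S n) + b' (Z.of_nat (S n)) + b' (Z.of_nat (S n) + 1))%Z.
      specialize (IH ltac:(lia) ltac:(lia)).
      assert (P' : (b (Z.of_nat (S n)) + b' (Z.of_nat (S n)) = q)%Z).
      { unfold b'. destruct (H (Z.of_nat (S n))%Z) as [_ ->]; lia. }
      lia. }
  assert (T := R (Z.to_nat q) ltac:(lia)). rewrite Nat.sub_diag in T. simpl in T.
  assert (L : (trapezia b (Z.to_nat q) + trapezia b' (Z.to_nat q) = 2 * q * (q - 1))%Z); [|lia].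
  destruct (Z.eq_dec q 1) as [->|H1].
  { change (Z.to_nat 1) with 1%nat. cbn [trapezia]. unfold b'. change (Z.of_nat 0) with 0%Z.
    change (1 - 0)%Z with 1%Z. change (0 + 1)%Z with 1%Z. change (1 - 1)%Z with 0%Z. rewrite B0, Bq. lia. }
  assert (T' := S (Z.to_nat (q - 1)) ltac:(lia) ltac:(lia)).
  replace (Z.to_nat q) with (Datatypes.S (Z.to_nat (q - 1))) by lia. cbn [trapezia].
  rewrite Z2Nat.id in * by lia. replace (q - 1 + 1)%Z with q by lia.
  assert (P : (b (q - 1) + b' (q - 1) = q)%Z) by (unfold b'; destruct (H (q - 1)%Z) as [_ ->]; lia).
  unfold b' at 3. rewrite Z.sub_diag, Bq, B0. lia.
Qed.

Lemma mountains_exist q b r : chain q b -> (forall l, (q | r * l - b l)%Z) -> exists M, mountains q b M.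
Proof.
  intros Hc Hr. assert (T := trapezia_chain q b Hc). destruct Hc as (Hq & B0 & Bq & H).
  destruct (mountain b (fun l => trapezia b (Z.to_nat l))) with (n := Z.to_nat (q - 1)) (i := 0%Z) (j := q)
    as (M & L & R & A & Bl & C & V); try lia.
  - intros l Hl. replace (Z.to_nat (l + 1)) with (S (Z.to_nat l)) by lia. simpl.
    replace (Z.of_nat (Z.to_nat l)) with l by lia. reflexivity.
  - intros l Hl. rewrite cross_node, B0, Bq. specialize (H l Hl). nia.
  - exists M. split; [|split; [exact Bl|split; [exact C|]]].
    + rewrite T, B0, Bq in A. simpl trapezia in A.
      (* Modulo [q] the ordinates are a linear function of the abscissa, so the nodes are collinear
         modulo [q] and the cross product is divisible by [q]. *)
      assert (D : forall t, In t M -> (q | tri_area b t)%Z /\ (0 < tri_area b t)%Z).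
      { intros [[a m] d] Ht. destruct (R a m d Ht) as [_ Hp]. split; auto.
        unfold tri_area. rewrite cross_node.
        destruct (Hr a) as [ka Ka], (Hr m) as [km Km], (Hr d) as [kuhn_edge Kd].
        replace (b a) with (r * a - ka * q)%Z by lia. replace (b m) with (r * m - km * q)%Z by lia.
        replace (b d) with (r * d - kuhn_edge * q)%Z by lia.
        exists ((d - a) * (ka - km) - (ka - kuhn_edge) * (m - a))%Z. ring. }
      assert (G : forall M : list (Z * Z * Z), (forall t, In t M -> (q | tri_area b t)%Z /\ (0 < tri_area b t)%Z) ->
        (q * Z.of_nat (length M) <= fold_right (fun t s => tri_area b t + s) 0 M)%Z /\
        ((fold_right (fun t s => tri_area b t + s) 0 M <= q * Z.of_nat (length M))%Z ->
         forall t, In t M -> tri_area b t = q)).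
      { clear - Hq. induction M as [|t M IH]; intro HD; [simpl; split; [lia|intros _ t []]|].
        destruct (IH (fun u Hu => HD u (or_intror Hu))) as [I1 I2].
        destruct (HD t (or_introl eq_refl)) as [[k Hk] Hp].
        assert (1 <= k)%Z by nia. assert (q <= tri_area b t)%Z by nia.
        change (length (t :: M)) with (S (length M)). rewrite Nat2Z.inj_succ.
        simpl fold_right. split; [lia|].
        intros HS u [<-|Hu]; [lia|]. apply I2; auto. lia. }
      destruct (G M D) as [_ G2]. intros a m d Ht. split; [apply R; auto|]. apply G2; auto.
      rewrite A, L, Z2Nat.id by lia. change (trapezia b (Z.to_nat 0)) with 0%Z. lia.
    + intros l s X Y H2 Hl HX HY. apply (V l s X Y); auto; try lia; try lra.
      rewrite B0, Bq. rewrite minus_IZR. assert (0 < IZR q) by (apply IZR_lt; lia).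
      assert (0 <= IZR q * Y) by (apply Rmult_le_pos; lra). lra.
Qed.

(* Ordinate, over abscissa X, of the edge of the chain b over [l, l+1] (for total mass s). *)
Definition height (b : Z -> Z) (l : Z) (s X : R) : R :=
  (IZR (l + 1) * s - X) * IZR (b l) + (X - IZR l * s) * IZR (b (l + 1)%Z).

Definition slice_at q b M k (s X Y : R) : Prop :=
  exists A mu, slice q b M k A /\ supported (mem A) mu /\ integral mu f1 = s /\ integral mu fx = X /\ integral mu fy = Y.

Lemma slice_at_rot q b M k s X Y : (0 < q)%Z -> slice_at q b M k (s) (IZR q * s - X) (IZR q * s - Y) ->
  slice_at q b M (4 - k) s X Y.
Proof.
  intros Hq (A & mu & HA & Hm & H1 & H2 & H3).
  destruct (slice_rot _ _ _ _ _ Hq HA) as (A' & SA & EA).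
  exists A', (map (fun p => (fst p, rot q (snd p))) mu).
  split; auto. split.
  - apply (supported_map _ (rot q) mu _ Hm). intros v Hv. apply EA. rewrite rot_rot; auto.
  - destruct (integral_rot q mu) as (R1 & R2 & R3). rewrite !integral_map, R1, R2, R3, H1, H2, H3. repeat split; ring.
Qed.

(** Over an inner edge the two paths coincide and level 2 has no simplex; the strict inequality in
    its clause excludes points there. For [q = 1] the two corner triangles fill the square, so no
    strictness is required. *)
Lemma slice_cover q b M l s X Y : chain q b -> mountains q b M -> (0 <= l < q)%Z ->
  IZR l * s <= X <= IZR (l + 1) * s ->
  ((2 <= q)%Z -> 0 <= Y <= height b l s X -> slice_at q b M 0 s X Y) /\
  (Y = height b l s X -> slice_at q b M 1 s X Y) /\
  ((height b l s X < Y \/ q = 1%Z) -> height b l s X <= Y <= height (top q b) l s X -> slice_at q b M 2 s X Y) /\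
  (Y = height (top q b) l s X -> slice_at q b M 3 s X Y) /\
  ((2 <= q)%Z -> height (top q b) l s X <= Y <= IZR q * s -> slice_at q b M 4 s X Y).
Proof.
  intros Hc HM. assert (Hq : (0 < q)%Z) by apply Hc.
  destruct (top_end q b Hc) as (T0 & Tq & Tm).
  set (P0 := fun l X Y => (2 <= q)%Z -> 0 <= Y <= height b l s X -> slice_at q b M 0 s X Y).
  set (P2 := fun l X Y => (height b l s X < Y \/ q = 1%Z) -> height b l s X <= Y <= height (top q b) l s X ->
    slice_at q b M 2 s X Y).
  assert (Edge : forall c k l, (forall l, (0 <= l < q)%Z -> slice q b M k (edge_nodes c l)) -> (0 <= l < q)%Z ->
    IZR l * s <= X <= IZR (l + 1) * s -> Y = height c l s X -> slice_at q b M k s X Y).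
  { clear l. intros c k l HS Hl HX ->.
    exists (edge_nodes c l), [(IZR (l + 1) * s - X, node c l); (X - IZR l * s, node c (l + 1))].
    split; [auto|]. split.
    - constructor; [split; [cbn [fst]; lra|left; reflexivity]|].
      constructor; [split; [cbn [fst]; lra|right; left; reflexivity]|]. constructor.
    - rewrite !integral_cons, !integral_nil. cbn [fst snd]. unfold height, f1, fx, fy, node, px, py; cbn [fst snd].
      rewrite !plus_IZR. repeat split; ring. }
  assert (Flip : forall l X, (0 <= l < q)%Z ->
    IZR q * s - height (top q b) l s X = height b (q - 1 - l) s (IZR q * s - X) /\
    IZR q * s - height b l s X = height (top q b) (q - 1 - l) s (IZR q * s - X)).
  { clear. intros l X Hl. unfold height, top.
    replace (q - 1 - l + 1)%Z with (q - l)%Z by lia. replace (q - (q - 1 - l))%Z with (l + 1)%Z by lia.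
    replace (q - (q - l))%Z with l by lia. replace (q - (l + 1))%Z with (q - 1 - l)%Z by lia.
    rewrite !minus_IZR, !plus_IZR. split; ring. }
  assert (Flip' : forall l X, (0 <= l < q)%Z -> IZR l * s <= X <= IZR (l + 1) * s ->
    (0 <= q - 1 - l < q)%Z /\ IZR (q - 1 - l) * s <= IZR q * s - X <= IZR (q - 1 - l + 1) * s).
  { clear. intros l X Hl HX. split; [lia|]. rewrite !plus_IZR, !minus_IZR in *. lra. }
  assert (C0 : forall l X Y, (0 <= l < q)%Z -> IZR l * s <= X <= IZR (l + 1) * s -> P0 l X Y).
  { clear l X Y Edge. intros l X Y Hl HX H2 HY. destruct HM as (_ & _ & _ & V).
    destruct (V l s X Y H2 Hl HX HY) as (t & mu & Ht & Hm & E1).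
    exists (triangle_nodes b t), mu. split; [constructor; auto|]. split; auto. }
  assert (C2 : forall X Y, 0 <= X <= s -> (2 <= q)%Z ->
    height b 0 s X <= Y <= height (top q b) 0 s X -> slice_at q b M 2 s X Y).
  { clear l X Y Edge C0 P2. intros X Y HX H2 HY. destruct Hc as (_ & B0 & Bq & H).
    unfold height in HY. change (0 + 1)%Z with 1%Z in HY. rewrite T0, B0, (Tm 1%Z) in HY by lia.
    assert (Q : 0 < IZR q) by (apply IZR_lt; lia).
    exists (corner_left q b), [(s - X - (Y - X * IZR (b 1%Z)) / IZR q, node b 0);
      ((Y - X * IZR (b 1%Z)) / IZR q, node (top q b) 0); (X, node (top q b) 1)].
    split; [constructor|]. split.
    - constructor; [split; cbn [fst snd]; [|left; reflexivity]|].
      + assert ((Y - X * IZR (b 1%Z)) / IZR q <= s - X); [|lra].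
        apply Rmult_le_reg_r with (IZR q); auto. field_simplify; lra.
      + constructor; [split; cbn [fst snd]; [|right; left; reflexivity]|].
        * apply Rle_mult_inv_pos; lra.
        * constructor; [split; cbn [fst snd]; [lra|right; right; left; reflexivity]|]. constructor.
    - rewrite !integral_cons, !integral_nil. cbn [fst snd]. unfold f1, fx, fy, node, px, py; cbn [fst snd].
      rewrite T0, B0, (Tm 1%Z) by lia. repeat split; field; lra. }
  intros Hl HX. split; [|split; [|split; [|split]]].
  - apply C0; auto.
  - apply Edge; auto. intros; constructor; auto.
  - intros Hs HY. destruct (Z.eq_dec q 1) as [E1|E1].
    + clear C0 C2 Edge Flip Flip'. assert (l = 0)%Z by lia. subst l q. destruct Hc as (_ & B0 & Bq & _).
      unfold height in HY. simpl in HX. change (0 + 1)%Z with 1%Z in HY. rewrite B0, Bq, T0, Tq in HY.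
      destruct (Rle_dec X Y) as [L|L].
      * exists (corner_left 1 b), [(s - Y, node b 0); (Y - X, node (top 1 b) 0); (X, node (top 1 b) 1)].
        split; [constructor|]. split.
        -- constructor; [split; cbn [fst snd]; [lra|left; reflexivity]|].
           constructor; [split; cbn [fst snd]; [lra|right; left; reflexivity]|].
           constructor; [split; cbn [fst snd]; [lra|right; right; left; reflexivity]|]. constructor.
        -- rewrite !integral_cons, !integral_nil. cbn [fst snd]. unfold f1, fx, fy, node, px, py; cbn [fst snd].
           rewrite T0, B0, Tq. repeat split; ring.
      * exists (corner_right 1 b), [(X - Y, node b 1); (Y, node (top 1 b) 1); (s - X, node b (1 - 1))].
        split; [constructor|]. split.
        -- constructor; [split; cbn [fst snd]; [lra|left; reflexivity]|].
           constructor; [split; cbn [fst snd]; [lra|right; left; reflexivity]|].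
           constructor; [split; cbn [fst snd]; [lra|right; right; left; reflexivity]|]. constructor.
        -- rewrite !integral_cons, !integral_nil. cbn [fst snd]. unfold f1, fx, fy, node, px, py; cbn [fst snd].
           change (1 - 1)%Z with 0%Z. rewrite B0, Bq, Tq. repeat split; ring.
    + destruct (Z.eq_dec l 0) as [->|L0].
      { apply C2; [simpl in HX; lra|lia|auto]. }
      destruct (Z.eq_dec l (q - 1)) as [->|L1].
      { change 2%nat with (4 - 2)%nat. apply slice_at_rot; auto.
        destruct (Flip _ X Hl) as [F1 F2]. destruct (Flip' _ X Hl HX) as [G1 G2].
        replace (q - 1 - (q - 1))%Z with 0%Z in * by lia. simpl in G2.
        apply C2; [lra|lia|]. rewrite <- F1, <- F2. lra. }
      exfalso. unfold height in HY, Hs. rewrite !Tm in HY by lia. destruct Hs; [lra|lia].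
  - apply Edge; auto. intros; constructor; auto.
  - intros H2 HY. change 4%nat with (4 - 0)%nat. apply slice_at_rot; auto.
    destruct (Flip _ X Hl) as [F1 F2]. destruct (Flip' _ X Hl HX) as [G1 G2].
    apply (C0 (q - 1 - l)%Z); auto. rewrite <- F1. lra.
Qed.

(** * Joining the square with apices *)

Lemma two_points_y (p r : zpt) mu nu : (py p <> py r) ->
  supported (fun v => v = p \/ v = r) mu -> supported (fun v => v = p \/ v = r) nu ->
  integral mu f1 = integral nu f1 -> integral mu fy = integral nu fy -> forall g, integral mu g = integral nu g.
Proof.
  intros Hpr Hm Hn H1 H2 g.
  set (s := (g r - g p) / (fy r - fy p)).
  assert (Hne : fy r - fy p <> 0).
  { unfold fy. rewrite <- minus_IZR. apply not_0_IZR. lia. }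
  assert (Hg : forall v, v = p \/ v = r -> g v = affine (g p - s * fy p) 0 s 0 v).
  { unfold affine; intros v [-> | ->]; [ring|]. unfold s; field; auto. }
  rewrite (integral_ext _ _ _ _ Hm Hg), (integral_ext _ _ _ _ Hn Hg), !integral_affine, H1, H2. ring.
Qed.

Lemma integral_const P m g c : supported P m -> (forall v, P v -> g v = c) -> integral m g = c * integral m f1.
Proof.
  intros Hm Hg. rewrite (integral_ext _ _ g (fun v => c + 0 * f1 v) Hm).
  - rewrite (integral_lin m (fun _ => c) f1 0), Rmult_0_l, Rplus_0_r.
    clear. unfold f1. induction m as [|p m IH]; [unfold integral; simpl; lra|rewrite !integral_cons, IH; ring].
  - intros v Hv. rewrite Hg by auto. ring.
Qed.

(* The apices lie on a line of constant abscissa, so a measure on a join determines the mass and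
   the abscissa of both parts, and monotonicity determines how the ordinate splits. *)
Lemma join_coherent (x0 sg : Z) A1 A2 F1 F2 : sg <> 0%Z ->
  (forall v, A1 v \/ A2 v -> pz v = 0%Z) -> (forall v, F1 v \/ F2 v -> px v = x0 /\ pz v = sg) ->
  (below A1 A2 /\ below F1 F2) \/
  (coherent2 A1 A2 /\ exists u, forall v, F1 v \/ F2 v -> v = u) \/
  (below A1 A2 /\ below A2 A1 /\ coherent2 F1 F2) ->
  coherent (fun v => F1 v \/ A1 v) (fun v => F2 v \/ A2 v).
Proof.
  intros Hsg HA HF H mu nu Hm Hn M1 M2 M3 M4 g.
  destruct (supported_split _ _ _ Hm) as (mf & ma & Omf & Oma & Em).
  destruct (supported_split _ _ _ Hn) as (nf & na & Onf & Ona & En).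
  rewrite Em, En in *.
  assert (Z1 : integral ma fz = 0 * integral ma f1).
  { apply (integral_const _ _ _ _ Oma). intros v Hv. unfold fz. rewrite HA; auto. }
  assert (Z2 : integral na fz = 0 * integral na f1).
  { apply (integral_const _ _ _ _ Ona). intros v Hv. unfold fz. rewrite HA; auto. }
  assert (Z3 : integral mf fz = IZR sg * integral mf f1).
  { apply (integral_const _ _ _ _ Omf). intros v Hv. unfold fz. destruct (HF v) as [_ ->]; auto. }
  assert (Z4 : integral nf fz = IZR sg * integral nf f1).
  { apply (integral_const _ _ _ _ Onf). intros v Hv. unfold fz. destruct (HF v) as [_ ->]; auto. }
  assert (X3 : integral mf fx = IZR x0 * integral mf f1).
  { apply (integral_const _ _ _ _ Omf). intros v Hv. unfold fx. destruct (HF v) as [-> _]; auto. }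
  assert (X4 : integral nf fx = IZR x0 * integral nf f1).
  { apply (integral_const _ _ _ _ Onf). intros v Hv. unfold fx. destruct (HF v) as [-> _]; auto. }
  assert (SG : IZR sg <> 0) by (apply not_0_IZR; auto).
  assert (MF : integral mf f1 = integral nf f1).
  { apply Rmult_eq_reg_l with (IZR sg); auto. lra. }
  assert (MA : integral ma f1 = integral na f1) by lra.
  assert (XF : integral mf fx = integral nf fx) by (rewrite X3, X4, MF; auto).
  assert (XA : integral ma fx = integral na fx) by lra.
  (* The two ordinates have equal sums. They agree separately since both differ in the same
     direction, or since there is one apex only, or since the parts in the square are ordered both
     ways. *)
  destruct H as [[B1 B2]|[[C [u HU]]|[B1 [B2 C]]]].
  - destruct (B1 ma na) as [L1 G1]; auto. destruct (B2 mf nf) as [L2 G2]; auto.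
    rewrite G1, G2; auto; lra.
  - assert (G : forall g, integral mf g = integral nf g).
    { intro h. rewrite (integral_const _ mf h (h u) Omf), (integral_const _ nf h (h u) Onf), MF; auto;
        intros v Hv; rewrite (HU v); auto. }
    rewrite G, (C ma na); auto. rewrite G in M3. lra.
  - destruct (B1 ma na) as [L1 G1]; auto. destruct (B2 na ma) as [L2 G2]; auto.
    rewrite G1, (C mf nf); auto; lra.
Qed.

Definition apex (q x0 sg n : Z) : zpt := (x0, q * n, sg)%Z.

Definition apices (q x0 sg n0 n1 n2 : Z) (k : nat) : list zpt :=
  match k with
  | 0 => [apex q x0 sg n0]
  | 1 => [apex q x0 sg n0; apex q x0 sg n1]
  | 2 => [apex q x0 sg n1]
  | 3 => [apex q x0 sg n1; apex q x0 sg n2]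
  | _ => [apex q x0 sg n2]
  end%nat.

(* The half of D_e on the side z >= 0 (sg = 1) or z <= 0 (sg = -1): level k of the square is joined with
   one apex or with an edge between two consecutive apices. The same description covers D_0 and D_1 because
   levels 1 and 3 disappear when their two apices coincide. *)
Definition half (q : Z) (b : Z -> Z) M (x0 sg n0 n1 n2 : Z) (T : list zpt) : Prop :=
  exists k A, slice q b M k A /\ (k = 1%nat -> n0 < n1)%Z /\ (k = 3%nat -> n1 < n2)%Z /\
    T = apices q x0 sg n0 n1 n2 k ++ A.

Definition zseq (n : Z) : list Z := map Z.of_nat (seq 0 (Z.to_nat n)).

Lemma in_zseq n i : In i (zseq n) <-> (0 <= i < n)%Z.
Proof.
  unfold zseq. rewrite in_map_iff. split.
  - intros (m & <- & H). apply in_seq in H. lia.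
  - intro H. exists (Z.to_nat i). split; [lia|]. apply in_seq. lia.
Qed.

Lemma half_list q b M x0 sg n0 n1 n2 :
  exists L, forall T, In T L <-> half q b M x0 sg n0 n1 n2 T.
Proof.
  set (ap := apices q x0 sg n0 n1 n2).
  exists (map (fun t => ap 0%nat ++ triangle_nodes b t) M ++
    (if Z_lt_dec n0 n1 then map (fun l => ap 1%nat ++ edge_nodes b l) (zseq q) else []) ++
    [ap 2%nat ++ corner_left q b; ap 2%nat ++ corner_right q b] ++
    (if Z_lt_dec n1 n2 then map (fun l => ap 3%nat ++ edge_nodes (top q b) l) (zseq q) else []) ++
    map (fun t => ap 4%nat ++ map (rot q) (triangle_nodes b t)) M).
  intro T. rewrite !in_app_iff. split.
  - intros [H|[H|[H|[H|H]]]].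
    + apply in_map_iff in H. destruct H as (t & <- & Ht).
      exists 0%nat, (triangle_nodes b t). repeat split; auto; try lia. constructor; auto.
    + destruct (Z_lt_dec n0 n1); [|destruct H].
      apply in_map_iff in H. destruct H as (l0 & <- & Ht). apply in_zseq in Ht.
      exists 1%nat, (edge_nodes b l0). repeat split; auto; try lia. constructor; auto.
    + destruct H as [<-|[<-|[]]]; eexists 2%nat, _; repeat split; try lia; constructor.
    + destruct (Z_lt_dec n1 n2); [|destruct H].
      apply in_map_iff in H. destruct H as (l0 & <- & Ht). apply in_zseq in Ht.
      exists 3%nat, (edge_nodes (top q b) l0). repeat split; auto; try lia. constructor; auto.
    + apply in_map_iff in H. destruct H as (t & <- & Ht).
      exists 4%nat, (map (rot q) (triangle_nodes b t)). repeat split; auto; try lia. constructor; auto.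
  - intros (k & A & HA & H1 & H3 & ->). destruct HA as [t Ht|l Hl| | |l Hl|t Ht].
    + left. apply in_map_iff. exists t; auto.
    + right; left. destruct (Z_lt_dec n0 n1); [|tauto].
      apply in_map_iff. exists l; rewrite in_zseq; auto.
    + do 2 right; left. left; auto.
    + do 2 right; left. right; left; auto.
    + do 3 right; left. destruct (Z_lt_dec n1 n2); [|tauto].
      apply in_map_iff. exists l; rewrite in_zseq; auto.
    + do 4 right. apply in_map_iff. exists t; auto.
Qed.

Lemma slice_le4 q b M k A : slice q b M k A -> (k <= 4)%nat.
Proof. intros []; lia. Qed.

(** Levels and apices increase together, so joins at different levels are ordered in both parts. At
    one level either the apex is unique, or it is a path edge joined with an apex edge. *)
Lemma half_coherent q b M x0 sg n0 n1 n2 : chain q b -> mountains q b M -> sg <> 0%Z ->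
  (n0 <= n1 <= n2)%Z -> forall T1 T2, half q b M x0 sg n0 n1 n2 T1 -> half q b M x0 sg n0 n1 n2 T2 ->
  coherent (mem T1) (mem T2).
Proof.
  intros Hc HM Hsg Hn T1 T2 (k & A & HA & K1 & K3 & ->) (k' & A' & HA' & K1' & K3' & ->).
  assert (Hq : (0 < q)%Z) by apply Hc.
  set (ap := apices q x0 sg n0 n1 n2).
  assert (AP : forall k v, mem (ap k) v -> px v = x0 /\ pz v = sg).
  { clear. intros k v. unfold ap, apices, mem.
    destruct k as [|[|[|[|k]]]]; simpl; intuition subst; reflexivity. }
  assert (W : forall k k' A A', (k < k')%nat -> slice q b M k A -> slice q b M k' A' ->
    coherent (fun v => mem (ap k) v \/ mem A v) (fun v => mem (ap k') v \/ mem A' v)).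
  { clear k k' A A' HA HA' K1 K3 K1' K3'. intros k k' A A' Hk HA HA'.
    apply (join_coherent x0 sg); auto.
    - intros v [Hv|Hv]; [apply (slice_z q b M k A)|apply (slice_z q b M k' A')]; auto.
    - intros v [Hv|Hv]; eauto.
    - left. split; [apply (slice_below q b M Hc HM k k'); auto|].
      assert (C : exists n, (forall v, mem (ap k) v -> (py v <= q * n)%Z) /\ (forall v, mem (ap k') v -> (q * n <= py v)%Z)).
      { assert (q * n0 <= q * n1)%Z by nia. assert (q * n1 <= q * n2)%Z by nia.
        apply slice_le4 in HA. apply slice_le4 in HA'.
        (* The topmost apex of level [k]; all apices of higher levels lie at or above it. *)
        exists (match k with 0 => n0 | 1 => n1 | 2 => n1 | _ => n2 end%nat)%Z.
        unfold ap, mem; destruct k as [|[|[|[|[|k]]]]]; destruct k' as [|[|[|[|[|k']]]]]; try lia;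
          split; intros v Hv; simpl in Hv; intuition subst; unfold apex, py; simpl; lia. }
      destruct C as (n & C1 & C2).
      apply (below_xsep (x0, q * n, sg)%Z).
      + left. split; intros v Hv; destruct (AP _ _ Hv) as [-> _]; unfold px; simpl; lia.
      + intros v Hv _. destruct (AP _ _ Hv) as [X Z]. assert (Y := C1 v Hv).
        destruct (Z.eq_dec (py v) (q * n)) as [e|e]; [right; apply zpt_ext; auto|left; unfold py at 2; simpl; lia].
      + intros v Hv _. destruct (AP _ _ Hv) as [X Z]. assert (Y := C2 v Hv).
        destruct (Z.eq_dec (py v) (q * n)) as [e|e]; [right; apply zpt_ext; auto|left; unfold py at 1; simpl; lia]. }
  assert (R : forall F A v, mem (F ++ A) v -> mem F v \/ mem A v) by (intros F B v; apply in_app_or).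
  destruct (Nat.lt_trichotomy k k') as [L|[<-|L]].
  - eapply coherent_mono; [apply R|apply R|]. apply W; auto.
  - eapply coherent_mono; [apply R|apply R|]. apply (join_coherent x0 sg); auto.
    + intros v [Hv|Hv]; [apply (slice_z q b M k A)|apply (slice_z q b M k A')]; auto.
    + intros v [Hv|Hv]; eauto.
    + right.
      assert (TP : forall m n, (m < n)%Z -> coherent2 (mem [apex q x0 sg m; apex q x0 sg n]) (mem [apex q x0 sg m; apex q x0 sg n])).
      { intros m n L mu nu Om On E1 _ E3.
        apply (two_points_y (apex q x0 sg m) (apex q x0 sg n)); auto.
        - unfold apex, py; simpl; nia.
        - eapply supported_mono; [|exact Om]. unfold mem; simpl; intuition.
        - eapply supported_mono; [|exact On]. unfold mem; simpl; intuition. }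
      assert (S := slice_coherent2 q b M Hc HM k A A' HA HA').
      assert (k4 := slice_le4 _ _ _ _ _ HA).
      destruct k as [|[|[|[|[|k]]]]]; try lia.
      * left. split; auto. eexists. intros v [[<-|[]]|[<-|[]]]; reflexivity.
      * right. split; [|split]; [apply (slice_edges q b M 1); auto|apply (slice_edges q b M 1); auto|apply TP; auto].
      * left. split; auto. eexists. intros v [[<-|[]]|[<-|[]]]; reflexivity.
      * right. split; [|split]; [apply (slice_edges q b M 3); auto|apply (slice_edges q b M 3); auto|apply TP; auto].
      * left. split; auto. eexists. intros v [[<-|[]]|[<-|[]]]; reflexivity.
  - apply coherent_sym. eapply coherent_mono; [apply R|apply R|]. apply W; auto.
Qed.

Lemma slice_coherent q b M k k' A A' : chain q b -> mountains q b M ->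
  slice q b M k A -> slice q b M k' A' -> coherent (mem A) (mem A').
Proof.
  intros Hc HM HA HA'. apply coherent2_coherent.
  destruct (Nat.lt_trichotomy k k') as [L|[<-|L]].
  - apply below_coherent2. eapply slice_below; eauto.
  - eapply slice_coherent2; eauto.
  - apply coherent2_sym, below_coherent2. eapply slice_below; eauto.
Qed.

Lemma halves_coherent q b M x0 x1 m0 m1 m2 n0 n1 n2 T1 T2 : chain q b -> mountains q b M ->
  half q b M x0 1 n0 n1 n2 T1 -> half q b M x1 (-1) m0 m1 m2 T2 -> coherent (mem T1) (mem T2).
Proof.
  intros Hc HM (k & A & HA & _ & _ & ->) (k' & A' & HA' & _ & _ & ->).
  assert (AP : forall x sg n0 n1 n2 k v, mem (apices q x sg n0 n1 n2 k) v -> pz v = sg).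
  { clear. intros x sg n0 n1 n2 k v. unfold apices, mem.
    destruct k as [|[|[|[|k]]]]; simpl; intuition subst; reflexivity. }
  assert (R : forall F A v, mem (F ++ A) v -> mem F v \/ mem A v) by (intros F B v; apply in_app_or).
  apply (coherent_sep 0 0 0 (-1)).
  - intros v Hv. unfold affine, fz. destruct (R _ _ _ Hv) as [Hv'|Hv'];
      [rewrite (AP _ _ _ _ _ _ _ Hv')|rewrite (slice_z _ _ _ _ _ _ HA Hv')]; lra.
  - intros v Hv. unfold affine, fz. destruct (R _ _ _ Hv) as [Hv'|Hv'];
      [rewrite (AP _ _ _ _ _ _ _ Hv')|rewrite (slice_z _ _ _ _ _ _ HA' Hv')]; lra.
  - eapply coherent_mono; [| |apply (slice_coherent q b M k k' A A'); auto].
    + intros v [Hv Hz]. unfold affine, fz in Hz. destruct (R _ _ _ Hv) as [Hv'|Hv']; auto.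
      rewrite (AP _ _ _ _ _ _ _ Hv') in Hz. lra.
    + intros v [Hv Hz]. unfold affine, fz in Hz. destruct (R _ _ _ Hv) as [Hv'|Hv']; auto.
      rewrite (AP _ _ _ _ _ _ _ Hv') in Hz. lra.
Qed.

(** At distance [t] from the square, apices carry mass [t] and the square carries [1 - t]: the
    section of a join is a weighted Minkowski sum of its two parts. *)
Lemma half_cover q b M x0 sg n0 n1 n2 x y t : chain q b -> mountains q b M ->
  (n0 <= n1 <= n2)%Z -> 0 <= t <= 1 -> 0 <= x - t * IZR x0 <= IZR q * (1 - t) ->
  IZR q * IZR n0 * t <= y <= IZR q * (1 - t) + IZR q * IZR n2 * t ->
  exists T mu, half q b M x0 sg n0 n1 n2 T /\ supported (mem T) mu /\
    integral mu f1 = 1 /\ integral mu fx = x /\ integral mu fy = y /\ integral mu fz = IZR sg * t.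
Proof.
  intros Hc HM Hn Ht HX HY. assert (Hq : (0 < q)%Z) by apply Hc.
  assert (QR : 0 < IZR q) by (apply IZR_lt; auto).
  (* All apices have abscissa [x0], so this is the mass and abscissa left for the square. *)
  set (s := 1 - t) in *. set (X := x - t * IZR x0) in *.
  destruct (find_step q s X) as (l & Hl & Hlx); auto; [unfold s; lra|].
  assert (HB : 0 <= height b l s X /\ height b l s X <= height (top q b) l s X <= IZR q * s).
  { assert (G1 := top_ge q b l Hc ltac:(lia)). assert (G2 := top_ge q b (l + 1) Hc ltac:(lia)).
    destruct G1 as [G1 G1'], G2 as [G2 G2'].
    assert (P1 : 0 <= IZR (l + 1) * s - X) by lra. assert (P2 : 0 <= X - IZR l * s) by lra.
    assert (mono : forall u v u' v', (u <= u')%Z -> (v <= v')%Z ->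
      (IZR (l + 1) * s - X) * IZR u + (X - IZR l * s) * IZR v <=
      (IZR (l + 1) * s - X) * IZR u' + (X - IZR l * s) * IZR v').
    { intros u v u' v' Hu Hv. apply Rplus_le_compat; apply Rmult_le_compat_l; auto; apply IZR_le; auto. }
    unfold height. split; [|split].
    - specialize (mono 0%Z 0%Z (b l) (b (l + 1)%Z)). lra || (assert (H0 := mono ltac:(lia) ltac:(lia)); lra).
    - apply mono; lia.
    - eapply Rle_trans; [apply (mono _ _ q q); lia|]. rewrite plus_IZR. lra. }
  destruct (slice_cover q b M l s X (y - IZR q * IZR n0 * t) Hc HM Hl Hlx) as (C0 & _).
  destruct (slice_cover q b M l s X (height b l s X) Hc HM Hl Hlx) as (_ & C1 & _).
  destruct (slice_cover q b M l s X (y - IZR q * IZR n1 * t) Hc HM Hl Hlx) as (_ & _ & C2 & _).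
  destruct (slice_cover q b M l s X (height (top q b) l s X) Hc HM Hl Hlx) as (_ & _ & _ & C3 & _).
  destruct (slice_cover q b M l s X (y - IZR q * IZR n2 * t) Hc HM Hl Hlx) as (_ & _ & _ & _ & C4).
  assert (one : forall k n Y, slice_at q b M k s X Y -> Y = y - IZR q * IZR n * t ->
    (k <> 1)%nat -> (k <> 3)%nat -> In (apex q x0 sg n) (apices q x0 sg n0 n1 n2 k) ->
    exists T mu, half q b M x0 sg n0 n1 n2 T /\ supported (mem T) mu /\
    integral mu f1 = 1 /\ integral mu fx = x /\ integral mu fy = y /\ integral mu fz = IZR sg * t).
  { intros k n Y (A & mu & HA & Hm & E1 & E2 & E3) -> K1 K3 Hin.
    exists (apices q x0 sg n0 n1 n2 k ++ A), ((t, apex q x0 sg n) :: mu).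
    split; [exists k, A; repeat split; auto; tauto|].
    assert (E4 : integral mu fz = 0 * integral mu f1).
    { apply (integral_const _ _ _ _ Hm). intros v Hv. unfold fz. rewrite (slice_z _ _ _ _ _ _ HA Hv). auto. }
    split.
    - constructor; [split; cbn [fst snd]; [lra|apply in_or_app; auto]|].
      eapply supported_mono; [|exact Hm]. intros v Hv. apply in_or_app; auto.
    - rewrite !integral_cons, E1, E2, E3, E4. cbn [fst snd]. unfold f1, fx, fy, fz, apex, px, py, pz; cbn [fst snd].
      unfold s, X. rewrite mult_IZR. repeat split; ring. }
  assert (two : forall k m n Y, slice_at q b M k s X Y -> (m < n)%Z ->
    IZR q * IZR m * t <= y - Y <= IZR q * IZR n * t ->
    (k = 1%nat -> n0 < n1)%Z -> (k = 3%nat -> n1 < n2)%Z ->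
    apices q x0 sg n0 n1 n2 k = [apex q x0 sg m; apex q x0 sg n] ->
    exists T mu, half q b M x0 sg n0 n1 n2 T /\ supported (mem T) mu /\
    integral mu f1 = 1 /\ integral mu fx = x /\ integral mu fy = y /\ integral mu fz = IZR sg * t).
  { intros k m n Y (A & mu & HA & Hm & E1 & E2 & E3) Hmn HYt K1 K3 Hap.
    assert (MN : 0 < IZR n - IZR m) by (rewrite <- minus_IZR; apply IZR_lt; lia).
    set (w := (y - Y - IZR q * IZR m * t) / (IZR q * (IZR n - IZR m))).
    assert (QM : 0 < IZR q * (IZR n - IZR m)) by (apply Rmult_lt_0_compat; auto).
    assert (W0 : 0 <= w) by (apply Rle_mult_inv_pos; lra).
    assert (We : w * (IZR q * (IZR n - IZR m)) = y - Y - IZR q * IZR m * t) by (unfold w; field; lra).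
    assert (Wt : w <= t).
    { apply Rmult_le_reg_r with (IZR q * (IZR n - IZR m)); auto. rewrite We. lra. }
    exists (apices q x0 sg n0 n1 n2 k ++ A), ((t - w, apex q x0 sg m) :: (w, apex q x0 sg n) :: mu).
    split; [exists k, A; repeat split; auto|].
    assert (E4 : integral mu fz = 0 * integral mu f1).
    { apply (integral_const _ _ _ _ Hm). intros v Hv. unfold fz. rewrite (slice_z _ _ _ _ _ _ HA Hv). auto. }
    split.
    - rewrite Hap.
      constructor; [split; cbn [fst snd]; [lra|left; auto]|].
      constructor; [split; cbn [fst snd]; [lra|right; left; auto]|].
      eapply supported_mono; [|exact Hm]. intros v Hv. apply in_or_app; auto.
    - rewrite !integral_cons, E1, E2, E3, E4. cbn [fst snd]. unfold f1, fx, fy, fz, apex, px, py, pz; cbn [fst snd].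
      unfold s, X. rewrite !mult_IZR. repeat split; try ring.
      transitivity (w * (IZR q * (IZR n - IZR m)) + IZR q * IZR m * t + Y); [ring|rewrite We; ring]. }
  assert (Q1 : q = 1%Z -> height b l s X = 0 /\ height (top q b) l s X = IZR q * s).
  { intros ->. assert (l = 0)%Z by lia. subst l. destruct (top_end _ _ Hc) as (T0 & Tq & _).
    destruct Hc as (_ & B0 & Bq & _). unfold height. change (0 + 1)%Z with 1%Z.
    rewrite T0, Tq, B0, Bq. split; ring. }
  assert (n01 : IZR n0 <= IZR n1) by (apply IZR_le; lia).
  assert (n12 : IZR n1 <= IZR n2) by (apply IZR_le; lia).
  assert (Eq : q = 1%Z \/ (2 <= q)%Z) by lia.
  (* As [y] grows the point passes through levels 0 to 4, and each failed test supplies the lower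
     bound for the next level. For [q = 1] the outer levels are empty and the paths run along the
     bottom and top of the square. *)
  destruct (classic ((2 <= q)%Z /\ y <= height b l s X + IZR q * IZR n0 * t)) as [[H2 H]|NA].
  { apply (one 0%nat n0 _ (C0 H2 ltac:(lra)) eq_refl); auto. left; auto. }
  assert (A1 : height b l s X + IZR q * IZR n0 * t <= y).
  { destruct Eq as [Eq|Eq]; [destruct (Q1 Eq) as [-> _]; lra|].
    apply Rnot_lt_le. intro. apply NA. split; auto. lra. }
  destruct (classic ((n0 < n1)%Z /\ y <= height b l s X + IZR q * IZR n1 * t)) as [[H2 H]|NB].
  { apply (two 1%nat n0 n1 _ (C1 eq_refl) H2); auto; lra || lia. }
  assert (A2 : height b l s X <= y - IZR q * IZR n1 * t /\ (height b l s X < y - IZR q * IZR n1 * t \/ q = 1%Z)).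
  { destruct (Z.eq_dec n0 n1) as [<-|Ne].
    - split; [lra|]. destruct Eq as [Eq|Eq]; auto. left.
      apply Rnot_le_lt. intro. apply NA. split; auto. lra.
    - assert (height b l s X < y - IZR q * IZR n1 * t); [|split; [lra|auto]].
      apply Rnot_le_lt. intro. apply NB. split; [lia|lra]. }
  destruct (Rle_dec (y - IZR q * IZR n1 * t) (height (top q b) l s X)) as [H|NC].
  { apply (one 2%nat n1 _ (C2 (proj2 A2) ltac:(lra)) eq_refl); auto. left; auto. }
  destruct (classic ((n1 < n2)%Z /\ y <= height (top q b) l s X + IZR q * IZR n2 * t)) as [[H2 H]|ND].
  { apply (two 3%nat n1 n2 _ (C3 eq_refl) H2); auto; lra || lia. }
  assert (A3 : height (top q b) l s X < y - IZR q * IZR n2 * t).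
  { destruct (Z.eq_dec n1 n2) as [<-|Ne]; [lra|].
    apply Rnot_le_lt. intro. apply ND. split; [lia|lra]. }
  destruct Eq as [Eq|Eq]; [destruct (Q1 Eq) as [_ Eh]; lra|].
  apply (one 4%nat n2 _ (C4 Eq ltac:(lra)) eq_refl); auto. left; auto.
Qed.

Lemma kuhn_edge_intro q u v A B C :
  (py v - py u = q * A)%Z -> (pz v - pz u = B)%Z -> (px v - px u = q * (C - B))%Z ->
  (0 <= A <= 1 /\ 0 <= B <= 1 /\ 0 <= C <= 1 \/ -1 <= A <= 0 /\ -1 <= B <= 0 /\ -1 <= C <= 0)%Z ->
  kuhn_edge q u v.
Proof.
  intros HA HB HC [H|H].
  - exists 1%Z, A, B, C. lia.
  - exists (-1)%Z, (-A)%Z, (-B)%Z, (-C)%Z. lia.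
Qed.

Lemma kuhn_edge_sym q u v : kuhn_edge q u v -> kuhn_edge q v u.
Proof. intros (e & a & b & c & He & H). exists (-e)%Z, a, b, c. lia. Qed.

(** * The cells D_e *)

Lemma slice_vertex p q b M k A v : chain q b -> (forall l, (q | l - b l * pprime p q)%Z) ->
  mountains q b M -> slice q b M k A -> mem A v ->
  (0 <= px v <= q /\ 0 <= py v <= q)%Z /\ Lambda p q v.
Proof.
  intros Hc HL [HM _] HA Hv. assert (Hq : (0 < q)%Z) by apply Hc.
  assert (B : forall l, (0 <= l <= q)%Z -> (0 <= px (node b l) <= q /\ 0 <= py (node b l) <= q)%Z /\ Lambda p q (node b l)).
  { intros l Hl. split; [assert (G := top_ge q b l Hc Hl); unfold node, px, py; cbn [fst snd]; lia|].
    rewrite Lambda_iff by lia. apply HL. }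
  assert (R : forall v, (0 <= px v <= q /\ 0 <= py v <= q)%Z /\ Lambda p q v ->
    (0 <= px (rot q v) <= q /\ 0 <= py (rot q v) <= q)%Z /\ Lambda p q (rot q v)).
  { intros w [H1 H2]. rewrite Lambda_iff in * by lia. unfold rot; set (x := px w) in *; set (y := py w) in *.
    unfold px, py; cbn [fst snd]. split; [lia|].
    destruct H2 as [m Hm]. exists (1 - pprime p q - m)%Z.
    replace ((1 - pprime p q - m) * q)%Z with (q - q * pprime p q - m * q)%Z by ring. rewrite <- Hm. ring. }
  assert (T : forall l, (0 <= l <= q)%Z -> (0 <= px (node (top q b) l) <= q /\ 0 <= py (node (top q b) l) <= q)%Z
     /\ Lambda p q (node (top q b) l)).
  { intros l Hl. replace (node (top q b) l) with (rot q (node b (q - l))).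
    - apply R, B; lia.
    - rewrite node_rot. replace (q - (q - l))%Z with l by lia. reflexivity. }
  destruct HA as [[[a m] d] Ht|l Hl| | |l Hl|[[a m] d] Ht]; try apply HM in Ht;
    unfold mem in Hv; simpl in Hv;
    repeat (destruct Hv as [<-|Hv]; [first [apply B|apply T|apply R, B]; lia|]); destruct Hv.
Qed.

Lemma slice_corner q b M k A : chain q b -> mountains q b M -> slice q b M k A ->
  exists left : bool, forall v, mem A v -> (q | px v)%Z ->
  exists X Y : Z, (px v = q * X /\ py v = q * Y /\ 0 <= X <= 1 /\ 0 <= Y <= 1)%Z /\
    ((k < 2)%nat -> Y = 0%Z) /\ ((2 < k)%nat -> Y = 1%Z) /\ (if left then X <= Y else Y <= X)%Z.
Proof.
  intros Hc [HM _] HA. assert (Hq : (0 < q)%Z) by apply Hc.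
  destruct (top_end q b Hc) as (T0 & Tq & _). destruct Hc as (_ & B0 & Bq & _).
  assert (Ends : forall l, (0 <= l <= q)%Z -> (q | l)%Z -> l = 0%Z \/ l = q).
  { intros l Hl [m ->]. assert (m = 0 \/ m = 1)%Z as [-> | ->] by nia; auto; lia. }
  assert (B : forall l, (0 <= l <= q)%Z -> (q | px (node b l))%Z -> exists X, px (node b l) = (q * X)%Z /\
     py (node b l) = (q * 0)%Z /\ (0 <= X <= 1)%Z /\ (X = 0 -> l = 0)%Z /\ (X = 1 -> l = q)%Z).
  { intros l Hl Hd. unfold node, px, py in *; cbn [fst snd] in *.
    destruct (Ends l Hl Hd) as [-> | ->]; [exists 0%Z | exists 1%Z]; rewrite ?B0, ?Bq; lia. }
  assert (T : forall l, (0 <= l <= q)%Z -> (q | px (node (top q b) l))%Z -> exists X, px (node (top q b) l) = (q * X)%Z /\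
     py (node (top q b) l) = (q * 1)%Z /\ (0 <= X <= 1)%Z /\ (X = 0 -> l = 0)%Z /\ (X = 1 -> l = q)%Z).
  { intros l Hl Hd. unfold node, px, py in *; cbn [fst snd] in *.
    destruct (Ends l Hl Hd) as [-> | ->]; [exists 0%Z | exists 1%Z]; rewrite ?T0, ?Tq; lia. }
  destruct HA as [[[a m] d] Ht|l Hl| | |l Hl|[[a m] d] Ht].
  - apply HM in Ht. exists false.
    intros v [<-|[<-|[<-|[]]]] HD; (edestruct B as (X & H1 & H2 & H3 & _); [|exact HD|]; [lia|]);
      exists X, 0%Z; repeat split; auto; lia.
  - exists false.
    intros v [<-|[<-|[]]] HD; (edestruct B as (X & H1 & H2 & H3 & _); [|exact HD|]; [lia|]);
      exists X, 0%Z; repeat split; auto; lia.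
  - exists true.
    intros v [<-|[<-|[<-|[]]]] HD.
    + destruct (B 0%Z ltac:(lia) HD) as (X & H1 & H2 & H3 & H4 & H5).
      exists X, 0%Z; repeat split; auto; lia.
    + destruct (T 0%Z ltac:(lia) HD) as (X & H1 & H2 & H3 & H4 & H5).
      exists X, 1%Z; repeat split; auto; lia.
    + destruct (T 1%Z ltac:(lia) HD) as (X & H1 & H2 & H3 & H4 & H5).
      exists X, 1%Z; repeat split; auto; lia.
  - exists false.
    intros v [<-|[<-|[<-|[]]]] HD.
    + destruct (B q ltac:(lia) HD) as (X & H1 & H2 & H3 & H4 & H5).
      exists X, 0%Z; repeat split; auto; lia.
    + destruct (T q ltac:(lia) HD) as (X & H1 & H2 & H3 & H4 & H5).
      exists X, 1%Z; repeat split; auto; lia.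
    + destruct (B (q - 1)%Z ltac:(lia) HD) as (X & H1 & H2 & H3 & H4 & H5).
      exists X, 0%Z; repeat split; auto; lia.
  - exists true.
    intros v [<-|[<-|[]]] HD; (edestruct T as (X & H1 & H2 & H3 & _); [|exact HD|]; [lia|]);
      exists X, 1%Z; repeat split; auto; lia.
  - apply HM in Ht. exists true.
    assert (N : forall l, rot q (node b l) = node (top q b) (q - l)) by (intro; apply node_rot).
    intros v [<-|[<-|[<-|[]]]] HD; rewrite N in *; (edestruct T as (X & H1 & H2 & H3 & _); [|exact HD|]; [lia|]);
      exists X, 1%Z; repeat split; auto; lia.
Qed.

Lemma slice_shape q b M k A : chain q b -> mountains q b M -> slice q b M k A ->
  (k <> 1 /\ k <> 3 /\ exists v0 v1 v2, A = [v0; v1; v2] /\ (cross v0 v1 v2 = q \/ cross v0 v1 v2 = - q)%Z)%nat \/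
  ((k = 1 \/ k = 3)%nat /\ exists c l, A = edge_nodes c l).
Proof.
  intros Hc [HM _] HA. assert (Hq : (0 < q)%Z) by apply Hc.
  destruct (top_end q b Hc) as (T0 & Tq & _). destruct Hc as (_ & B0 & Bq & _).
  destruct HA as [[[a m] d] Ht|l Hl| | |l Hl|[[a m] d] Ht].
  - apply HM in Ht. left. repeat split; try lia. eexists _, _, _. split; [reflexivity|].
    right. destruct Ht as [_ <-]. simpl. rewrite !cross_node. ring.
  - right. split; auto. eauto.
  - left. repeat split; try lia. eexists _, _, _. split; [reflexivity|].
    unfold cross, node, px, py; cbn [fst snd]. rewrite T0, B0. lia.
  - left. repeat split; try lia. eexists _, _, _. split; [reflexivity|].
    unfold cross, node, px, py; cbn [fst snd]. rewrite Tq, Bq. lia.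
  - right. split; auto. eauto.
  - apply HM in Ht. left. repeat split; try lia. eexists _, _, _. split; [reflexivity|].
    right. destruct Ht as [_ Ht]. transitivity (- tri_area b (a, m, d))%Z; [|rewrite Ht; ring].
    unfold tri_area, rot, cross, node, px, py; cbn [fst snd]. ring.
Qed.

Lemma half_tetrahedron p q b M x0 sg n0 n1 n2 T : chain q b -> (forall l, (q | l - b l * pprime p q)%Z) ->
  mountains q b M -> (sg = 1 \/ sg = -1)%Z -> (q | x0)%Z ->
  (n0 <= n1 <= n0 + 1)%Z -> (n1 <= n2 <= n1 + 1)%Z -> half q b M x0 sg n0 n1 n2 T ->
  exists v0 v1 v2 v3, T = [v0; v1; v2; v3] /\ Forall (Lambda p q) T /\
    (vol v0 v1 v2 v3 = q \/ vol v0 v1 v2 v3 = - q)%Z.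
Proof.
  intros Hc HL HM Hsg Hx0 Hn01 Hn12 (k & A & HA & K1 & K3 & ->). assert (Hq : (0 < q)%Z) by apply Hc.
  assert (LA : Forall (Lambda p q) (apices q x0 sg n0 n1 n2 k ++ A)).
  { apply Forall_app. split.
    - assert (LU : forall n, Lambda p q (apex q x0 sg n)).
      { intro n. rewrite Lambda_iff by lia. unfold apex, px, py; cbn [fst snd].
        destruct Hx0 as [m ->]. exists (m - n * pprime p q)%Z. ring. }
      destruct k as [|[|[|[|k]]]]; simpl; auto.
    - apply Forall_forall. intros v Hv. apply (slice_vertex p q b M k A v); auto. }
  assert (K4 := slice_le4 _ _ _ _ _ HA).
  destruct (slice_shape _ _ _ _ _ Hc HM HA) as [(N1 & N3 & v0 & v1 & v2 & -> & HV)|(Hk & c & l & ->)].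
  - assert (Z : forall v, In v [v0; v1; v2] -> pz v = 0%Z) by (intros v; apply (slice_z _ _ _ _ _ _ HA)).
    assert (Z0 : pz v0 = 0%Z) by (apply Z; simpl; auto).
    assert (Z1 : pz v1 = 0%Z) by (apply Z; simpl; auto).
    assert (Z2 : pz v2 = 0%Z) by (apply Z; simpl; auto).
    assert (V : forall n, (vol (apex q x0 sg n) v0 v1 v2 = q \/ vol (apex q x0 sg n) v0 v1 v2 = - q)%Z).
    { intro n. assert (EV : (vol (apex q x0 sg n) v0 v1 v2 = - sg * cross v0 v1 v2)%Z).
      { unfold vol, det3. rewrite !px_zsub, !py_zsub, !pz_zsub, Z0, Z1, Z2.
        unfold apex, cross, px, py, pz; cbn [fst snd]. ring. }
      rewrite EV. destruct Hsg as [-> | ->]; destruct HV as [-> | ->]; lia. }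
    destruct k as [|[|[|[|[|k]]]]]; try lia; do 4 eexists; (split; [reflexivity|split; [exact LA|apply V]]).
  - assert (V : forall m, (vol (apex q x0 sg m) (apex q x0 sg (m + 1)) (node c l) (node c (l + 1)) = q \/
       vol (apex q x0 sg m) (apex q x0 sg (m + 1)) (node c l) (node c (l + 1)) = - q)%Z).
    { intro m. assert (EV : (vol (apex q x0 sg m) (apex q x0 sg (m + 1)) (node c l) (node c (l + 1)) = - (q * sg))%Z).
      { unfold vol, det3. rewrite !px_zsub, !py_zsub, !pz_zsub.
        unfold apex, node, px, py, pz; cbn [fst snd]. ring. }
      rewrite EV. destruct Hsg as [-> | ->]; lia. }
    destruct Hk as [-> | ->].
    + assert (En : n1 = (n0 + 1)%Z) by (specialize (K1 eq_refl); lia). subst n1.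
      do 4 eexists; (split; [reflexivity|split; [exact LA|apply V]]).
    + assert (En : n2 = (n1 + 1)%Z) by (specialize (K3 eq_refl); lia). subst n2.
      do 4 eexists; (split; [reflexivity|split; [exact LA|apply V]]).
Qed.

(** The bounds on [sg] say that passing from a corner of the square to an apex joined with it
    changes the row by 0 or [sg]. The corner rows are 0 at levels 0 and 1, arbitrary at level 2, and
    1 at levels 3 and 4. *)
Lemma half_kuhn_edge q b M sg n0 n1 n2 T u v : chain q b -> mountains q b M -> (sg = 1 \/ sg = -1)%Z ->
  (n0 <= n1 <= n0 + 1)%Z -> (n1 <= n2 <= n1 + 1)%Z ->
  (0 <= sg * n0 <= 1)%Z -> (0 <= sg * n1 <= 1)%Z -> (0 <= sg * (n1 - 1) <= 1)%Z -> (0 <= sg * (n2 - 1) <= 1)%Z ->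
  half q b M (if Z.eq_dec sg 1 then 0 else q)%Z sg n0 n1 n2 T -> In u T -> In v T ->
  corner q u -> corner q v -> kuhn_edge q u v.
Proof.
  intros Hc HM Hsg Hn01 Hn12 S0 S1 S1' S2 (k & A & HA & K1 & K3 & ->) Hu Hv Cu Cv.
  set (x0 := (if Z.eq_dec sg 1 then 0 else q)%Z) in *.
  assert (Hx : (x0 = 0 /\ sg = 1 \/ x0 = q /\ sg = -1)%Z).
  { unfold x0. destruct (Z.eq_dec sg 1); lia. }
  clearbody x0.
  destruct (slice_corner _ _ _ _ _ Hc HM HA) as (left & HC).
  assert (K4 := slice_le4 _ _ _ _ _ HA).
  assert (SS : forall u v, mem A u -> mem A v -> corner q u -> corner q v -> kuhn_edge q u v).
  { clear u v Hu Hv Cu Cv. intros u v Hu Hv [Cu _] [Cv _].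
    destruct (HC u Hu Cu) as (X & Y & (U1 & U2 & U3 & U4) & U5 & U6 & U7).
    destruct (HC v Hv Cv) as (X' & Y' & (V1 & V2 & V3 & V4) & V5 & V6 & V7).
    apply (kuhn_edge_intro q u v (Y' - Y) 0 (X' - X))%Z.
    - lia.
    - rewrite (slice_z _ _ _ _ _ _ HA Hu), (slice_z _ _ _ _ _ _ HA Hv). lia.
    - lia.
    - destruct left; lia. }
  assert (AS : forall n v, In (apex q x0 sg n) (apices q x0 sg n0 n1 n2 k) -> mem A v -> corner q v ->
     kuhn_edge q v (apex q x0 sg n)).
  { clear u v Hu Hv Cu Cv. intros n v Hu Hv [Cv _].
    destruct (HC v Hv Cv) as (X' & Y' & (V1 & V2 & V3 & V4) & V5 & V6 & V7).
    assert (D : (0 <= sg * (n - Y') <= 1)%Z).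
    { assert (N : forall m, apex q x0 sg m = apex q x0 sg n -> m = n).
      { intros m H. unfold apex in H. injection H as H. destruct Hc as [Hq _]. nia. }
      destruct k as [|[|[|[|[|k]]]]]; try lia; simpl in Hu.
      - destruct Hu as [Hu|[]]. apply N in Hu. subst n. rewrite V5 by lia. lia.
      - rewrite V5 by lia. destruct Hu as [Hu|[Hu|[]]]; apply N in Hu; subst n; lia.
      - destruct Hu as [Hu|[]]. apply N in Hu. subst n. assert (Y' = 0 \/ Y' = 1)%Z as [-> | ->] by lia; lia.
      - rewrite V6 by lia. destruct Hu as [Hu|[Hu|[]]]; apply N in Hu; subst n; lia.
      - destruct Hu as [Hu|[]]. apply N in Hu. subst n. rewrite V6 by lia. lia. }
    apply (kuhn_edge_intro q v (apex q x0 sg n) (n - Y') sg (if Z.eq_dec sg 1 then 1 - X' else - X'))%Z.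
    - unfold apex, py at 1; cbn [fst snd]. lia.
    - rewrite (slice_z _ _ _ _ _ _ HA Hv). unfold apex, pz; cbn [fst snd]. lia.
    - unfold apex, px at 1; cbn [fst snd]. destruct (Z.eq_dec sg 1); lia.
    - destruct (Z.eq_dec sg 1); lia. }
  assert (AA : forall m n, (m <= n <= m + 1)%Z -> kuhn_edge q (apex q x0 sg m) (apex q x0 sg n)).
  { intros m n H. apply (kuhn_edge_intro q _ _ (n - m) 0 0)%Z; unfold apex, px, py, pz; cbn [fst snd]; lia. }
  assert (AP : forall u, mem (apices q x0 sg n0 n1 n2 k) u -> exists n, u = apex q x0 sg n).
  { clear. intros u. unfold mem, apices. destruct k as [|[|[|[|k]]]]; simpl; intuition eauto. }
  apply in_app_or in Hu. apply in_app_or in Hv.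
  destruct Hu as [Hu|Hu], Hv as [Hv|Hv].
  - unfold apices in Hu, Hv. destruct k as [|[|[|[|k]]]]; simpl in Hu, Hv;
    repeat match goal with H : _ \/ _ |- _ => destruct H | H : False |- _ => destruct H end;
      subst; first [apply AA; lia | apply kuhn_edge_sym, AA; lia].
  - destruct (AP u Hu) as [n ->]. apply kuhn_edge_sym. auto.
  - destruct (AP v Hv) as [n ->]. auto.
  - auto.
Qed.

Lemma cell_exists p q e : (1 <= q)%Z -> Z.gcd p q = 1%Z -> (0 <= e <= 1)%Z ->
  exists L : list (list zpt),
   (forall T, In T L -> exists v0 v1 v2 v3, T = [v0; v1; v2; v3] /\ Forall (Lambda p q) T /\
      (vol v0 v1 v2 v3 = q \/ vol v0 v1 v2 v3 = - q)%Z) /\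
   (forall T v, In T L -> In v T ->
      (0 <= px v <= q /\ 0 <= px v + q * pz v <= q /\ 0 <= py v <= q + e * q * pz v)%Z) /\
   (forall T1 T2, In T1 L -> In T2 L -> coherent (mem T1) (mem T2)) /\
   (forall T u v, In T L -> In u T -> In v T -> corner q u -> corner q v -> kuhn_edge q u v) /\
   (forall x y z, 0 <= x <= IZR q -> 0 <= x + IZR q * z <= IZR q -> 0 <= y <= IZR q + IZR e * IZR q * z ->
      exists T mu, In T L /\ supported (mem T) mu /\ integral mu f1 = 1 /\ integral mu fx = x /\ integral mu fy = y /\ integral mu fz = z).
Proof.
  intros Hq Hg He.
  destruct (chain_exists p q Hq Hg) as (b & r & Hc & HL & Hr).
  destruct (mountains_exist q b r Hc Hr) as (M & HM).
  (* At z = 1 the body D_e shrinks to the edge x = 0, 0 <= y <= q (1 + e), and at z = -1 to x = q, 0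
     <= y <= q (1 - e). The middle apex, in row 1 above and row 0 below, is the one joined by Kuhn
     edges to corners of both rows. *)
  destruct (half_list q b M 0 1 0 1 (1 + e)) as (L1 & HL1).
  destruct (half_list q b M q (-1) 0 0 (1 - e)) as (L2 & HL2).
  exists (L1 ++ L2).
  assert (QR : 0 < IZR q) by (apply IZR_lt; lia).
  split; [|split; [|split; [|split]]].
  - intros T HT. apply in_app_iff in HT. rewrite HL1, HL2 in HT. destruct HT as [HT|HT].
    + apply (half_tetrahedron p q b M 0 1 0 1 (1 + e)); auto; try lia. exists 0%Z; lia.
    + apply (half_tetrahedron p q b M q (-1) 0 0 (1 - e)); auto; try lia. exists 1%Z; lia.
  - intros T v HT Hv. apply in_app_iff in HT. rewrite HL1, HL2 in HT.
    assert (SV : forall k A, slice q b M k A -> In v A ->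
      (0 <= px v <= q /\ 0 <= px v + q * pz v <= q /\ 0 <= py v <= q + e * q * pz v)%Z).
    { intros k A HA Hv'. assert (G := slice_vertex p q b M k A v Hc HL HM HA Hv').
      rewrite (slice_z _ _ _ _ _ _ HA Hv'). lia. }
    destruct HT as [(k & A & HA & _ & _ & ->)|(k & A & HA & _ & _ & ->)];
      apply in_app_or in Hv; (destruct Hv as [Hv|Hv]; [|eauto]).
    + unfold apices, apex in Hv. destruct k as [|[|[|[|k]]]]; cbn [In] in Hv;
      repeat match goal with H : _ \/ _ |- _ => destruct H | H : False |- _ => destruct H end;
      subst v; unfold px, py, pz; cbn [fst snd]; assert (e = 0 \/ e = 1)%Z as [Ee|Ee] by lia; rewrite Ee; lia.
    + unfold apices, apex in Hv. destruct k as [|[|[|[|k]]]]; cbn [In] in Hv;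
      repeat match goal with H : _ \/ _ |- _ => destruct H | H : False |- _ => destruct H end;
      subst v; unfold px, py, pz; cbn [fst snd]; assert (e = 0 \/ e = 1)%Z as [Ee|Ee] by lia; rewrite Ee; lia.
  - intros T1 T2 H1 H2. apply in_app_iff in H1. apply in_app_iff in H2. rewrite HL1, HL2 in H1, H2.
    destruct H1 as [H1|H1], H2 as [H2|H2].
    + eapply half_coherent; [exact Hc|exact HM| | |exact H1|exact H2]; lia.
    + eapply halves_coherent; [exact Hc|exact HM|exact H1|exact H2].
    + apply coherent_sym. eapply halves_coherent; [exact Hc|exact HM|exact H2|exact H1].
    + eapply half_coherent; [exact Hc|exact HM| | |exact H1|exact H2]; lia.
  - intros T u v HT Hu Hv Cu Cv. apply in_app_iff in HT. rewrite HL1, HL2 in HT. destruct HT as [HT|HT].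
    + apply (half_kuhn_edge q b M 1 0 1 (1 + e) T); auto; lia.
    + apply (half_kuhn_edge q b M (-1) 0 0 (1 - e) T); auto; lia.
  - intros x y z Hx Hxz Hy.
    assert (He1 : 0 <= IZR e <= 1) by (split; apply IZR_le; lia).
    destruct (Rle_dec 0 z) as [Hz|Hz].
    + assert (Z1 : z <= 1) by (apply Rmult_le_reg_l with (IZR q); lra).
      destruct (half_cover q b M 0 1 0 1 (1 + e) x y z) as (T & mu & HT & H1 & H2 & H3 & H4 & H5);
        auto; try lia; try lra.
      * rewrite plus_IZR. split; [lra|]. replace (IZR q * (1 - z) + IZR q * (1 + IZR e) * z)
          with (IZR q + IZR e * IZR q * z) by ring. lra.
      * exists T, mu. rewrite in_app_iff, HL1, HL2. repeat split; auto. rewrite H5. ring.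
    + assert (Z1 : - z <= 1) by (apply Rmult_le_reg_l with (IZR q); lra).
      destruct (half_cover q b M q (-1) 0 0 (1 - e) x y (- z)) as (T & mu & HT & H1 & H2 & H3 & H4 & H5);
        auto; try lia; try lra.
      * rewrite minus_IZR. split; [lra|]. replace (IZR q * (1 - - z) + IZR q * (1 - IZR e) * - z)
          with (IZR q + IZR e * IZR q * z) by ring. lra.
      * exists T, mu. rewrite in_app_iff, HL1, HL2. repeat split; auto. rewrite H5. ring.
Qed.

(** * Facets and boundary of the dilated tetrahedron *)

(** Up to the factor [q * k], the barycentric coordinates on the dilated tetrahedron. Every index
    from 3 on denotes the last facet, so a quantifier over [nat] runs over the four facets. *)
Definition facet (q k : Z) (i : nat) (v : zpt) : Z :=
  match i with
  | 0%nat => px v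
  | 1%nat => py v
  | 2%nat => q * pz v - py v
  | _ => q * k - px v - q * pz v
  end%Z.

Definition facetR (q k : Z) (i : nat) (x : rpt) : R :=
  let '(a, b, c) := x in
  match i with
  | 0%nat => a
  | 1%nat => b
  | 2%nat => IZR q * c - b
  | _ => IZR q * IZR k - a - IZR q * c
  end.

Definition dilate (q k : Z) : list zpt := map (zscale k) (DeltaV q).

Lemma facetR_toR q k i v : facetR q k i (toR v) = IZR (facet q k i v).
Proof.
  destruct v as [[a b] c]. destruct i as [|[|[|i]]]; unfold facetR, facet, toR, px, py, pz; cbn [fst snd];
    rewrite ?minus_IZR, ?mult_IZR; reflexivity.
Qed.

Lemma facetR_barycentre q k i mu x : barycentre mu x -> facetR q k i x = integral mu (fun v => IZR (facet q k i v)).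
Proof.
  intros [H1 ->].
  assert (A : forall a b c d, integral mu (affine a b c d) = a + b * integral mu fx + c * integral mu fy + d * integral mu fz).
  { intros. rewrite integral_affine, H1. ring. }
  destruct i as [|[|[|i]]]; unfold facetR, facet; cbv beta iota.
  - reflexivity.
  - reflexivity.
  - rewrite (integral_eq _ (fun v => IZR (q * pz v - py v)) (affine 0 0 (-1) (IZR q))); [rewrite A; ring|].
    intro v. unfold affine, fx, fy, fz. rewrite minus_IZR, mult_IZR. ring.
  - rewrite (integral_eq _ (fun v => IZR (q * k - px v - q * pz v)) (affine (IZR q * IZR k) (-1) 0 (- IZR q))); [rewrite A; ring|].
    intro v. unfold affine, fx, fy, fz. rewrite !minus_IZR, !mult_IZR. ring.
Qed.

Lemma conv_facets q k T x : (forall v i, In v T -> (0 <= facet q k i v)%Z) -> conv (map toR T) x ->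
  forall i, 0 <= facetR q k i x.
Proof.
  intros H Hx i. apply conv_barycentre in Hx. destruct Hx as (mu & Hm & Hb).
  rewrite (facetR_barycentre _ _ _ _ _ Hb). eapply integral_nonneg; eauto.
  intros v Hv. apply IZR_le; auto.
Qed.

Lemma conv_dilate q k x : (0 < q)%Z -> (0 < k)%Z ->
  conv (map toR (dilate q k)) x <-> (forall i, 0 <= facetR q k i x).
Proof.
  intros Hq Hk. split.
  - apply conv_facets. unfold dilate, DeltaV. intros v i Hv.
    cbn [map zscale In] in Hv.
    repeat (destruct Hv as [<-|Hv]); try destruct Hv;
      destruct i as [|[|[|i]]]; unfold facet, px, py, pz; cbn [fst snd]; nia.
  - intro H. apply conv_barycentre. destruct x as [[x y] z].
    assert (H0 := H 0%nat). assert (H1 := H 1%nat). assert (H2 := H 2%nat). assert (H3 := H 3%nat).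
    unfold facetR in *.
    assert (Q : 0 < IZR q) by (apply IZR_lt; auto). assert (K : 0 < IZR k) by (apply IZR_lt; auto).
    assert (QK : 0 < IZR q * IZR k) by (apply Rmult_lt_0_compat; auto).
    exists [((IZR q * IZR k - x - IZR q * z) / (IZR q * IZR k), zscale k (0, 0, 0)%Z);
            (x / (IZR q * IZR k), zscale k (q, 0, 0)%Z);
            ((IZR q * z - y) / (IZR q * IZR k), zscale k (0, 0, 1)%Z);
            (y / (IZR q * IZR k), zscale k (0, q, 1)%Z)].
    split.
    + constructor; [split; [cbn [fst]; apply Rle_mult_inv_pos; auto|left; reflexivity]|].
      constructor; [split; [cbn [fst]; apply Rle_mult_inv_pos; auto|right; left; reflexivity]|].
      constructor; [split; [cbn [fst]; apply Rle_mult_inv_pos; auto|right; right; left; reflexivity]|].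
      constructor; [split; [cbn [fst]; apply Rle_mult_inv_pos; auto|right; right; right; left; reflexivity]|].
      constructor.
    + unfold barycentre. rewrite !integral_cons, !integral_nil. unfold f1, fx, fy, fz, zscale, px, py, pz; cbn [fst snd].
      rewrite !mult_IZR.
      split; [field; lra|]. f_equal; [f_equal|]; field; lra.
Qed.

Lemma conv_vertex T v : In v T -> conv (map toR T) (toR v).
Proof.
  intro H. apply conv_barycentre. exists [(1, v)]. split.
  - constructor; [split; [cbn [fst]; lra|auto]|constructor].
  - unfold barycentre. rewrite !integral_cons, !integral_nil. destruct v as [[a b] c].
    unfold f1, fx, fy, fz, px, py, pz, toR; cbn [fst snd]. split; [ring|]. f_equal; [f_equal|]; ring.
Qed.

Lemma dilate_vertex q k T v : (0 < q)%Z -> (0 < k)%Z ->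
  (forall x, conv (map toR T) x -> conv (map toR (dilate q k)) x) -> In v T ->
  forall i, (0 <= facet q k i v)%Z.
Proof.
  intros Hq Hk H Hv i. apply conv_vertex, H in Hv. rewrite conv_dilate in Hv by auto.
  specialize (Hv i). rewrite facetR_toR in Hv. apply le_IZR; auto.
Qed.

Lemma boundary_facet q k u v i : (0 < q)%Z -> (0 < k)%Z ->
  (forall j, (0 <= facet q k j u)%Z) -> (forall j, (0 <= facet q k j v)%Z) ->
  facet q k i u = 0%Z -> facet q k i v = 0%Z ->
  forall x, conv [toR u; toR v] x -> boundary (conv (map toR (dilate q k))) x.
Proof.
  intros Hq Hk Hu Hv Fu Fv x Hx.
  assert (Hin : forall j, 0 <= facetR q k j x).
  { apply (conv_facets q k [u; v]); auto. intros w j [<-|[<-|[]]]; auto. }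
  assert (Hi : facetR q k i x = 0).
  { change [toR u; toR v] with (map toR [u; v]) in Hx. apply conv_barycentre in Hx.
    destruct Hx as (mu & Hm & Hb). rewrite (facetR_barycentre _ _ _ _ _ Hb).
    rewrite (integral_const _ _ _ 0 Hm); [ring|]. intros w [<-|[<-|[]]]; rewrite ?Fu, ?Fv; reflexivity. }
  destruct x as [[a b] c]. split.
  - intros eps He. exists (a, b, c). split; [|apply conv_dilate; auto].
    unfold dist_inf. rewrite !Rminus_diag, !Rabs_R0. rewrite !(Rmax_left 0 0) by lra; lra.
  - intros eps He.
    assert (D : forall d, Rabs d = eps / 2 -> Rabs d < eps /\ Rmax 0 (Rabs d) < eps)
      by (intros d ->; rewrite Rmax_right; lra).
    assert (A1 : Rabs (eps / 2) = eps / 2) by (apply Rabs_pos_eq; lra).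
    assert (A2 : Rabs (- (eps / 2)) = eps / 2) by (rewrite Rabs_Ropp; auto).
    assert (N : forall y, facetR q k i y < 0 -> ~ conv (map toR (dilate q k)) y).
    { intros y Hy HC. rewrite conv_dilate in HC by auto. specialize (HC i). lra. }
    destruct i as [|[|[|i]]].
    + exists (a - eps / 2, b, c). split; [|apply N; unfold facetR in *; lra].
      unfold dist_inf. replace (a - (a - eps / 2)) with (eps / 2) by ring. rewrite !Rminus_diag, !Rabs_R0, A1.
      rewrite (Rmax_left 0 0), Rmax_left by lra; lra.
    + exists (a, b - eps / 2, c). split; [|apply N; unfold facetR in *; lra].
      unfold dist_inf. replace (b - (b - eps / 2)) with (eps / 2) by ring. rewrite !Rminus_diag, !Rabs_R0, A1.
      rewrite (Rmax_left (eps / 2) 0), Rmax_right by lra; lra.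
    + exists (a, b + eps / 2, c). split; [|apply N; unfold facetR in *; lra].
      unfold dist_inf. replace (b - (b + eps / 2)) with (- (eps / 2)) by ring. rewrite !Rminus_diag, !Rabs_R0, A2.
      rewrite (Rmax_left (eps / 2) 0), Rmax_right by lra; lra.
    + exists (a + eps / 2, b, c). split; [|apply N; unfold facetR in *; lra].
      unfold dist_inf. replace (a - (a + eps / 2)) with (- (eps / 2)) by ring. rewrite !Rminus_diag, !Rabs_R0, A2.
      rewrite (Rmax_left 0 0), Rmax_left by lra; lra.
Qed.

(** At the midpoint of the edge each facet form is the mean of its values at the ends. If none
    vanished at both ends, the midpoint would be interior. *)
Lemma facet_of_boundary q k u v : (0 < q)%Z -> (0 < k)%Z ->
  (forall j, (0 <= facet q k j u)%Z) -> (forall j, (0 <= facet q k j v)%Z) ->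
  (forall x, conv [toR u; toR v] x -> boundary (conv (map toR (dilate q k))) x) ->
  exists i, facet q k i u = 0%Z /\ facet q k i v = 0%Z.
Proof.
  intros Hq Hk Hu Hv HB.
  set (mu := [(1 / 2, u); (1 / 2, v)] : measure).
  assert (Eg : forall g, integral mu g = (g u + g v) / 2).
  { intro g. unfold mu. rewrite !integral_cons, integral_nil. cbn [fst snd]. field. }
  set (m := (integral mu fx, integral mu fy, integral mu fz)).
  assert (Bm : barycentre mu m) by (split; [rewrite Eg; unfold f1; field|reflexivity]).
  assert (Fm : forall i, facetR q k i m = (IZR (facet q k i u) + IZR (facet q k i v)) / 2).
  { intro i. rewrite (facetR_barycentre _ _ _ _ _ Bm), Eg. reflexivity. }
  destruct (HB m) as [_ Hout].
  { apply (conv_barycentre [u; v]). exists mu. split; auto. unfold mu.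
    constructor; [split; [cbn [fst]; lra|left; reflexivity]|].
    constructor; [split; [cbn [fst]; lra|right; left; reflexivity]|]. constructor. }
  apply NNPP. intro N.
  assert (P : forall i, 0 < facetR q k i m).
  { intro i. rewrite Fm. specialize (Hu i). specialize (Hv i).
    assert (facet q k i u <> 0 \/ facet q k i v <> 0)%Z.
    { destruct (Z.eq_dec (facet q k i u) 0); auto. right. intro. apply N; eauto. }
    assert (0 < IZR (facet q k i u + facet q k i v)) by (apply IZR_lt; lia).
    rewrite plus_IZR in *. lra. }
  assert (Q : 0 < IZR q) by (apply IZR_lt; auto).
  assert (P0 := P 0%nat). assert (P1 := P 1%nat). assert (P2 := P 2%nat). assert (P3 := P 3%nat).
  set (d := Rmin (Rmin (facetR q k 0 m) (facetR q k 1 m)) (Rmin (facetR q k 2 m) (facetR q k 3 m))).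
  assert (D : 0 < d /\ d <= facetR q k 0 m /\ d <= facetR q k 1 m /\ d <= facetR q k 2 m /\ d <= facetR q k 3 m).
  { unfold d. split; [repeat apply Rmin_glb_lt; auto|].
    assert (M1 := Rmin_l (Rmin (facetR q k 0 m) (facetR q k 1 m)) (Rmin (facetR q k 2 m) (facetR q k 3 m))).
    assert (M2 := Rmin_r (Rmin (facetR q k 0 m) (facetR q k 1 m)) (Rmin (facetR q k 2 m) (facetR q k 3 m))).
    assert (M3 := Rmin_l (facetR q k 0 m) (facetR q k 1 m)). assert (M4 := Rmin_r (facetR q k 0 m) (facetR q k 1 m)).
    assert (M5 := Rmin_l (facetR q k 2 m) (facetR q k 3 m)). assert (M6 := Rmin_r (facetR q k 2 m) (facetR q k 3 m)).
    lra. }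
  clearbody d. destruct D as (D & D0 & D1 & D2 & D3).
  (* In the maximum norm the facet forms are Lipschitz with constant [1 + q], so this radius keeps
     all of them positive. *)
  assert (He : 0 < d / (1 + IZR q)) by (apply Rdiv_lt_0_compat; lra).
  destruct (Hout _ He) as (y & Hy & Ny). apply Ny. apply conv_dilate; auto.
  clearbody m. destruct m as [[a b] c], y as [[a' b'] c'].
  unfold dist_inf in Hy. set (eps := d / (1 + IZR q)) in *.
  assert (Ed : eps * (1 + IZR q) = d) by (unfold eps; field; lra).
  assert (Ha : Rabs (a - a') < eps) by (eapply Rle_lt_trans; [apply Rmax_l|exact Hy]).
  assert (Hbc : Rmax (Rabs (b - b')) (Rabs (c - c')) < eps) by (eapply Rle_lt_trans; [apply Rmax_r|exact Hy]).
  assert (Hb : Rabs (b - b') < eps) by (eapply Rle_lt_trans; [apply Rmax_l|exact Hbc]).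
  assert (Hc : Rabs (c - c') < eps) by (eapply Rle_lt_trans; [apply Rmax_r|exact Hbc]).
  apply Rabs_def2 in Ha. apply Rabs_def2 in Hb. apply Rabs_def2 in Hc.
  assert (0 < eps * IZR q) by (apply Rmult_lt_0_compat; auto).
  assert (Hqc : - (IZR q * eps) < IZR q * (c - c') < IZR q * eps).
  { split; [rewrite Ropp_mult_distr_r|]; apply Rmult_lt_compat_l; lra. }
  intros [|[|[|i]]]; unfold facetR in *; lra.
Qed.

(** * Standard directions and Kuhn edges *)

Definition std_direction (q : Z) (u v : zpt) : Prop :=
  exists a b, In a (DeltaV q) /\ In b (DeltaV q) /\ a <> b /\
    exists t : R, rsub (toR u) (toR v) = rscale t (rsub (toR a) (toR b)).

Lemma rsub_toR u v : rsub (toR u) (toR v) = toR (zsub u v).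
Proof.
  destruct u as [[? ?] ?], v as [[? ?] ?]. unfold rsub, zsub, radd, zadd, rscale, zscale, toR.
  rewrite !plus_IZR, !mult_IZR. reflexivity.
Qed.

(** The one Kuhn direction that is not an edge of Delta' is e1 + e3, which is (q, q, 0) in the
    original coordinates. Every facet form changes along it, so it occurs in no facet. *)
Lemma kuhn_edge_std_direction q k i u v : (0 < q)%Z -> u <> v -> kuhn_edge q u v ->
  facet q k i u = 0%Z -> facet q k i v = 0%Z -> std_direction q u v.
Proof.
  intros Hq Huv (e & a & b & c & He & Ha & Hb & Hc & H1 & H2 & H3) Fu Fv.
  assert (S : forall A B, In A (DeltaV q) -> In B (DeltaV q) -> A <> B ->
    zsub u v = zscale (- e) (zsub A B) -> std_direction q u v).
  { intros A B HA HB HAB H. exists A, B. repeat split; auto. exists (IZR (- e)).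
    rewrite !rsub_toR, H. destruct (zsub A B) as [[? ?] ?]. unfold rscale, zscale, toR. rewrite !mult_IZR. reflexivity. }
  assert (Sz : zsub u v = (px u - px v, py u - py v, pz u - pz v)%Z).
  { apply zpt_ext; [apply px_zsub|apply py_zsub|apply pz_zsub]. }
  assert (X : (px v - px u = q * (e * (c - b)))%Z) by lia.
  assert (NZ : (a = 0 -> b = 0 -> c = 0 -> False)%Z).
  { intros -> -> ->. apply Huv. apply zpt_ext; lia. }
  assert (NF : ~ (a = 1 /\ b = 0 /\ c = 1)%Z).
  { intros (-> & -> & ->). destruct i as [|[|[|i]]]; unfold facet in *; destruct He as [-> | ->]; lia. }
  assert (a = 0 \/ a = 1)%Z as [-> | ->] by lia;
  assert (b = 0 \/ b = 1)%Z as [-> | ->] by lia;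
  assert (c = 0 \/ c = 1)%Z as [-> | ->] by lia; try (exfalso; auto; fail); try (exfalso; apply NF; auto; fail);
        [ apply (S (q, 0, 0) (0, 0, 0))%Z | apply (S (0, 0, 1) (q, 0, 0))%Z
        | apply (S (0, 0, 1) (0, 0, 0))%Z | apply (S (0, q, 1) (0, 0, 1))%Z
        | apply (S (0, q, 1) (q, 0, 0))%Z | apply (S (0, q, 1) (0, 0, 0))%Z ];
    try (simpl; tauto); try (intro H; injection H; lia);
    rewrite Sz; clear S Sz NZ NF; apply zpt_ext; cbv [px py pz zscale zsub zadd fst snd] in *;
    destruct He as [-> | ->]; lia.
Qed.

(** In the affine basis given by the vertices, [u - v] has a coordinate 1 or -1, and this coordinate
    is [m] times an integer. *)
Lemma unimodular_primitive p q T u v m d : unimodular p q T -> In u T -> In v T -> u <> v ->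
  (forall w, Lambda p q w -> Lambda p q (zadd w d)) ->
  zsub u v = zscale m d -> (m = 1 \/ m = -1)%Z.
Proof.
  destruct T as [|v0 [|v1 [|v2 [|v3 [|v4 T]]]]]; try (intros []; fail).
  intros [HI HU] Hu Hv Huv Hd Hm.
  assert (L0 : Lambda p q v0).
  { apply HU. exists 0%Z, 0%Z, 0%Z. destruct v0 as [[? ?] ?].
    destruct (zsub v1 _) as [[? ?] ?], (zsub v2 _) as [[? ?] ?], (zsub v3 _) as [[? ?] ?].
    unfold zadd, zscale. f_equal; [f_equal|]; ring. }
  (* Expanding the lattice point [v0 + d] yields the integer coordinates of [d]. *)
  destruct (proj1 (HU _) (Hd _ L0)) as (n1 & n2 & n3 & Hn).
  assert (C : forall w, In w [v0; v1; v2; v3] -> exists c1 c2 c3 : Z,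
    ((c1 = 0 /\ c2 = 0 /\ c3 = 0) \/ (c1 = 1 /\ c2 = 0 /\ c3 = 0) \/ (c1 = 0 /\ c2 = 1 /\ c3 = 0) \/
     (c1 = 0 /\ c2 = 0 /\ c3 = 1))%Z /\
    w = zadd v0 (zadd (zscale c1 (zsub v1 v0)) (zadd (zscale c2 (zsub v2 v0)) (zscale c3 (zsub v3 v0))))).
  { assert (Z : forall c1 c2 c3 : Z, zadd v0 (zadd (zscale c1 (zsub v1 v0)) (zadd (zscale c2 (zsub v2 v0)) (zscale c3 (zsub v3 v0)))) =
      (px v0 + (c1 * (px v1 - px v0) + (c2 * (px v2 - px v0) + c3 * (px v3 - px v0))),
       py v0 + (c1 * (py v1 - py v0) + (c2 * (py v2 - py v0) + c3 * (py v3 - py v0))),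
       pz v0 + (c1 * (pz v1 - pz v0) + (c2 * (pz v2 - pz v0) + c3 * (pz v3 - pz v0))))%Z).
    { intros. rewrite <- !px_zsub, <- !py_zsub, <- !pz_zsub.
      destruct (zsub v1 v0) as [[? ?] ?], (zsub v2 v0) as [[? ?] ?], (zsub v3 v0) as [[? ?] ?], v0 as [[? ?] ?].
      reflexivity. }
    intros w [<-|[<-|[<-|[<-|[]]]]]; [exists 0%Z, 0%Z, 0%Z|exists 1%Z, 0%Z, 0%Z|exists 0%Z, 1%Z, 0%Z|exists 0%Z, 0%Z, 1%Z];
      (split; [lia|]); rewrite Z; apply zpt_ext; unfold px at 2, py at 2, pz at 2; cbn [fst snd]; ring. }
  destruct (C u Hu) as (a1 & a2 & a3 & Ha & Ea). destruct (C v Hv) as (b1 & b2 & b3 & Hb & Eb).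
  destruct (HI (IZR (m * n1 - (a1 - b1))) (IZR (m * n2 - (a2 - b2))) (IZR (m * n3 - (a3 - b3)))) as (R1 & R2 & R3).
  - rewrite !rsub_toR. rewrite Ea, Eb in Hm. clear - Hm Hn.
    destruct (zsub v1 v0) as [[x1 y1] z1], (zsub v2 v0) as [[x2 y2] z2], (zsub v3 v0) as [[x3 y3] z3],
      v0 as [[x0 y0] z0], d as [[dx dy] dz].
    assert (N1 := f_equal px Hn). assert (N2 := f_equal py Hn). assert (N3 := f_equal pz Hn).
    assert (M1 := f_equal px Hm). assert (M2 := f_equal py Hm). assert (M3 := f_equal pz Hm).
    clear Hn Hm. cbv [px py pz zscale zsub zadd fst snd] in *.
    unfold toR, rscale, radd, rzero. rewrite <- !mult_IZR, <- !plus_IZR.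
    f_equal; [f_equal|]; apply f_equal.
    + replace dx with (n1 * x1 + (n2 * x2 + n3 * x3))%Z in M1 by lia. lia.
    + replace dy with (n1 * y1 + (n2 * y2 + n3 * y3))%Z in M2 by lia. lia.
    + replace dz with (n1 * z1 + (n2 * z2 + n3 * z3))%Z in M3 by lia. lia.
  - apply eq_IZR in R1, R2, R3.
    assert (H : (m * n1 = 1 \/ m * n1 = -1 \/ m * n2 = 1 \/ m * n2 = -1 \/ m * n3 = 1 \/ m * n3 = -1)%Z).
    { destruct (classic (a1 = b1 /\ a2 = b2 /\ a3 = b3)) as [(-> & -> & ->)|N]; [|lia].
      destruct Huv. rewrite Ea, Eb. reflexivity. }
    assert (D : forall n, (m * n = 1 \/ m * n = -1)%Z -> (m = 1 \/ m = -1)%Z).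
    { intros n [En|En].
      - apply Z.eq_mul_1 in En. auto.
      - apply (Z.eq_mul_1 m (- n)). lia. }
    intuition eauto.
Qed.

(** Being standard fixes only the direction. Between corners the factor is an integer, and
    unimodularity excludes all but 1 and -1. *)
Lemma std_direction_kuhn_edge p q T u v : (0 < q)%Z -> unimodular p q T -> In u T -> In v T ->
  corner q u -> corner q v -> (u <> v -> std_direction q u v) -> kuhn_edge q u v.
Proof.
  intros Hq HU Hu Hv [[xu Xu] [yu Yu]] [[xv Xv] [yv Yv]] Hstd.
  destruct (zpt_eq_dec u v) as [<-|Huv].
  { exists 1%Z, 0%Z, 0%Z, 0%Z. lia. }
  destruct (Hstd Huv) as (a & b & Ia & Ib & Hab & t & Ht).
  assert (Q : IZR q <> 0) by (apply not_0_IZR; lia).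
  rewrite !rsub_toR in Ht.
  assert (D : exists x y z : Z, zsub a b = (q * x, q * y, z)%Z /\
    ((x = 1 \/ x = -1 \/ y = 1 \/ y = -1 \/ z = 1 \/ z = -1) /\
    (0 <= y <= 1 /\ 0 <= z <= 1 /\ 0 <= x + z <= 1 \/ -1 <= y <= 0 /\ -1 <= z <= 0 /\ -1 <= x + z <= 0))%Z).
  { unfold DeltaV in Ia, Ib. cbn [In] in Ia, Ib.
    destruct Ia as [<-|[<-|[<-|[<-|[]]]]]; destruct Ib as [<-|[<-|[<-|[<-|[]]]]];
      try (destruct Hab; reflexivity); unfold zsub, zadd, zscale;
      [exists (-1)%Z, 0%Z, 0%Z|exists 0%Z, 0%Z, (-1)%Z|exists 0%Z, (-1)%Z, (-1)%Z
      |exists 1%Z, 0%Z, 0%Z|exists 1%Z, 0%Z, (-1)%Z|exists 1%Z, (-1)%Z, (-1)%Z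
      |exists 0%Z, 0%Z, 1%Z|exists (-1)%Z, 0%Z, 1%Z|exists 0%Z, (-1)%Z, 0%Z
      |exists 0%Z, 1%Z, 1%Z|exists (-1)%Z, 1%Z, 1%Z|exists 0%Z, 1%Z, 0%Z];
      (split; [apply zpt_ext; cbv [px py pz fst snd]; ring|lia]). }
  destruct D as (x & y & z & Hd & H1 & H2). rewrite Hd in Ht.
  assert (Sz : zsub u v = (q * (xu - xv), q * (yu - yv), pz u - pz v)%Z).
  { apply zpt_ext; rewrite ?px_zsub, ?py_zsub, ?pz_zsub.
    - transitivity (q * (xu - xv))%Z; [lia|reflexivity].
    - transitivity (q * (yu - yv))%Z; [lia|reflexivity].
    - reflexivity. }
  rewrite Sz in Ht. unfold toR, rscale in Ht. rewrite !mult_IZR in Ht. injection Ht as Tx Ty Tz.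
  assert (Tx' : IZR (xu - xv) = t * IZR x) by (apply Rmult_eq_reg_l with (IZR q); auto; lra).
  assert (Ty' : IZR (yu - yv) = t * IZR y) by (apply Rmult_eq_reg_l with (IZR q); auto; lra).
  (* After division by [q] some coordinate of the direction is 1 or -1, and there [t] equals an
     integer difference up to sign. *)
  assert (Tm : exists m, t = IZR m).
  { destruct H1 as [-> |[-> |[-> |[-> |[-> | ->]]]]].
    - exists (xu - xv)%Z. lra.
    - exists (- (xu - xv))%Z. rewrite opp_IZR. lra.
    - exists (yu - yv)%Z. lra.
    - exists (- (yu - yv))%Z. rewrite opp_IZR. lra.
    - exists (pz u - pz v)%Z. lra.
    - exists (- (pz u - pz v))%Z. rewrite opp_IZR. lra. }
  destruct Tm as [m ->]. rewrite <- mult_IZR in Tx', Ty', Tz.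
  apply eq_IZR in Tx', Ty', Tz.
  assert (M : (m = 1 \/ m = -1)%Z).
  { apply (unimodular_primitive p q T u v m (q * x, q * y, z)%Z); auto.
    - intros w. rewrite !Lambda_iff, px_zadd, py_zadd by lia.
      change (px (q * x, q * y, z)%Z) with (q * x)%Z. change (py (q * x, q * y, z)%Z) with (q * y)%Z.
      intros [n Hn]. exists (n + x - y * pprime p q)%Z.
      replace ((n + x - y * pprime p q) * q)%Z with (n * q + q * x - q * y * pprime p q)%Z by ring.
      rewrite <- Hn. ring.
    - rewrite Sz, Tx', Ty', Tz. apply zpt_ext; cbv [px py pz zscale fst snd]; ring. }
  apply (kuhn_edge_intro q u v (yv - yu) (pz v - pz u) ((xv - xu) + (pz v - pz u)))%Z; lia.
Qed.

(** On the lattice x is congruent to p' y modulo [q], and p' is invertible, so [q] divides both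
    coordinates or neither. *)
Lemma corner_Lambda p q v : (1 <= q)%Z -> Z.gcd p q = 1%Z -> Lambda p q v ->
  (q | px v)%Z \/ (q | py v)%Z -> corner q v.
Proof.
  intros Hq Hg. rewrite Lambda_iff by auto. intros HL H.
  assert (Hg' : Z.gcd q (pprime p q) = 1%Z).
  { unfold pprime. rewrite Z.gcd_comm, Z.gcd_mod by lia. rewrite Z.gcd_opp_r, Z.gcd_comm. auto. }
  destruct H as [H|H]; split; auto.
  - apply (Z.gauss q (pprime p q)); auto.
    replace (pprime p q * py v)%Z with (px v - (px v - py v * pprime p q))%Z by ring.
    apply Z.divide_sub_r; auto.
  - replace (px v) with ((px v - py v * pprime p q) + py v * pprime p q)%Z by ring.
    apply Z.divide_add_r; auto. apply Z.divide_mul_l; auto.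
Qed.

(** On the separating plane both tetrahedra show faces with Kuhn edges between corners, hence faces
    of the same Kuhn triangulation. *)
Lemma wall_coherent q a b c d T1 T2 : (0 < q)%Z ->
  (forall v, In v T1 -> (a + b * px v + c * py v + d * pz v <= 0)%Z) ->
  (forall v, In v T2 -> (0 <= a + b * px v + c * py v + d * pz v)%Z) ->
  (forall v, In v T1 \/ In v T2 -> (a + b * px v + c * py v + d * pz v = 0)%Z -> corner q v) ->
  (forall u v, In u T1 -> In v T1 -> (a + b * px u + c * py u + d * pz u = 0)%Z ->
     (a + b * px v + c * py v + d * pz v = 0)%Z -> kuhn_edge q u v) ->
  (forall u v, In u T2 -> In v T2 -> (a + b * px u + c * py u + d * pz u = 0)%Z ->
     (a + b * px v + c * py v + d * pz v = 0)%Z -> kuhn_edge q u v) ->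
  coherent (mem T1) (mem T2).
Proof.
  intros Hq H1 H2 HC K1 K2.
  assert (Ha : forall v, affine (IZR a) (IZR b) (IZR c) (IZR d) v = IZR (a + b * px v + c * py v + d * pz v)).
  { intro v. unfold affine, fx, fy, fz. rewrite !plus_IZR, !mult_IZR. reflexivity. }
  apply (coherent_sep (IZR a) (IZR b) (IZR c) (IZR d)).
  - intros v Hv. rewrite Ha. apply IZR_le; auto.
  - intros v Hv. rewrite Ha. apply IZR_le; auto.
  - apply (kuhn_coherent q); auto; setoid_rewrite Ha.
    + intros v [Hv Hz]. apply eq_IZR in Hz. auto.
    + intros v [Hv Hz]. apply eq_IZR in Hz. auto.
    + intros u v [Hu Hu'] [Hv Hv']. apply eq_IZR in Hu'. apply eq_IZR in Hv'. auto.
    + intros u v [Hu Hu'] [Hv Hv']. apply eq_IZR in Hu'. apply eq_IZR in Hv'. auto.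
Qed.

(** * Gluing *)

Lemma zsub_translate t u v : zsub (zadd t u) (zadd t v) = zsub u v.
Proof. apply zpt_ext; rewrite ?px_zsub, ?py_zsub, ?pz_zsub, ?px_zadd, ?py_zadd, ?pz_zadd; ring. Qed.

Lemma Lambda_translate p q t v : (1 <= q)%Z -> Lambda p q t -> (Lambda p q (zadd t v) <-> Lambda p q v).
Proof.
  intros Hq. rewrite !Lambda_iff, px_zadd, py_zadd by auto. intros [m Hm].
  split; intros [n Hn]; [exists (n - m)%Z|exists (m + n)%Z]; lia.
Qed.

Lemma unimodular_translate p q t T : (1 <= q)%Z -> Lambda p q t -> unimodular p q T ->
  unimodular p q (map (zadd t) T).
Proof.
  intros Hq Ht.
  destruct T as [|v0 [|v1 [|v2 [|v3 [|v4 T]]]]]; try (intros []; fail).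
  unfold unimodular, aff_indep; cbn [map]. rewrite !rsub_toR, !zsub_translate. intros [HI HU].
  split; [exact HI|]. intro w.
  replace w with (zadd t (zsub w t)) at 1
    by (apply zpt_ext; rewrite ?px_zadd, ?py_zadd, ?pz_zadd, ?px_zsub, ?py_zsub, ?pz_zsub; ring).
  rewrite Lambda_translate by auto. rewrite HU.
  split; intros (n1 & n2 & n3 & H); exists n1, n2, n3;
    assert (H1 := f_equal px H); assert (H2 := f_equal py H); assert (H3 := f_equal pz H);
    revert H1 H2 H3; rewrite ?px_zsub, ?py_zsub, ?pz_zsub, ?px_zadd, ?py_zadd, ?pz_zadd; intros H1 H2 H3;
    apply zpt_ext; rewrite ?px_zsub, ?py_zsub, ?pz_zsub, ?px_zadd, ?py_zadd, ?pz_zadd; lia.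
Qed.

Lemma unimodular_aff_indep p q T : unimodular p q T -> aff_indep T.
Proof. destruct T as [|v0 [|v1 [|v2 [|v3 [|v4 T]]]]]; try (intros []; fail). intros [H _]; exact H. Qed.

Lemma coherent_translate_list t T1 T2 : coherent (mem T1) (mem T2) -> coherent (mem (map (zadd t) T1)) (mem (map (zadd t) T2)).
Proof.
  intro H. eapply coherent_mono; [| |apply (coherent_translate t _ _ H)];
    intros v Hv; apply in_map_iff in Hv; destruct Hv as (w & <- & Hw); exists w; auto.
Qed.

Lemma supported_translate t T mu : supported (mem T) mu ->
  exists nu, supported (mem (map (zadd t) T)) nu /\ integral nu f1 = integral mu f1 /\ integral nu fx = fx t * integral mu f1 + integral mu fx /\
   integral nu fy = fy t * integral mu f1 + integral mu fy /\ integral nu fz = fz t * integral mu f1 + integral mu fz.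
Proof.
  intro H. exists (map (fun p => (fst p, zadd t (snd p))) mu). split.
  - apply (supported_map _ (zadd t) mu _ H). intros v Hv. apply in_map; auto.
  - rewrite !integral_map. apply integral_translate.
Qed.

Lemma floor_step q x n : (0 < q)%Z -> (0 < n)%Z -> 0 <= x <= IZR q * IZR n ->
  exists i, (0 <= i < n)%Z /\ IZR q * IZR i <= x <= IZR q * IZR (i + 1).
Proof.
  intros Hq Hn Hx. assert (Q : 0 < IZR q) by (apply IZR_lt; auto).
  destruct (find_step n (IZR q) x) as (i & Hi & H); [auto|lra|lra|].
  exists i. split; [auto|lra].
Qed.

(* The cell with q i <= x <= q (i+1) and q s <= x + q z <= q (s+1); its slice at z = s - i is the
   square in row j, and the last row j = s - i - 1 touches the facet y = q z. *)
Definition cell_shift (q i s j : Z) : zpt := (q * i, q * j, s - i)%Z.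
Definition cells (q k1 k2 : Z) (L0 L1 : list (list zpt)) : list (list zpt) :=
  flat_map (fun i => flat_map (fun s' => flat_map (fun j =>
     map (map (zadd (cell_shift q i (k1 + s') j))) (if Z.eq_dec j (k1 + s' - i - 1) then L1 else L0))
     (zseq (k1 + s' - i))) (zseq k2)) (zseq k1).

Lemma in_cells q k1 k2 L0 L1 T : In T (cells q k1 k2 L0 L1) <-> exists i s j T0,
  (0 <= i < k1)%Z /\ (k1 <= s < k1 + k2)%Z /\ (0 <= j < s - i)%Z /\
  In T0 (if Z.eq_dec j (s - i - 1) then L1 else L0) /\ T = map (zadd (cell_shift q i s j)) T0.
Proof.
  unfold cells. rewrite in_flat_map. split.
  - intros (i & Hi & H). apply in_flat_map in H. destruct H as (s' & Hs & H).
    apply in_flat_map in H. destruct H as (j & Hj & H). apply in_map_iff in H. destruct H as (T0 & <- & H).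
    rewrite in_zseq in Hi, Hs, Hj. exists i, (k1 + s')%Z, j, T0. repeat split; auto; lia.
  - intros (i & s & j & T0 & Hi & Hs & Hj & H & ->).
    exists i. rewrite in_zseq. split; auto. apply in_flat_map. exists (s - k1)%Z. rewrite in_zseq. split; [lia|].
    replace (k1 + (s - k1))%Z with s by lia.
    apply in_flat_map. exists j. rewrite in_zseq. split; auto. apply in_map; auto.
Qed.

(** A form of the property suited to gluing: covering and fitting are expressed by measures, and the
    boundary by pairs of vertices in a common facet. *)
Definition std_triangulation (p q k : Z) (Tr : list (list zpt)) : Prop :=
  (forall T, In T Tr -> Forall (Lambda p q) T /\ unimodular p q T) /\
  (forall T v i, In T Tr -> In v T -> (0 <= facet q k i v)%Z) /\
  (forall x, (forall i, 0 <= facetR q k i x) -> exists T mu, In T Tr /\ supported (mem T) mu /\ barycentre mu x) /\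
  (forall T1 T2, In T1 Tr -> In T2 Tr -> coherent (mem T1) (mem T2)) /\
  (forall T u v i, In T Tr -> In u T -> In v T -> u <> v -> facet q k i u = 0%Z -> facet q k i v = 0%Z ->
     std_direction q u v).

Lemma has_unimod_std_triang_iff p q k : (1 <= q)%Z -> (0 < k)%Z ->
  has_unimod_std_triang p q k <-> exists Tr, std_triangulation p q k Tr.
Proof.
  intros Hq Hk. split.
  - intros (Tr & (H1 & H2 & H3) & HU & HS). exists Tr.
    assert (F : forall T v i, In T Tr -> In v T -> (0 <= facet q k i v)%Z).
    { intros T v i HT Hv. apply (dilate_vertex q k T); auto; try lia.
      intros x Hx. apply H2. eauto. }
    split; [|split; [exact F|split; [|split]]].
    + intros T HT. split; [apply H1|apply HU]; auto.
    + intros x Hx. apply conv_dilate in Hx; try lia. apply H2 in Hx. destruct Hx as (T & HT & Hx).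
      apply conv_barycentre in Hx. destruct Hx as (mu & Hm & Hb). exists T, mu. auto.
    + intros T1 T2 HT1 HT2. destruct (H3 T1 T2 HT1 HT2) as (G & G1 & G2 & HG).
      apply (common_face_coherent T1 T2 G); auto; try (apply H1; auto; fail). intros x Hx; apply HG; auto.
    + intros T u v i HT Hu Hv Huv Fu Fv. apply (HS T u v HT Hu Hv Huv).
      apply (boundary_facet q k u v i); auto; try lia; intro j; apply (F T); auto.
  - intros (Tr & H1 & F & H2 & H3 & HS). exists Tr. split; [split; [|split]|split].
    + intros T HT. split; [apply H1; auto|]. apply (unimodular_aff_indep p q). apply H1; auto.
    + intro x. change (map (zscale k) (DeltaV q)) with (dilate q k). rewrite conv_dilate by lia. split.
      * intro Hx. destruct (H2 x Hx) as (T & mu & HT & Hm & Hb). exists T. split; auto.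
        apply conv_barycentre. eauto.
      * intros (T & HT & Hx). apply (conv_facets q k T); auto. intros v i Hv. apply (F T); auto.
    + intros T1 T2 HT1 HT2. apply coherent_common_face. apply (H3 T1 T2); auto.
    + intros T HT. apply H1; auto.
    + intros T u v HT Hu Hv Huv HB.
      destruct (facet_of_boundary q k u v) as (i & Fu & Fv); auto; try lia.
      * intro j; apply (F T); auto.
      * intro j; apply (F T); auto.
      * apply (HS T u v i); auto.
Qed.

(** Facets 0 and 3 are those along which a given triangulation meets the middle part: x = 0 for the
    translate of the second body, x + q z = q k1 for the first. *)
Lemma std_triangulation_kuhn_edge p q k Tr T u v i : (1 <= q)%Z -> Z.gcd p q = 1%Z -> std_triangulation p q k Tr ->
  In T Tr -> In u T -> In v T -> (i = 0 \/ i = 3)%nat -> facet q k i u = 0%Z -> facet q k i v = 0%Z ->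
  corner q u /\ corner q v /\ kuhn_edge q u v.
Proof.
  intros Hq Hg (H1 & _ & _ & _ & HS) HT Hu Hv Hi Fu Fv.
  assert (C : forall w, In w T -> facet q k i w = 0%Z -> corner q w).
  { intros w Hw Fw. apply (corner_Lambda p); auto.
    - destruct (H1 T HT) as [HL _]. rewrite Forall_forall in HL. auto.
    - left. destruct Hi as [-> | ->]; simpl in Fw; [exists 0%Z|exists (k - pz w)%Z]; lia. }
  assert (Cu := C u Hu Fu). assert (Cv := C v Hv Fv).
  split; [auto|split; [auto|]]. apply (std_direction_kuhn_edge p q T); auto; try lia.
  - apply H1; auto.
  - intro Huv. apply (HS T u v i); auto.
Qed.

Lemma cells_vertex q k1 k2 L0 L1 i s j T0 v : (1 <= q)%Z ->
  (forall T v, In T L0 -> In v T ->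
      (0 <= px v <= q /\ 0 <= px v + q * pz v <= q /\ 0 <= py v <= q + 0 * q * pz v)%Z) ->
  (forall T v, In T L1 -> In v T ->
      (0 <= px v <= q /\ 0 <= px v + q * pz v <= q /\ 0 <= py v <= q + 1 * q * pz v)%Z) ->
  (0 <= i < k1)%Z -> (k1 <= s < k1 + k2)%Z -> (0 <= j < s - i)%Z ->
  In T0 (if Z.eq_dec j (s - i - 1) then L1 else L0) ->
  In v (map (zadd (cell_shift q i s j)) T0) ->
  (q * i <= px v <= q * (i + 1) /\ q * s <= px v + q * pz v <= q * (s + 1) /\
   q * j <= py v <= q * pz v /\ (j < s - i - 1 -> py v <= q * (j + 1)))%Z.
Proof.
  intros Hq B0 B1 Hi Hs Hj HT Hv. apply in_map_iff in Hv. destruct Hv as (w & <- & Hw).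
  rewrite px_zadd, py_zadd, pz_zadd. change (px (cell_shift q i s j)) with (q * i)%Z.
  change (py (cell_shift q i s j)) with (q * j)%Z. change (pz (cell_shift q i s j)) with (s - i)%Z.
  destruct (Z.eq_dec j (s - i - 1)) as [->|Hne].
  - destruct (B1 T0 w HT Hw) as (A1 & A2 & A3). lia.
  - destruct (B0 T0 w HT Hw) as (A1 & A2 & A3).
    (* Height drops by at most 1 below the middle square, and the row is not the last, so its upper
       side still satisfies y <= q z. *)
    assert (-1 <= pz w)%Z by nia.
    assert (q * (j + 1) <= q * (s - i + pz w))%Z by (apply Z.mul_le_mono_nonneg_l; lia).
    lia.
Qed.

Lemma std_triangulation_add p q k1 k2 : (1 <= q)%Z -> Z.gcd p q = 1%Z -> (0 < k1)%Z -> (0 < k2)%Z ->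
  (exists Tr, std_triangulation p q k1 Tr) -> (exists Tr, std_triangulation p q k2 Tr) -> exists Tr, std_triangulation p q (k1 + k2) Tr.
Proof.
  intros Hq Hg Hk1 Hk2 (Tr1 & G1) (Tr2 & G2).
  destruct (cell_exists p q 0 Hq Hg) as (L0 & A0 & B0 & C0 & D0 & E0); [lia|].
  destruct (cell_exists p q 1 Hq Hg) as (L1 & A1 & B1 & C1 & D1 & E1); [lia|].
  set (t2 := (q * k1, 0, 0)%Z : zpt).
  assert (Q : 0 < IZR q) by (apply IZR_lt; lia).
  assert (LT : forall x y z : Z, Lambda p q (q * x, q * y, z)%Z).
  { intros x y z. rewrite Lambda_iff by auto. cbv [px py fst snd]. exists (x - y * pprime p q)%Z. ring. }
  assert (Lt2 : Lambda p q t2) by (apply (LT k1 0%Z 0%Z) || (unfold t2; replace 0%Z with (q * 0)%Z at 1 by ring; apply LT)).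
  assert (K1 := fun T u v i => std_triangulation_kuhn_edge p q k1 Tr1 T u v i Hq Hg G1).
  assert (K2 := fun T u v i => std_triangulation_kuhn_edge p q k2 Tr2 T u v i Hq Hg G2).
  destruct G1 as (U1 & F1 & V1 & W1 & S1). destruct G2 as (U2 & F2 & V2 & W2 & S2).
  assert (Vt2 : forall v, px (zadd t2 v) = (q * k1 + px v)%Z /\ py (zadd t2 v) = py v /\ pz (zadd t2 v) = pz v).
  { intro v. rewrite px_zadd, py_zadd, pz_zadd. repeat split. }
  assert (CV := fun i s j T0 v => cells_vertex q k1 k2 L0 L1 i s j T0 v Hq B0 B1).
  set (inC := fun i s j T => ((0 <= i < k1) /\ (k1 <= s < k1 + k2) /\ (0 <= j < s - i))%Z /\
     exists T0, In T0 (if Z.eq_dec j (s - i - 1) then L1 else L0) /\ T = map (zadd (cell_shift q i s j)) T0).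
  assert (cellA : forall i s j T, inC i s j T -> Forall (Lambda p q) T /\ unimodular p q T).
  { intros i s j T (_ & T0 & HT & ->).
    assert (R : exists v0 v1 v2 v3, T0 = [v0; v1; v2; v3] /\ Forall (Lambda p q) T0 /\
      (vol v0 v1 v2 v3 = q \/ vol v0 v1 v2 v3 = - q)%Z) by (destruct (Z.eq_dec j (s - i - 1)); auto).
    destruct R as (v0 & v1 & v2 & v3 & -> & HL & HV). split.
    - apply Forall_map. eapply Forall_impl; [|exact HL]. intros v Hv.
      apply Lambda_translate; auto. apply LT.
    - apply unimodular_translate; auto; [apply LT|]. apply vol_unimodular; auto. }
  assert (cellK : forall i s j T u v, inC i s j T -> In u T -> In v T -> corner q u -> corner q v -> kuhn_edge q u v).
  { intros i s j T u v (_ & T0 & HT & ->) Hu Hv Cu Cv.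
    apply in_map_iff in Hu. destruct Hu as (u' & <- & Hu). apply in_map_iff in Hv. destruct Hv as (v' & <- & Hv).
    assert (R : forall w, corner q (zadd (cell_shift q i s j) w) -> corner q w).
    { intros w [[a Ha] [b Hb]]. rewrite px_zadd in Ha. rewrite py_zadd in Hb.
      unfold cell_shift in Ha, Hb. split; [exists (a - i)%Z|exists (b - j)%Z];
        [change (px (q * i, q * j, s - i)%Z) with (q * i)%Z in Ha|change (py (q * i, q * j, s - i)%Z) with (q * j)%Z in Hb]; lia. }
    assert (kuhn_edge q u' v') by (destruct (Z.eq_dec j (s - i - 1)); eauto).
    destruct H as (e & a & b & c & H). exists e, a, b, c. rewrite !px_zadd, !py_zadd, !pz_zadd. lia. }
  assert (cellV : forall i s j T v, inC i s j T -> In v T ->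
    (q * i <= px v <= q * (i + 1) /\ q * s <= px v + q * pz v <= q * (s + 1) /\
     q * j <= py v <= q * pz v /\ (j < s - i - 1 -> py v <= q * (j + 1)))%Z).
  { intros i s j T v ((Hi & Hs & Hj) & T0 & HT & ->) Hv. apply (CV i s j T0); auto. }
  assert (cellC : forall i s j T v, inC i s j T -> In v T -> (q | px v)%Z \/ (q | py v)%Z -> corner q v).
  { intros i s j T v HT Hv. apply (corner_Lambda p); auto. destruct (cellA _ _ _ _ HT) as [HL _].
    rewrite Forall_forall in HL. auto. }
  exists (Tr1 ++ map (map (zadd t2)) Tr2 ++ cells q k1 k2 L0 L1).
  assert (Cases : forall T, In T (Tr1 ++ map (map (zadd t2)) Tr2 ++ cells q k1 k2 L0 L1) ->
    In T Tr1 \/ (exists T0, In T0 Tr2 /\ T = map (zadd t2) T0) \/ (exists i s j, inC i s j T)).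
  { intros T HT. rewrite !in_app_iff in HT. destruct HT as [HT|[HT|HT]]; auto.
    - apply in_map_iff in HT. destruct HT as (T0 & <- & HT). right; left. eauto.
    - apply in_cells in HT. destruct HT as (i & s & j & T0 & Hi & Hs & Hj & HT & ->). right; right.
      exists i, s, j. split; auto. eauto. }
  assert (F1' : forall T v, In T Tr1 -> In v T -> (0 <= px v /\ 0 <= py v <= q * pz v /\ px v + q * pz v <= q * k1)%Z).
  { intros T v HT Hv. assert (X0 := F1 T v 0%nat HT Hv). assert (X1 := F1 T v 1%nat HT Hv).
    assert (X2 := F1 T v 2%nat HT Hv). assert (X3 := F1 T v 3%nat HT Hv). simpl in *. lia. }
  assert (F2' : forall T v, In T Tr2 -> In v (map (zadd t2) T) ->
    (q * k1 <= px v /\ 0 <= py v <= q * pz v /\ px v + q * pz v <= q * (k1 + k2))%Z).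
  { intros T v HT Hv. apply in_map_iff in Hv. destruct Hv as (w & <- & Hw). destruct (Vt2 w) as (-> & -> & ->).
    assert (X0 := F2 T w 0%nat HT Hw). assert (X1 := F2 T w 1%nat HT Hw).
    assert (X2 := F2 T w 2%nat HT Hw). assert (X3 := F2 T w 3%nat HT Hw). simpl in *. lia. }
  assert (K2' : forall T u v, In T Tr2 -> In u (map (zadd t2) T) -> In v (map (zadd t2) T) ->
    px u = (q * k1)%Z -> px v = (q * k1)%Z -> corner q u /\ corner q v /\ kuhn_edge q u v).
  { intros T u v HT Hu Hv Xu Xv.
    apply in_map_iff in Hu. destruct Hu as (u' & <- & Hu). apply in_map_iff in Hv. destruct Hv as (v' & <- & Hv).
    destruct (Vt2 u') as (U & U' & U''). destruct (Vt2 v') as (Y & Y' & Y'').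
    destruct (K2 T u' v' 0%nat) as (Cu & Cv & e & a & b & c & H); auto; [simpl; lia|simpl; lia|].
    unfold corner. rewrite U, U', Y, Y'. destruct Cu as [[cu Cu] Cu'], Cv as [[cv Cv] Cv'].
    split; [split; auto; exists (k1 + cu)%Z; lia|]. split; [split; auto; exists (k1 + cv)%Z; lia|].
    exists e, a, b, c. rewrite U, U', U'', Y, Y', Y''. lia. }
  assert (K1' : forall T u v, In T Tr1 -> In u T -> In v T -> (px u + q * pz u = q * k1)%Z ->
    (px v + q * pz v = q * k1)%Z -> corner q u /\ corner q v /\ kuhn_edge q u v).
  { intros T u v HT Hu Hv Xu Xv. apply (K1 T u v 3%nat); auto; simpl; lia. }
  split; [|split; [|split; [|split]]].
  - intros T HT. destruct (Cases T HT) as [H|[(T0 & H & ->)|(i & s & j & H)]]; auto.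
    + split; [|apply unimodular_translate; auto; apply U2; auto].
      apply Forall_map. destruct (U2 T0 H) as [HL _]. eapply Forall_impl; [|exact HL].
      intros v Hv. apply Lambda_translate; auto.
    + apply (cellA i s j T H).
  - intros T v n HT Hv.
    assert (X : (0 <= px v /\ 0 <= py v <= q * pz v /\ px v + q * pz v <= q * (k1 + k2))%Z).
    { destruct (Cases T HT) as [H|[(T0 & H & ->)|(i & s & j & H)]].
      - specialize (F1' T v H Hv). nia.
      - specialize (F2' T0 v H Hv). nia.
      - destruct (cellV i s j T v H Hv) as (X1 & X2 & X3 & _). destruct H as ((Hi & Hs & Hj) & _).
        assert (q * (s + 1) <= q * (k1 + k2))%Z by (apply Z.mul_le_mono_nonneg_l; lia). nia. }
    destruct n as [|[|[|n]]]; unfold facet; lia.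
  - intros [[x y] z] Hx.
    assert (X0 := Hx 0%nat). assert (X1 := Hx 1%nat). assert (X2 := Hx 2%nat). assert (X3 := Hx 3%nat).
    unfold facetR in X0, X1, X2, X3. rewrite plus_IZR in X3.
    destruct (Rle_dec (x + IZR q * z) (IZR q * IZR k1)) as [L|L].
    { destruct (V1 (x, y, z)) as (T & mu & HT & H).
      - intros [|[|[|n]]]; unfold facetR; lra.
      - exists T, mu. split; auto. apply in_app_iff; auto. }
    destruct (Rle_dec (IZR q * IZR k1) x) as [L'|L'].
    { destruct (V2 (x - IZR q * IZR k1, y, z)) as (T & mu & HT & Hm & M1 & M2).
      - intros [|[|[|n]]]; unfold facetR; lra.
      - injection M2 as Mx My Mz. destruct (supported_translate t2 T mu Hm) as (nu & Hn & N1 & N2 & N3 & N4).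
        exists (map (zadd t2) T), nu. split; [|split; [exact Hn|]].
        + rewrite !in_app_iff. right; left. apply in_map; auto.
        + split; [lra|]. rewrite N2, N3, N4, M1, <- Mx, <- My, <- Mz.
          unfold t2, fx, fy, fz, px, py, pz; cbn [fst snd]. rewrite mult_IZR. f_equal; [f_equal|]; ring. }
    destruct (floor_step q x k1) as (i & Hi & Hix); [lia|lia|lra|].
    destruct (floor_step q (x + IZR q * z - IZR q * IZR k1) k2) as (s' & Hs & Hsx); [lia|lia|lra|].
    set (s := (k1 + s')%Z).
    assert (Hb : (0 < s - i)%Z) by (unfold s; lia).
    assert (Hsx' : IZR q * IZR s <= x + IZR q * z <= IZR q * IZR (s + 1)).
    { unfold s. rewrite !plus_IZR in *. lra. }
    clear Hsx.
    (* The last row has no upper wall: it extends to the facet y = q z, so there the bound by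
       [q * (j + 1)] is dropped. *)
    assert (J : exists j, (0 <= j < s - i)%Z /\ IZR q * IZR j <= y /\ ((j = s - i - 1)%Z \/ y <= IZR q * IZR (j + 1))).
    { destruct (Rle_dec (IZR q * IZR (s - i - 1)) y) as [Ly|Ly].
      - exists (s - i - 1)%Z. split; [lia|auto].
      - destruct (Z.eq_dec (s - i) 1) as [e|e].
        { exfalso. apply Ly. rewrite e. simpl. lra. }
        destruct (floor_step q y (s - i - 1)) as (j & Hj & Hjy); [lia|lia|lra|].
        exists j. split; [lia|]. split; [lra|right; lra]. }
    destruct J as (j & Hj & Hjy & Hj').
    set (t := cell_shift q i s j).
    assert (W : exists T0 mu, In T0 (if Z.eq_dec j (s - i - 1) then L1 else L0) /\ supported (mem T0) mu /\
      integral mu f1 = 1 /\ integral mu fx = x - IZR q * IZR i /\ integral mu fy = y - IZR q * IZR j /\ integral mu fz = z - IZR (s - i)).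
    { rewrite !plus_IZR, ?minus_IZR in *.
      destruct (Z.eq_dec j (s - i - 1)) as [->|Hne].
      - rewrite !minus_IZR in *. apply E1; lra.
      - destruct Hj' as [Hj'|Hj']; [lia|]. apply E0; lra. }
    destruct W as (T0 & mu & HT & Hm & M1 & Mx & My & Mz).
    destruct (supported_translate t T0 mu Hm) as (nu & Hn & N1 & N2 & N3 & N4).
    exists (map (zadd t) T0), nu. split; [|split; [exact Hn|]].
    + rewrite !in_app_iff. right; right. apply in_cells. exists i, s, j, T0.
      repeat split; auto; unfold s; lia.
    + split; [lra|]. rewrite N2, N3, N4, M1, Mx, My, Mz.
      unfold t, cell_shift, fx, fy, fz, px, py, pz; cbn [fst snd]. rewrite !mult_IZR. f_equal; [f_equal|]; ring.
  - assert (H12 : forall T1 T2, In T1 Tr1 -> In T2 Tr2 -> coherent (mem T1) (mem (map (zadd t2) T2))).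
    { intros T1 T2 HT1 HT2.
      (* The first body meets the plane x = q k1 only in the vertex (q k1, 0, 0), which lies on its
         facet 3, where the Kuhn property is known. *)
      assert (P1 : forall v, In v T1 -> (- (q * k1) + 1 * px v + 0 * py v + 0 * pz v = 0)%Z -> (px v + q * pz v = q * k1)%Z).
      { intros v Hv Hz. specialize (F1' T1 v HT1 Hv). assert (0 <= q * pz v)%Z by lia. lia. }
      apply (wall_coherent q (- (q * k1)) 1 0 0); [lia|..].
      - intros v Hv. specialize (F1' T1 v HT1 Hv). lia.
      - intros v Hv. specialize (F2' T2 v HT2 Hv). lia.
      - intros v [Hv|Hv] Hz; [apply (K1' T1 v v); auto|apply (K2' T2 v v); auto; lia].
      - intros u v Hu Hv Zu Zv. apply (K1' T1); auto.
      - intros u v Hu Hv Zu Zv. apply (K2' T2); auto; lia. }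
    assert (H1C : forall T1 i s j T, In T1 Tr1 -> inC i s j T -> coherent (mem T1) (mem T)).
    { intros T1 i s j T HT1 HT.
      assert (Hs : (q * k1 <= q * s)%Z) by (destruct HT as ((_ & Hs & _) & _); nia).
      assert (P1 : forall v, In v T -> (- (q * k1) + 1 * px v + 0 * py v + q * pz v = 0)%Z -> corner q v).
      { intros v Hv Hz. apply (cellC i s j T); auto. left. exists (k1 - pz v)%Z. lia. }
      apply (wall_coherent q (- (q * k1)) 1 0 q); [lia|..].
      - intros v Hv. specialize (F1' T1 v HT1 Hv). lia.
      - intros v Hv. destruct (cellV i s j T v HT Hv) as (_ & X & _). lia.
      - intros v [Hv|Hv] Hz; [apply (K1' T1 v v); auto; lia|auto].
      - intros u v Hu Hv Zu Zv. apply (K1' T1); auto; lia.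
      - intros u v Hu Hv Zu Zv. apply (cellK i s j T); auto. }
    assert (H2C : forall T2 i s j T, In T2 Tr2 -> inC i s j T -> coherent (mem T) (mem (map (zadd t2) T2))).
    { intros T2 i s j T HT2 HT.
      assert (Hi : (q * (i + 1) <= q * k1)%Z) by (destruct HT as ((Hi & _) & _); nia).
      assert (P1 : forall v, In v T -> (- (q * k1) + 1 * px v + 0 * py v + 0 * pz v = 0)%Z -> corner q v).
      { intros v Hv Hz. apply (cellC i s j T); auto. left. exists k1. lia. }
      apply (wall_coherent q (- (q * k1)) 1 0 0); [lia|..].
      - intros v Hv. destruct (cellV i s j T v HT Hv) as (X & _). lia.
      - intros v Hv. specialize (F2' T2 v HT2 Hv). lia.
      - intros v [Hv|Hv] Hz; [auto|apply (K2' T2 v v); auto; lia].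
      - intros u v Hu Hv Zu Zv. apply (cellK i s j T); auto.
      - intros u v Hu Hv Zu Zv. apply (K2' T2); auto; lia. }
    (* Different cells are separated by a wall in the first of [i], [s], [j] to be distinguished.
       Rows are compared only within the same [i] and [s], and the lower one is then not the last
       row. *)
    assert (HCC : forall i s j T i' s' j' T', inC i s j T -> inC i' s' j' T' ->
      (i < i' \/ s < s' \/ i = i' /\ s = s' /\ j < j')%Z -> coherent (mem T) (mem T')).
    { intros i s j T i' s' j' T' HT HT' [H|[H|(<- & <- & H)]].
      - assert (Hi : (q * (i + 1) <= q * i')%Z) by nia.
        assert (P1 : forall v, In v T \/ In v T' -> (- (q * i') + 1 * px v + 0 * py v + 0 * pz v = 0)%Z -> corner q v).
        { intros v [Hv|Hv] Hz; [apply (cellC i s j T)|apply (cellC i' s' j' T')]; auto; left; exists i'; lia. }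
        apply (wall_coherent q (- (q * i')) 1 0 0); auto; try lia.
        + intros v Hv. destruct (cellV i s j T v HT Hv) as (X & _). lia.
        + intros v Hv. destruct (cellV i' s' j' T' v HT' Hv) as (X & _). lia.
        + intros u v Hu Hv Zu Zv. apply (cellK i s j T); auto.
        + intros u v Hu Hv Zu Zv. apply (cellK i' s' j' T'); auto.
      - assert (Hs : (q * (s + 1) <= q * s')%Z) by nia.
        assert (P1 : forall v, In v T \/ In v T' -> (- (q * s') + 1 * px v + 0 * py v + q * pz v = 0)%Z -> corner q v).
        { intros v [Hv|Hv] Hz; [apply (cellC i s j T)|apply (cellC i' s' j' T')]; auto; left; exists (s' - pz v)%Z; lia. }
        apply (wall_coherent q (- (q * s')) 1 0 q); auto; try lia.
        + intros v Hv. destruct (cellV i s j T v HT Hv) as (_ & X & _). lia.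
        + intros v Hv. destruct (cellV i' s' j' T' v HT' Hv) as (_ & X & _). lia.
        + intros u v Hu Hv Zu Zv. apply (cellK i s j T); auto.
        + intros u v Hu Hv Zu Zv. apply (cellK i' s' j' T'); auto.
      - assert (Hj : (q * (j + 1) <= q * j')%Z) by nia.
        assert (P1 : forall v, In v T \/ In v T' -> (- (q * j') + 0 * px v + 1 * py v + 0 * pz v = 0)%Z -> corner q v).
        { intros v [Hv|Hv] Hz; [apply (cellC i s j T)|apply (cellC i s j' T')]; auto; right; exists j'; lia. }
        apply (wall_coherent q (- (q * j')) 0 1 0); auto; try lia.
        + intros v Hv. destruct (cellV i s j T v HT Hv) as (_ & _ & _ & X).
          destruct HT' as ((_ & _ & Hj') & _). specialize (X ltac:(lia)). lia.
        + intros v Hv. destruct (cellV i s j' T' v HT' Hv) as (_ & _ & X & _). lia.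
        + intros u v Hu Hv Zu Zv. apply (cellK i s j T); auto.
        + intros u v Hu Hv Zu Zv. apply (cellK i s j' T'); auto. }
    intros T T' HT HT'.
    destruct (Cases T HT) as [H|[(T0 & H & ->)|(i & s & j & H)]];
    destruct (Cases T' HT') as [H'|[(T0' & H' & ->)|(i' & s' & j' & H')]]; auto.
    + eapply H1C; eauto.
    + apply coherent_sym; auto.
    + apply coherent_translate_list; auto.
    + apply coherent_sym; eapply H2C; eauto.
    + apply coherent_sym; eapply H1C; eauto.
    + eapply H2C; eauto.
    + destruct (classic (i < i' \/ s < s' \/ i = i' /\ s = s' /\ j < j')%Z) as [O|O]; [eauto|].
      destruct (classic (i' < i \/ s' < s \/ i' = i /\ s' = s /\ j' < j)%Z) as [O'|O']; [apply coherent_sym; eauto|].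
      assert (i = i' /\ s = s' /\ j = j')%Z as (<- & <- & <-) by lia.
      destruct H as (_ & T0 & HT0 & ->). destruct H' as (_ & T0' & HT0' & ->).
      apply coherent_translate_list. destruct (Z.eq_dec j (s - i - 1)); auto.
  - intros T u v n HT Hu Hv Huv Fu Fv.
    destruct (Cases T HT) as [H|[(T0 & H & ->)|(i & s & j & H)]].
    + destruct n as [|[|[|n]]]; [apply (S1 T u v 0%nat)|apply (S1 T u v 1%nat)|apply (S1 T u v 2%nat)|]; auto.
      (* The facet x + q z = q (k1 + k2) is out of reach of the first body, as the facet x = 0 is of
         the translate treated next. *)
      exfalso. specialize (F1' T u H Hu). unfold facet in Fu. nia.
    + apply in_map_iff in Hu. destruct Hu as (u' & <- & Hu). apply in_map_iff in Hv. destruct Hv as (v' & <- & Hv).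
      assert (Fe : forall m w, facet q k2 (S m) w = facet q (k1 + k2) (S m) (zadd t2 w)).
      { intros m w. destruct (Vt2 w) as (X & Y & Z). destruct m as [|[|m]]; unfold facet; rewrite ?X, ?Y, ?Z; ring. }
      destruct n as [|n].
      { exfalso. unfold facet in Fu. destruct (Vt2 u') as (X & _). rewrite X in Fu.
        assert (P := F2 T0 u' 0%nat H Hu). simpl in P. nia. }
      rewrite <- Fe in Fu, Fv.
      destruct (S2 T0 u' v' (S n)) as (a & b & Ia & Ib & Hab & t & Ht); auto.
      { intros ->. auto. }
      exists a, b. repeat split; auto. exists t. rewrite <- Ht, !rsub_toR, zsub_translate. reflexivity.
    (* Each outer facet forces [q] to divide x or y, so its vertices are corners and Kuhn edges
       inside it are standard. *)
    + assert (C : forall w, In w T -> facet q (k1 + k2) n w = 0%Z -> corner q w).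
      { intros w Hw Fw. apply (cellC i s j T); auto.
        destruct n as [|[|[|n]]]; unfold facet in Fw;
          [left; exists 0%Z|right; exists 0%Z|right; exists (pz w)|left; exists (k1 + k2 - pz w)%Z]; lia. }
      apply (kuhn_edge_std_direction q (k1 + k2) n); auto; try lia. apply (cellK i s j T); auto.
Qed.

Theorem theorem5p7 (p q k1 k2 : Z) :
  (1 <= q)%Z -> Z.gcd p q = 1%Z -> (0 < k1)%Z -> (0 < k2)%Z ->
  has_unimod_std_triang p q k1 -> has_unimod_std_triang p q k2 ->
  has_unimod_std_triang p q (k1 + k2).
Proof.
  intros Hq Hg Hk1 Hk2. rewrite !has_unimod_std_triang_iff by lia. apply std_triangulation_add; auto.
Qed.
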